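(* The sequence $(t_n)_{n\ge 0}$ is strictly increasing. As $n\to\infty$, $$t_n=\log n-\log 4+o(1),\qquad n\,r(n)\longrightarrow 8\pi,\qquad \xi_n\Longrightarrow\frac{\mathrm{d}x}{\pi\sqrt{x(1-x)}},$$ where $\Longrightarrow$ denotes weak convergence of probability measures on $[0,1]$.
   Context: Let $(P_n)_{n\ge 0}$, $\deg P_n=n$, be the orthogonal polynomials on $(-1,1)$ with respect to the weight $\frac{\arcsin x}{x}\,\mathrm{d}x$, normalized by $P_n(1)=1$. The vector $v_n=(v_{n,0},\dots,v_{n,n})^{\mathsf T}\in\mathbb R^{n+1}$ is defined by $$e^{in\theta}P_n(\cos\theta)=\sum_{k=0}^n v_{n,k}e^{2ik\theta}\qquad(\theta\in\mathbb R).$$ Put $L=\log 2$ and let $\psi=\Gamma'/\Gamma$ be the digamma function. Define $$A_n=\left(L+\psi\left(\frac{1+|i-j|}{2}\right)\right)_{0\le i,j\le n},\qquad t_n=v_n^{\mathsf T}A_nv_n,\qquad r(n)=2\pi e^{-t_n}.$$ For $n\ge1$ let $\xi_n=\sum_{k=0}^n v_{n,k}\delta_{k/n}$; it is a probability measure on $[0,1]$, since all $v_{n,k}$ are positive and $\sum_k v_{n,k}=P_n(1)=1$. *)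

(* Defs.v *)
From HB Require Import structures.
From mathcomp Require Import all_boot all_order all_algebra.
From mathcomp Require Import all_classical all_reals all_analysis.
From mathcomp Require Import measurable_realfun complex ring lra.

Set Implicit Arguments.
Unset Strict Implicit.
Unset Printing Implicit Defensive.

Import Order.TTheory GRing.Theory Num.Theory.
Import numFieldNormedType.Exports.

Local Open Scope classical_set_scope.
Local Open Scope ring_scope.

Section polynomials.
Context {R : realType}.

(* At [x = 0] this takes the value [0] instead of the limit [1]; a single point
   does not affect the Lebesgue integrals below. *)
Definition arcsin_weight (x : R) : R := asin x / x.

Definition orthogonal_polynomials (P : nat -> {poly R}) : Prop :=
  [/\ forall n, size (P n) = n.+1,
      forall m n, m <> n ->
        (\int[lebesgue_measure]_(x in `](-1)%R, 1%R[)
           ((P m).[x] * (P n).[x] * arcsin_weight x)%:E = 0)%E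
    & forall n, (P n).[1] = 1].

Definition expi (x : R) : R[i] := (cos x +i* sin x)%C.

Definition fourier_coefficients (P : nat -> {poly R})
    (v : forall n, 'cV[R]_n.+1) : Prop :=
  forall n (theta : R),
    expi (n%:R * theta) * ((P n).[cos theta])%:C%C =
    \sum_(k < n.+1) (v n k 0)%:C%C * expi (2 * k%:R * theta).

End polynomials.

Section digamma.
Context {R : realType}.

Definition Gamma (x : R) : R :=
  \int[lebesgue_measure]_(t in `]0, +oo[) (t `^ (x - 1) * expR (- t)).

Definition digamma (x : R) : R := Gamma^`()%classic x / Gamma x.

Definition digamma_mx (n : nat) : 'M[R]_n.+1 :=
  \matrix_(i, j) (ln 2 + digamma ((1 + `|i%:R - j%:R|) / 2)).

End digamma.

Section energy.
Context {R : realType} (v : forall n, 'cV[R]_n.+1).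

Definition energy (n : nat) : R := ((v n)^T *m digamma_mx n *m v n) 0 0.

Definition energy_radius (n : nat) : R := 2 * pi * expR (- energy n).

End energy.

Section arcsine_law.
Context {R : realType}.
Local Notation mu := (@lebesgue_measure R).

(* The endpoints, where the density is infinite, are null. *)
Definition arcsine_pdf : R -> R :=
  (fun x => (pi * Num.sqrt (x * (1 - x)))^-1) \_ `]0, 1[.

Definition arcsine_prob (A : set R) : \bar R :=
  (\int[mu]_(x in A) (arcsine_pdf x)%:E)%E.

Lemma arcsine_pdf_ge0 x : 0 <= arcsine_pdf x.
Proof.
by apply: restrict_ge0 => {}x _; rewrite invr_ge0 mulr_ge0 ?pi_ge0 ?sqrtr_ge0.
Qed.

Let continuous_arcsine (x : R) : 0 < x < 1 ->
  {for x, continuous (fun x : R => (pi * Num.sqrt (x * (1 - x)))^-1)}.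
Proof.
move=> /andP[x0 x1]; apply: cvgV.
  by rewrite mulf_neq0// gt_eqF ?pi_gt0// sqrtr_gt0 mulr_gt0// subr_gt0.
apply: cvgMl_tmp.
apply: (@continuous_comp _ _ _ (fun x : R => x * (1 - x)) (@Num.sqrt R)).
  by apply: cvgM => //; apply: cvgB => //; exact: cvg_cst.
exact: sqrt_continuous.
Qed.

Lemma measurable_arcsine_pdf : measurable_fun setT arcsine_pdf.
Proof.
rewrite /arcsine_pdf.
apply: (iffLR (@measurable_restrictT _ _ R R `]0, 1[%classic _ _)) => //.
apply: open_continuous_measurable_fun; first exact: interval_open.
by move=> x; rewrite inE/= in_itv/=; exact: continuous_arcsine.
Qed.

Let th (n : nat) : R := pi / 2 * (1 - n.+2%:R^-1).
Let I (n : nat) : set R := `[(1 - sin (th n)) / 2, (1 + sin (th n)) / 2].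

Let th_itv n : 0 < th n < pi / 2.
Proof.
have n2 : (0 : R) < n.+2%:R^-1 by rewrite invr_gt0.
apply/andP; split.
  by rewrite mulr_gt0 ?divr_gt0 ?pi_gt0// subr_gt0 invf_lt1// ltr1n.
by rewrite gtr_pMr ?divr_gt0 ?pi_gt0// gtrBl.
Qed.

Let sin_th n : 0 < sin (th n) < 1.
Proof.
have /andP[h0 h1] := th_itv n; have pi0 := pi_gt0 R.
rewrite sin_gt0_pihalf ?h0//= -(@sin_pihalf R) ltr_sin// in_itv/=; lra.
Qed.

Let asin_sin_th n : asin (sin (th n)) = th n.
Proof.
have /andP[h0 h1] := th_itv n; have pi0 := pi_gt0 R.
by rewrite sinK// in_itv/=; lra.
Qed.

Let asinN_sin_th n : asin (- sin (th n)) = - th n.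
Proof.
have /andP[h0 h1] := th_itv n; have pi0 := pi_gt0 R.
by rewrite -sinN sinK// in_itv/=; lra.
Qed.

Let is_derive_arcsine_cdf (x : R) : 0 < x < 1 ->
  is_derive x 1 (fun x : R => pi^-1 * asin (2 * x - 1))
    (pi * Num.sqrt (x * (1 - x)))^-1.
Proof.
move=> x01; have /andP[x0 x1] := x01.
have xI : -1 < 2 * x - 1 < 1 by lra.
have d1 : is_derive x 1 (fun x : R => 2 * x - 1) 2.
  by apply: is_derive_eq; rewrite subr0 /GRing.scale/= mulr1.
have d2 := is_derive1_asin xI.
have d3 := @is_derive1_comp R (@asin R) (fun x => 2 * x - 1) x _ _ d2 d1.
have d4 := is_deriveZ (pi^-1) d3.
apply: (is_derive_eq d4).
rewrite (_ : 1 - _ = 2 ^+ 2 * (x * (1 - x))); last by ring.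
rewrite sqrtrM// sqrtr_sqr ger0_norm// /GRing.scale/=.
have : Num.sqrt (x * (1 - x)) != 0.
  by rewrite gt_eqF// sqrtr_gt0 mulr_gt0// subr_gt0.
have : (pi : R) != 0 by rewrite gt_eqF ?pi_gt0.
move: (pi : R) (Num.sqrt _) => p s p0 s0; field; exact/andP.
Qed.

Let integral_I n :
  (\int[mu]_(x in I n) (arcsine_pdf x)%:E = (1 - n.+2%:R^-1)%:E)%E.
Proof.
have /andP[s0 s1] := sin_th n.
have sub (x : R) : (1 - sin (th n)) / 2 <= x <= (1 + sin (th n)) / 2 -> 0 < x < 1.
  by lra.
have dF (x : R) : (1 - sin (th n)) / 2 <= x <= (1 + sin (th n)) / 2 ->
    is_derive x 1 (fun x : R => pi^-1 * asin (2 * x - 1))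
      (pi * Num.sqrt (x * (1 - x)))^-1.
  by move=> /sub; exact: is_derive_arcsine_cdf.
have cF (x : R) : (1 - sin (th n)) / 2 <= x <= (1 + sin (th n)) / 2 ->
    {for x, continuous (fun x : R => pi^-1 * asin (2 * x - 1))}.
  move=> /dF h; apply: differentiable_continuous; apply/derivable1_diffP.
  exact: ex_derive.
transitivity (\int[mu]_(x in I n) ((pi * Num.sqrt (x * (1 - x)))^-1)%:E)%E.
  apply: eq_integral => x; rewrite inE /I/= in_itv/= => /sub x01.
  by rewrite /arcsine_pdf patchE mem_set//.
rewrite /I (@continuous_FTC2 _ _ (fun x => pi^-1 * asin (2 * x - 1)))//.
- rewrite (_ : 2 * ((1 + _) / 2) - 1 = sin (th n)); last by field.
  rewrite (_ : 2 * ((1 - _) / 2) - 1 = - sin (th n)); last by field.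
  rewrite asin_sin_th asinN_sin_th -EFinB /th; congr EFin.
  have : (pi : R) != 0 by rewrite gt_eqF ?pi_gt0.
  by move: (pi : R) (n.+2%:R^-1) => p q p0; field.
- lra.
- apply: continuous_in_subspaceT => x; rewrite inE/= in_itv/= => /sub.
  exact: continuous_arcsine.
- split.
  + move=> x; rewrite in_itv/= => /andP[/ltW xl /ltW xr].
    by apply: ex_derive; apply: dF; rewrite xl.
  + by apply/cvg_at_right_filter/cF; lra.
  + by apply/cvg_at_left_filter/cF; lra.
- move=> x; rewrite in_itv/= => /andP[/ltW xl /ltW xr].
  rewrite derive1E; apply: derive_val.
  by apply: dF; rewrite xl.
Qed.

Let cvg_th : 1 - n.+2%:R^-1 @[n --> \oo] --> (1 : R).
Proof.
rewrite -[X in _ --> X]subr0; apply: cvgB; first exact: cvg_cst.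
rewrite (cvg_shiftS (fun n => n.+1%:R^-1 : R)); exact: cvg_harmonic.
Qed.

Let th_nd m n : (m <= n)%N -> th m <= th n.
Proof.
move=> mn; rewrite ler_pM2l ?divr_gt0 ?pi_gt0// lerB// lef_pV2 ?posrE//.
by rewrite ler_nat !ltnS.
Qed.

Let le_sin (x y : R) : - (pi / 2) <= x -> y <= pi / 2 -> x <= y ->
  sin x <= sin y.
Proof.
move=> hx hy; rewrite le_eqVlt => /predU1P[->//|xy].
by rewrite ltW// ltr_sin// in_itv/=; lra.
Qed.

Let sin_th_nd m n : (m <= n)%N -> sin (th m) <= sin (th n).
Proof.
move=> /th_nd mn; have := th_itv m; have := th_itv n; have pi0 := pi_gt0 R.
by move=> ? ?; apply: le_sin; lra.
Qed.

Let bigcup_I : \bigcup_n I n = `]0, 1[%classic.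
Proof.
apply/seteqP; split => x /=.
  move=> [n _]; rewrite /I/= !in_itv/=.
  by have := sin_th n; lra.
rewrite in_itv/= => x01; have pi0 := pi_gt0 R.
have xI : -1 < 2 * x - 1 < 1 by lra.
have /andP[xN1 x1] := xI.
have aN : - (pi / 2) < asin (2 * x - 1) by rewrite asin_gtNpi2// xN1 ltW.
have aP : asin (2 * x - 1) < pi / 2 by rewrite asin_ltpi2// x1 ltW.
have : `|asin (2 * x - 1)| / (pi / 2) < 1.
  by rewrite ltr_pdivrMr ?mul1r ?ltr_norml ?aN// divr_gt0.
move=> /(cvgr_gt _ cvg_th)[n _ /(_ n (leqnn _))/=].
rewrite ltr_pdivrMr ?divr_gt0// [ltRHS]mulrC -/(th n) ltr_norml => /andP[h1 h2].
have hth := th_itv n.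
exists n => //; rewrite /I/= in_itv/=.
have : sin (asin (2 * x - 1)) <= sin (th n) by apply: le_sin; lra.
have : sin (- th n) <= sin (asin (2 * x - 1)).
  by apply: le_sin; lra.
rewrite sinN asinK ?in_itv/= ?(ltW xN1) ?(ltW x1)//; lra.
Qed.

Let nd_I : nondecreasing_seq I.
Proof.
move=> m n /sin_th_nd mn; rewrite subsetEset /I => x/=; rewrite !in_itv/=.
lra.
Qed.

Let arcsine_setT : arcsine_prob [set: R] = 1%E.
Proof.
have mpdf : measurable_fun setT (EFin \o arcsine_pdf).
  by apply/measurable_EFinP; exact: measurable_arcsine_pdf.
transitivity (\int[mu]_(x in \bigcup_n I n) (arcsine_pdf x)%:E)%E.
  rewrite bigcup_I /arcsine_prob integral_mkcond [RHS]integral_mkcond/=.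
  apply: eq_integral => x _; rewrite !patchE in_setT /arcsine_pdf patchE.
  by case: ifPn.
have mI n : measurable (I n) by exact: measurable_itv.
have : (\int[mu]_(x in I n) (arcsine_pdf x)%:E)%E @[n --> \oo] -->
       (\int[mu]_(x in \bigcup_n I n) (arcsine_pdf x)%:E)%E.
  apply: ge0_nondecreasing_set_cvg_integral => // [n|n x _].
    exact: measurable_funTS.
  by rewrite lee_fin arcsine_pdf_ge0.
under eq_cvg do rewrite integral_I.
move=> /cvg_lim <-//; apply/cvg_lim => //.
by apply: cvg_EFin; [exact: nearW|exact: cvg_th].
Qed.

Let arcsine0 : arcsine_prob set0 = 0%E.
Proof. by rewrite /arcsine_prob integral_set0. Qed.

Let arcsine_ge0 A : (0 <= arcsine_prob A)%E.
Proof. by apply: integral_ge0 => x _; rewrite lee_fin arcsine_pdf_ge0. Qed.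

Let arcsine_sigma_additive : semi_sigma_additive arcsine_prob.
Proof.
move=> /= F mF tF mUF; rewrite /arcsine_prob; apply: cvg_toP.
  apply: ereal_nondecreasing_is_cvgn => m n mn.
  apply: lee_sum_nneg_natr => // k _ _; exact: arcsine_ge0.
rewrite ge0_integral_bigcup//=.
- apply/measurable_funTS/measurableT_comp => //.
  exact: measurable_arcsine_pdf.
- by move=> x _; rewrite lee_fin arcsine_pdf_ge0.
Qed.

HB.instance Definition _ := isMeasure.Build _ _ _
  arcsine_prob arcsine0 arcsine_ge0 arcsine_sigma_additive.

HB.instance Definition _ :=
  @Measure_isProbability.Build _ _ R arcsine_prob arcsine_setT.

End arcsine_law.

Section weak_convergence.
Context {R : realType}.

Definition coefficient_measures (v : forall n, 'cV[R]_n.+1)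
    (xi : nat -> probability R R) : Prop :=
  forall n, (0 < n)%N -> forall A : set R, measurable A ->
    xi n A = (\sum_(k < n.+1) (v n k 0)%:E * \d_((k%:R / n%:R)%R : R) A)%E.

(* For probability measures carried by [0, 1]; every function continuous on
   this compact interval is bounded there. *)
Definition weakly_converges01 (mu_ : nat -> probability R R)
    (mu : probability R R) : Prop :=
  forall f : R -> R, {within `[0, 1], continuous f} ->
    (\int[mu_ n]_(x in `[0%R, 1%R]) (f x)%:E)%E @[n --> \oo] -->
    (\int[mu]_(x in `[0%R, 1%R]) (f x)%:E)%E.

End weak_convergence.

(* Main.v *)
(* Put a(m) = log 2 + psi((1+m)/2) and b(k) = a(k+1) - a(k). Then b(k) + b(k-1) = 2/k
   and b(0) = 2 log 2, the recursion satisfied by (2/pi) times the integrals of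
   the Chebyshev polynomials U_{2k} against the weight. Expanding
   P_n(cos t) sin((2i+1-n)t) in sines turns orthogonality to U_{2i-n} into
   sum_j v_{n,j} b(i-j) = 0 for i < n: all rows of A_n v_n equal t_n, so v_n is
   the equilibrium measure of {0,...,n} for the logarithmic kernel a(|i-j|).

   The kernel a(n+1) - a(|i-j|) is positive definite, a combination of triangle
   functions with positive weights b(k) - b(k+1). A maximum principle gives
   v_n >= 0, and strict negativity of the form on vectors of zero sum gives
   t_n < t_{n+1}.

   Testing against the uniform measure on {0,...,n} gives
   t_n = log n + E[H(xi_n)] - 1 + o(1), H(x) = x log x + (1-x) log(1-x), and shows
   that max_k v_{n,k} = O(1/log n). The difference of rows i+1 and i-1 reads
   sum_{j <> i} v_{n,j}/(i-j) = 0 for 0 < i < n. Multiplied by v_{n,i} f(i/n) with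
   f(x) = x^(k+1) - x^(k+2) and symmetrized, the diagonal being negligible, it
   gives sum_{a <= k} M_a M_{k-a} -> 1 for the moments M_k of xi_n. Hence M_k tends to
   the k-th arcsine moment, and xi_n converges weakly by Weierstrass. Finally
   E[H] = 1 - 2 log 2 for the arcsine law. *)

(* Everything about [digamma] comes from its functional equation and from ln x - 1/x <= digamma x <=
   ln x. For the signs of b and its differences: their recursions relate indices two apart, and a
   sequence that decreases along each parity class with limit 0 is positive.

   Since v_n has sum 1, passing from a(|i-j|) to a(n+1) - a(|i-j|) keeps all rows equal. The index
   n+1 exceeds every distance in {0,...,n}, as the expansion in triangles requires; the triangle of
   height 1 is the identity matrix, hence strictness.

   The bound on max_k v_{n,k} compares two estimates of t_n: row i gives t_n <= (1 - v_{n,i})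
   log(n+1), as a(0) <= 0, and the uniform measure gives t_n >= log n - O(1). It is what makes the
   diagonal of the symmetrized equations negligible. The test function must vanish at 0 and 1
   because rows i+1 and i-1 both exist only for 0 < i < n. In the limit the generating function M(z)
   of the moments satisfies M(z)^2 = 1/(1-z), and (1-z)^(-1/2) generates the arcsine moments. *)
Require Import Defs.
From HB Require Import structures.
From mathcomp Require Import all_boot all_order all_algebra.
From mathcomp Require Import all_classical all_reals all_analysis.
From mathcomp Require Import measurable_realfun complex ring lra zify.

Set Implicit Arguments.
Unset Strict Implicit.
Unset Printing Implicit Defensive.

Import Order.TTheory GRing.Theory Num.Theory.
Import numFieldNormedType.Exports.

Local Open Scope classical_set_scope.
Local Open Scope ring_scope.

(** * Integration along an exhaustion by segments *)

Section exhaustion.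
Context {R : realType}.
Notation mu := (@lebesgue_measure R).

Lemma integrable_exhaustion_cvg (f : R -> R) (J : (set R)^nat) (D : set R) :
  mu.-integrable D (EFin \o f) -> measurable D ->
  (forall n, measurable (J n)) -> nondecreasing_seq J -> \bigcup_n J n = D ->
  (\int[mu]_(x in J n) (f x)%:E)%E @[n --> \oo] --> (\int[mu]_(x in D) (f x)%:E)%E.
Proof.
move=> fi mD mJ ndJ JD.
have JsD n : J n `<=` D by rewrite -JD; exact: bigcup_sup.
rewrite [X in X @ _ --> _](_ : _ =
    (fun n => \int[mu]_(x in D) ((EFin \o f) \_ (J n)) x)%E); last first.
  apply/funext => n; rewrite integral_mkcond [RHS]integral_mkcond.
  apply: eq_integral => x _; rewrite !patchE.
  case: ifPn => xJ; last by rewrite if_same.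
  by rewrite ifT//; apply/mem_set/(JsD n)/set_mem.
have mf : measurable_fun D (EFin \o f) by case/integrableP : fi.
have [] // := @dominated_convergence _ _ _ mu D mD
   (fun n => (EFin \o f) \_ (J n)) (EFin \o f) (abse \o (EFin \o f))%E.
- move=> n; apply/(measurable_restrict _ (mJ n) mD).
  by apply: measurable_funS mf => //; exact: subIsetl.
- apply/aeW => x; rewrite -JD => -[m _ Jmx]; apply: cvg_near_cst.
  exists m => // n /= mn; rewrite patchE mem_set//.
  by move/ndJ: mn => /subsetPset; exact.
- by apply: integrable_abse.
- apply/aeW => x n Dx; rewrite patchE; case: ifPn => // _; rewrite /=.
  by rewrite normr0 lee_fin.
Qed.

(** An improper fundamental theorem: [F] may behave badly at the ends of [D], only its increments
    over the exhausting segments must converge. *)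
Lemma exhaustion_FTC (f F : R -> R) (a b : nat -> R) (D : set R) (l : R) :
  (forall n, a n < b n) -> nondecreasing_seq (fun n => `[a n, b n]%classic) ->
  \bigcup_n `[a n, b n]%classic = D ->
  mu.-integrable D (EFin \o f) ->
  (forall x, D x -> {for x, continuous f}) ->
  (forall x, D x -> is_derive x 1 F (f x)) ->
  F (b n) - F (a n) @[n --> \oo] --> l ->
  \int[mu]_(x in D) f x = l.
Proof.
move=> ab ndJ JD fi cf dF Fl.
have mD : measurable D by rewrite -JD; apply: bigcupT_measurable.
have := integrable_exhaustion_cvg fi mD (fun n => measurable_itv _) ndJ JD.
have JsD n : `[a n, b n]%classic `<=` D.
  by rewrite -JD; exact: (bigcup_sup (i := n)).
have E n : (\int[mu]_(x in `[a n, b n]) (f x)%:E = (F (b n) - F (a n))%:E)%E.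
  rewrite (@continuous_FTC2 _ _ F)//.
  - apply: continuous_in_subspaceT => x; rewrite inE => /(JsD n); exact: cf.
  - have h x : x \in `[a n, b n] -> F @ x --> F x.
      move=> xab; have /dF h : D x by exact: (JsD n).
      by apply/differentiable_continuous/derivable1_diffP; exact: ex_derive.
    split.
    + move=> x xab; apply: ex_derive; apply: dF; apply: (JsD n).
      exact: subset_itv_oo_cc xab.
    + apply/cvg_at_right_filter/h; rewrite in_itv/= lexx/=; exact: ltW.
    + apply/cvg_at_left_filter/h; rewrite in_itv/= lexx andbT; exact: ltW.
  - move=> x xab; rewrite derive1E; apply: derive_val; apply: dF.
    by apply: (JsD n); exact: subset_itv_oo_cc xab.
under eq_fun do rewrite E.
move=> h; rewrite /Rintegral.
have h2 : (F (b n) - F (a n))%:E @[n --> \oo] --> l%:E.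
  by apply: cvg_EFin => //; exact: nearW.
by rewrite (cvg_unique _ h h2).
Qed.

(** The increments of a primitive are the integrals over the segments; monotone convergence carries
    their bound over to [D]. *)
Lemma ge0_exhaustion_integrable (f F : R -> R) (a b : nat -> R) (D : set R) (M : R) :
  (forall n, a n < b n) -> nondecreasing_seq (fun n => `[a n, b n]%classic) ->
  \bigcup_n `[a n, b n]%classic = D ->
  (forall x, D x -> 0 <= f x) ->
  measurable_fun D f ->
  (forall x, D x -> {for x, continuous f}) ->
  (forall x, D x -> is_derive x 1 F (f x)) ->
  (forall n, F (b n) - F (a n) <= M) ->
  mu.-integrable D (EFin \o f).
Proof.
move=> ab ndJ JD f0 mf cf dF FM.
have mD : measurable D by rewrite -JD; apply: bigcupT_measurable.
have JsD n : `[a n, b n]%classic `<=` D.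
  by rewrite -JD; exact: (bigcup_sup (i := n)).
have E n : (\int[mu]_(x in `[a n, b n]) (f x)%:E = (F (b n) - F (a n))%:E)%E.
  have fi : mu.-integrable `[a n, b n] (EFin \o f).
    apply: continuous_compact_integrable; first exact: segment_compact.
    apply: continuous_in_subspaceT => x; rewrite inE => /(JsD n); exact: cf.
  have <- : \int[mu]_(x in `[a n, b n]) f x = F (b n) - F (a n).
    apply: (@exhaustion_FTC f F (fun=> a n) (fun=> b n)) => //.
    - by rewrite bigcup_const.
    - by move=> x /(JsD n); exact: cf.
    - by move=> x /(JsD n); exact: dF.
    - exact: cvg_cst.
  by rewrite /Rintegral fineK//; exact: integrable_fin_num.
apply/integrableP; split; first exact/measurable_EFinP.
rewrite (_ : (\int[mu]_(x in D) _)%E = (\int[mu]_(x in D) (f x)%:E)%E); last first.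
  by apply: eq_integral => x; rewrite inE => Dx /=; rewrite ger0_norm// f0.
apply: (@le_lt_trans _ _ M%:E); last exact: ltry.
have h : (\int[mu]_(x in `[a n, b n]) (f x)%:E)%E @[n --> \oo] -->
       (\int[mu]_(x in D) (f x)%:E)%E.
  rewrite -[in X in _ --> X]JD; apply: ge0_nondecreasing_set_cvg_integral => //.
  - by move=> n; apply: measurable_funS (measurableT_comp _ mf) => //.
  - by move=> n x xJ; rewrite lee_fin f0//; exact: (JsD n).
rewrite -(cvg_lim _ h)//; apply: lime_le; first by apply/cvg_ex; eexists; exact: h.
by apply: nearW => n; rewrite E lee_fin.
Qed.

End exhaustion.

(** * The digamma function and the logarithmic kernel *)

Section gamma.
Context {R : realType}.
Notation mu := (@lebesgue_measure R).

Let g (x t : R) : R := t `^ (x - 1) * expR (- t).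

Let a (n : nat) : R := n.+2%:R^-1.
Let b (n : nat) : R := n.+2%:R.

Let ab n : a n < b n.
Proof.
have h : (1 : R) < n.+2%:R by rewrite ltr1n.
rewrite /a /b (@lt_trans _ _ 1)// invf_lt1//; lra.
Qed.

Let ndJ : nondecreasing_seq (fun n => `[a n, b n]%classic).
Proof.
move=> m n mn; rewrite subsetEset => x/=; rewrite !in_itv/= => /andP[h1 h2].
apply/andP; split.
  by apply: le_trans h1; rewrite lef_pV2 ?posrE// ler_nat !ltnS.
by apply: (le_trans h2); rewrite ler_nat !ltnS.
Qed.

Let JD : \bigcup_n `[a n, b n]%classic = `]0, +oo[%classic.
Proof.
apply/seteqP; split => x /=.
  move=> [n _]; rewrite /= !in_itv/= andbT => /andP[+ _].
  by apply: lt_le_trans; rewrite invr_gt0.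
rewrite in_itv/= andbT => x0.
pose n := maxn (Num.truncn x).+1 (Num.truncn x^-1).+1.
have h1 : x <= n%:R.
  rewrite (le_trans (ltW (truncnS_gt x)))// ler_nat leq_maxl//.
have h2 : x^-1 <= n%:R.
  rewrite (le_trans (ltW (truncnS_gt x^-1)))// ler_nat leq_maxr//.
have h3 : (n%:R : R) <= n.+2%:R by rewrite ler_nat; apply: leqW.
exists n => //=; rewrite in_itv/= /a /b (le_trans h1)// andbT.
by rewrite -[leRHS]invrK lef_pV2 ?posrE ?invr_gt0//; apply: le_trans h3.
Qed.

Let continuous_g (x t : R) : 0 < t -> {for t, continuous (g x)}.
Proof.
move=> t0; apply: differentiable_continuous; apply/derivable1_diffP.
apply: derivableM.
  exact: (@ex_derive _ _ _ _ _ _ _ (is_derive1_powR (x - 1) t0)).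
apply: ex_derive.
Qed.

(** Comparison function for the Gamma integrand: of order t^(x-1) at 0 and t^(-2) at infinity, with
    an elementary bounded primitive. *)
Let bd (x t : R) : R := (t / (1 + t)) `^ (x - 1) * (1 + t) ^- 2.

Let bd_derive (x t : R) : 0 < x -> 0 < t ->
  is_derive t 1 (fun t => x^-1 * (t / (1 + t)) `^ x) (bd x t).
Proof.
move=> x0 t0.
have h0 : 0 < t / (1 + t) by apply: divr_gt0 => //; lra.
have d1 : is_derive t 1 (fun t : R => 1 + t) 1.
  have d := is_deriveD (is_derive_cst (1 : R) t 1) (is_derive_id t 1).
  by apply: (is_derive_eq d); rewrite add0r.
have d2 : is_derive t 1 (fun t : R => t / (1 + t)) ((1 + t) ^- 2).
  have nz : 1 + t != 0 by rewrite gt_eqF//; lra.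
  have := is_deriveV (v := 1) nz d1; move=> d3.
  have d4 := is_deriveM (is_derive_id t 1) d3.
  apply: (is_derive_eq d4); rewrite /GRing.scale/= !mulr1.
  by rewrite -exprVn; field.
have d3 := is_derive1_powR x h0.
have d4 := @is_derive1_comp R (@powR R ^~ x) (fun t => t / (1 + t)) t _ _ d3 d2.
have d5 := is_deriveZ (x^-1) d4.
apply: (is_derive_eq d5); rewrite /GRing.scale/= /bd !mulrA mulVf ?gt_eqF// mul1r//.
Qed.

Let continuous_bd (x t : R) : 0 < t -> {for t, continuous (bd x)}.
Proof.
move=> t0.
have nz : 1 + t != 0 by rewrite gt_eqF//; lra.
have h0 : 0 < t / (1 + t) by apply: divr_gt0 => //; lra.
have c1 : {for t, continuous (fun t : R => 1 + t)} by apply: cvgD => //; exact: cvg_cst.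
have c2 : {for t, continuous (fun t : R => (1 + t)^-1)} by apply: cvgV.
apply: cvgM; last first.
  rewrite /prop_for /continuous_at -exprVn expr2.
  under eq_fun do rewrite -exprVn expr2.
  exact: cvgM.
apply: (@continuous_comp _ _ _ (fun t : R => t / (1 + t)) (@powR R ^~ (x - 1))).
  exact: cvgM.
apply: differentiable_continuous; apply/derivable1_diffP.
exact: (@ex_derive _ _ _ _ _ _ _ (is_derive1_powR (x - 1) h0)).
Qed.

Let bd_ge0 (x t : R) : 0 < t -> 0 <= bd x t.
Proof.
by move=> t0; rewrite mulr_ge0 ?powR_ge0// invr_ge0 exprn_ge0//; lra.
Qed.

Let measurable_cont (f : R -> R) : (forall t, 0 < t -> {for t, continuous f}) ->
  measurable_fun (`]0, +oo[%classic : set R) f.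
Proof.
move=> cf; apply: open_continuous_measurable_fun; first exact: interval_open.
by move=> x; rewrite inE/= in_itv/= andbT; exact: cf.
Qed.

Let integrable_bd (x : R) : 0 < x -> mu.-integrable `]0, +oo[ (EFin \o bd x).
Proof.
move=> x0.
apply: (@ge0_exhaustion_integrable _ _ (fun t => x^-1 * (t / (1 + t)) `^ x) a b _ x^-1) => //.
- by move=> t; rewrite /= in_itv/= andbT; exact: bd_ge0.
- by apply: measurable_cont; exact: continuous_bd.
- by move=> t; rewrite /= in_itv/= andbT; exact: continuous_bd.
- by move=> t; rewrite /= in_itv/= andbT; exact: bd_derive.
move=> n; rewrite -mulrBr ger_pMr ?invr_gt0// lerBlDr.
have b0 : 0 < b n by [].
have h : b n / (1 + b n) <= 1 by rewrite ler_pdivrMr; lra.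
rewrite (@le_trans _ _ 1)//; last by rewrite lerDl powR_ge0.
rewrite [leRHS](_ : 1 = 1 `^ x); last by rewrite powR1.
apply: ge0_ler_powR => //; first exact: ltW.
  by rewrite nnegrE divr_ge0// ?addr_ge0// ltW.
by rewrite nnegrE.
Qed.

Let gE (x t : R) : 0 < t -> g x t = expR ((x - 1) * ln t - t).
Proof. by move=> t0; rewrite /g /powR gt_eqF// expRD. Qed.

Let g_ge0 (x t : R) : 0 <= g x t.
Proof. by rewrite mulr_ge0 ?powR_ge0 ?expR_ge0. Qed.

Let ln_leB1 (x : R) : 0 < x -> ln x <= x - 1.
Proof.
by move=> x0; have := @le_ln1Dx R (x - 1); rewrite addrCA subrr addr0; apply; lra.
Qed.

(** After taking logarithms, the claim is an upper bound for (x+1) ln(1+t) - t, which the tangent of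
    ln at x+1 provides. *)
Let g_le_bd (x t : R) : 0 < x -> 0 < t ->
  g x t <= expR (1 + (x + 1) * ln (x + 1)) * bd x t.
Proof.
move=> x0 t0; rewrite gE// /bd /powR gt_eqF ?divr_gt0//; last by lra.
have t1 : 0 < 1 + t by lra.
rewrite (_ : (1 + t) ^- 2 = expR (- (2 * ln (1 + t)))); last first.
  by rewrite expRN -[2]/(2%:R) expRM_natl lnK.
rewrite -!expRD ler_expR ln_div ?posrE//.
have x1 : 0 < x + 1 by lra.
have h : ln (1 + t) <= (1 + t) / (x + 1) - 1 + ln (x + 1).
  rewrite -lerBlDr -ln_div ?posrE//; apply: ln_leB1; exact: divr_gt0.
have : (x + 1) * ln (1 + t) <= (x + 1) * ((1 + t) / (x + 1) - 1 + ln (x + 1)).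
  by rewrite ler_pM2l.
rewrite mulrDr mulrBr mulrCA divff ?gt_eqF// !mulr1; lra.
Qed.

Lemma integrable_Gamma (x : R) : 0 < x ->
  mu.-integrable `]0, +oo[ (fun t => (t `^ (x - 1) * expR (- t))%:E).
Proof.
move=> x0.
have bi : mu.-integrable `]0, +oo[
    (fun t => (expR (1 + (x + 1) * ln (x + 1)) * bd x t)%:E).
  by apply: (integrableZl _ _ (integrable_bd x0)).
apply: le_integrable bi => //.
- by apply/measurable_EFinP; apply: measurable_cont; exact: continuous_g.
- move=> t; rewrite /= in_itv/= andbT => t0; rewrite lee_fin !ger0_norm//.
  + exact: g_le_bd.
  + by rewrite mulr_ge0 ?expR_ge0 ?bd_ge0.
  + exact: g_ge0.
Qed.

Lemma Gamma_gt0 (x : R) : 0 < x -> 0 < Gamma x.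
Proof.
move=> x0.
(* On [1,2] one has 0 <= ln t <= 1 and t <= 2, so the integrand is at least [c], and the interval
   has length 1. *)
pose c : R := expR (- `|x - 1| - 2).
have c0 : 0 < c by exact: expR_gt0.
apply: (lt_le_trans c0).
have fi := integrable_Gamma x0.
rewrite /Gamma /Rintegral -lee_fin fineK; last exact: integrable_fin_num.
rewrite (_ : c%:E = (\int[mu]_(t in `[1%R, 2%R]) c%:E)%E); last first.
  rewrite integral_cst//= lebesgue_measure_itv/= lte_fin ltr1n -EFinD -EFinM.
  by congr EFin; ring.
apply: (@le_trans _ _ (\int[mu]_(t in `[1%R, 2%R]) (g x t)%:E)%E); last first.
  apply: ge0_subset_integral => //.
  - by case/integrableP : fi.
  - by move=> t _; rewrite lee_fin g_ge0.
  - by move=> t; rewrite /= !in_itv/= andbT => /andP[+ _]; exact: lt_le_trans.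
apply: ge0_le_integral => //.
- by move=> t _; rewrite lee_fin ltW.
- case/integrableP : fi => + _; apply: measurable_funS => //.
  by move=> t; rewrite /= !in_itv/= andbT => /andP[+ _]; exact: lt_le_trans.
move=> t; rewrite /= in_itv/= => /andP[t1 t2].
have t0 : 0 < t by lra.
rewrite lee_fin gE// ler_expR lerB// -[leRHS]opprK lerN2.
rewrite (le_trans (ler_norm _))// normrN normrM ler_piMr//.
rewrite ger0_norm ?ln_ge0// (le_trans (ln_leB1 t0))//; lra.
Qed.

(** Integration by parts: x g(x) - g(x+1) is the derivative of t^x e^(-t), whose boundary values are
    both 0. *)
Lemma GammaD1 (x : R) : 0 < x -> Gamma (x + 1) = x * Gamma x.
Proof.
move=> x0; have x10 : 0 < x + 1 by lra.
have i1 := integrable_Gamma x0; have i2 := integrable_Gamma x10.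
have i3 : mu.-integrable `]0, +oo[ (EFin \o (fun t => x * g x t)).
  by under [X in _.-integrable _ X]eq_fun do rewrite /= EFinM; exact: integrableZl.
apply/eqP; rewrite eq_sym -subr_eq0 /Gamma -RintegralZl// -RintegralB//; apply/eqP.
apply: (@exhaustion_FTC _ _ (fun t => t `^ x * expR (- t)) a b) => //.
- by under [X in _.-integrable _ X]eq_fun do rewrite /= EFinB; exact: integrableB.
- move=> t; rewrite /= in_itv/= andbT => t0; apply: cvgB; last exact: continuous_g.
  by apply: cvgMl_tmp; exact: continuous_g.
- move=> t; rewrite /= in_itv/= andbT => t0.
  have d1 := is_derive1_powR x t0.
  have d2 : is_derive t 1 (fun t => expR (- t)) (- expR (- t)).
    by apply: is_derive_eq; rewrite /GRing.scale/= mulrN1.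
  apply: (is_derive_eq (is_deriveM d1 d2)); rewrite /GRing.scale/= addrK; ring.
- have an : a n @[n --> \oo] --> (0 : R).
    rewrite (cvg_shiftS (fun n => n.+1%:R^-1 : R)); exact: cvg_harmonic.
  rewrite -[X in _ --> X]subr0; apply: cvgB.
    (* At infinity, b^x e^(-b) is 1/b times the integrand of Gamma at x + 2, which [g_le_bd] bounds
       by a constant since the comparison function is at most 1 there. *)
    apply: (@squeeze_cvgr _ _ _ _ (cst 0)
      (fun n => expR (1 + (x + 2 + 1) * ln (x + 2 + 1)) * a n)).
    + near=> n; rewrite mulr_ge0 ?powR_ge0 ?expR_ge0//=.
      have b0 : 0 < b n by [].
      rewrite /a -/(b n) ler_pdivlMr// mulrAC.
      rewrite [X in X * _ <= _](_ : _ = b n `^ (x + 2 - 1)); last first.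
        rewrite -[X in _ * X](powRr1 (ltW b0)) -powRD; last by rewrite gt_eqF ?implybT.
        by congr (_ `^ _); ring.
      rewrite -/(g _ _) (le_trans (g_le_bd _ b0))//; first by lra.
      rewrite ler_piMr ?expR_ge0// /bd.
      have b1 : 0 < 1 + b n by rewrite addr_gt0.
      rewrite mulr_ile1 ?powR_ge0 ?invr_ge0 ?exprn_ge0 ?(ltW b1)//.
        rewrite [leRHS](_ : 1 = 1 `^ (x + 2 - 1)); last by rewrite powR1.
        apply: ge0_ler_powR; rewrite ?nnegrE//; first by lra.
          by rewrite divr_ge0// ltW.
        by rewrite ler_pdivrMr// mul1r lerDr.
      by rewrite invf_le1 ?exprn_gt0// exprn_ege1// lerDl ltW.
    + exact: cvg_cst.
    + rewrite -[X in _ --> X](mulr0 (expR (1 + (x + 2 + 1) * ln (x + 2 + 1)))).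
      exact: cvgMl_tmp.
  apply: (@squeeze_cvgr _ _ _ _ (cst 0) (fun n => a n `^ x)).
  + near=> n; rewrite mulr_ge0 ?powR_ge0 ?expR_ge0//= ler_piMr ?powR_ge0//.
    by rewrite expR_le1 oppr_le0 invr_ge0.
  + exact: cvg_cst.
  + have /cvg_at_rightP := powR_cvg0 x0; apply; split => // n.
    by rewrite invr_gt0.
Unshelve. all: end_near. Qed.

Let Gamma_comb (x y c d : R) : 0 < x -> 0 < y ->
  mu.-integrable `]0, +oo[ (EFin \o (fun t => c * g x t + d * g y t)) /\
  \int[mu]_(t in `]0, +oo[) (c * g x t + d * g y t) = c * Gamma x + d * Gamma y.
Proof.
move=> x0 y0; have i1 := integrable_Gamma x0; have i2 := integrable_Gamma y0.
have j1 : mu.-integrable `]0, +oo[ (EFin \o (fun t => c * g x t)).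
  exact: (integrableZl _ _ i1).
have j2 : mu.-integrable `]0, +oo[ (EFin \o (fun t => d * g y t)).
  exact: (integrableZl _ _ i2).
split; first exact: (integrableD _ j1 j2).
by rewrite RintegralD// !RintegralZl.
Qed.

Lemma is_derive_Gamma (x : R) : 0 < x ->
  mu.-integrable `]0, +oo[ (EFin \o (fun t => g x t * ln t)) /\
  is_derive x 1 Gamma (\int[mu]_(t in `]0, +oo[) (g x t * ln t)).
Proof.
move=> x0; pose u := x / 2; pose v := x + 1.
have u0 : 0 < u by rewrite /u; lra.
have dg (y t : R) : 0 < t -> is_derive y 1 (fun y => g y t) (g y t * ln t).
  move=> t0.
  rewrite (_ : (fun y => g y t) = (fun y => expR ((y - 1) * ln t - t))); last first.
    by apply/funext => z; exact: gE.
  have d1 : is_derive y 1 (fun y : R => ln t * y) (ln t).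
    apply: (is_derive_eq (is_deriveZ (ln t) (is_derive_id y 1))).
    by rewrite /GRing.scale/= mulr1.
  have d2 := is_deriveB d1 (is_derive_cst (ln t + t) y 1).
  have d3 := @is_derive1_comp R expR _ y _ _ (is_derive_expR _) d2.
  rewrite (_ : (fun y => _) = (expR \o ((fun y => ln t * y) - cst (ln t + t)))).
    apply: (is_derive_eq d3); rewrite subr0 gE//; congr (expR _ * _).
    by rewrite !fctE; ring.
  by apply/funext => z /=; rewrite !fctE; congr expR; ring.
(* Dominates the derivative in y for all y in (u, v): for t < 1, |ln t| costs (2/u) t^(-u/2); for t
   >= 1, ln t <= t raises the exponent by 1. *)
pose G t := (2 / u) * g (u / 2) t + 1 * g (v + 1) t.
have G0 t : 0 <= G t by rewrite /G mul1r addr_ge0// mulr_ge0// divr_ge0// ltW.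
have iG : mu.-integrable `]0, +oo[ (EFin \o G).
  have p1 : 0 < u / 2 by lra.
  have p2 : 0 < v + 1 by rewrite /v; lra.
  have [h _] := Gamma_comb (2 / u) 1 p1 p2.
  exact: h.
have Gub y t : u < y < v -> 0 < t -> `|g y t * ln t| <= G t.
  move=> /andP[uy yv] t0; rewrite normrM (ger0_norm (g_ge0 _ _)).
  rewrite gE//; have [t1|t1] := leP 1 t.
    have l0 := ln_ge0 t1; rewrite ger0_norm// (@le_trans _ _ (g (v + 1) t))//; last first.
      by rewrite /G mul1r lerDr mulr_ge0// divr_ge0// ltW.
    have : ln t <= expR (ln t) by have := expR_ge1Dx (ln t); lra.
    rewrite gE// => h; apply: (le_trans (ler_wpM2l (expR_ge0 _) h)).
    rewrite -expRD ler_expR; have : y * ln t <= v * ln t by apply: ler_wpM2r => //; exact: ltW.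
    lra.
  have l0 : ln t < 0 by apply: ln_lt0; rewrite t0.
  rewrite ltr0_norm// (@le_trans _ _ (2 / u * g (u / 2) t))//; last by rewrite /G mul1r lerDl.
  have h : - ln t * (u / 2) <= expR (- ln t * (u / 2)).
    by have := expR_ge1Dx (- ln t * (u / 2)); lra.
  rewrite [leRHS]mulrAC ler_pdivlMr//.
  have {}h : - ln t * u <= 2 * expR (- ln t * (u / 2)) by lra.
  rewrite -mulrA; apply: (le_trans (ler_wpM2l (expR_ge0 _) h)).
  rewrite mulrCA ler_pM2l// -expRD gE// ler_expR.
  have : u * - ln t <= y * - ln t by apply: ler_wpM2r; [lra|exact: ltW].
  lra.
have Ix : `]u, v[%classic x by rewrite /= in_itv/= /u /v; apply/andP; split; lra.
have I0 y : `]u, v[%classic y -> 0 < y.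
  by rewrite /= in_itv/= => /andP[+ _]; exact: lt_trans.
have intf y : `]u, v[%classic y -> mu.-integrable `]0, +oo[ (EFin \o g y).
  by move=> /I0; exact: integrable_Gamma.
have E (y t : R) : 0 < t -> partial1of2 g y t = g y t * ln t.
  move=> t0; rewrite partial1of2E; have := dg y _ t0 => d; exact: derive_val.
have der1 (y t : R) : `]u, v[%classic y -> `]0, +oo[%classic t ->
    derivable (fun y => g y t) y 1.
  move=> _; rewrite /= in_itv/= andbT => t0; have := dg y _ t0 => d; exact: ex_derive.
have Gub' (y t : R) : `]u, v[%classic y -> `]0, +oo[%classic t ->
    `|partial1of2 g y t| <= G t.
  rewrite /= !in_itv/= andbT => uv t0; rewrite E//; exact: Gub.
split; last first.
  apply: DeriveDef.
    exact: (derivable_under_integral _ Ix intf der1 G0 iG Gub').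
  rewrite -derive1E (differentiation_under_integral _ Ix intf der1 G0 iG Gub')//.
  apply: eq_Rintegral => t; rewrite inE/= in_itv/= andbT; exact: E.
apply: le_integrable iG => //.
  apply/measurable_EFinP; apply: measurable_cont => t t0.
  by apply: cvgM; [exact: continuous_g|exact: continuous_ln].
move=> t; rewrite /= in_itv/= andbT => t0.
by rewrite lee_fin (ger0_norm (G0 _)); apply: Gub => //; move: Ix; rewrite /= in_itv.
Qed.

Let Gamma' x := \int[mu]_(t in `]0, +oo[) (g x t * ln t).

Lemma digammaE (x : R) : 0 < x -> digamma x = Gamma' x / Gamma x.
Proof.
by move=> x0; rewrite /digamma derive1E; have [_ d] := is_derive_Gamma x0; rewrite derive_val.
Qed.

Lemma digammaD1 (x : R) : 0 < x -> digamma (x + 1) = digamma x + x^-1.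
Proof.
move=> x0; have x10 : 0 < x + 1 by lra.
have [_ d1] := is_derive_Gamma x10; have [_ d0] := is_derive_Gamma x0.
have d : is_derive x 1 (fun y : R => y + 1) 1.
  by apply: (is_derive_eq (is_deriveD (is_derive_id x 1) (is_derive_cst (1 : R) x 1))); rewrite addr0.
have d2 := @is_derive1_comp R Gamma _ x _ _ d1 d.
have d3 := is_deriveM (is_derive_id x 1) d0.
have e : 'D_1 (Gamma \o (fun y : R => y + 1)) x = 'D_1 (id * Gamma) x.
  apply: near_eq_derive => //; near=> y; rewrite !fctE /= GammaD1//.
  by near: y; exact: lt_nbhsr.
move: e; rewrite !derive_val mulr1 /GRing.scale/= mulr1 => e.
rewrite !digammaE// /Gamma' e GammaD1//.
by have := Gamma_gt0 x0; move: (Gamma x) => y y0; field; rewrite !gt_eqF.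
Unshelve. all: end_near. Qed.

Let gD1 (x t : R) : 0 < t -> g (x + 1) t = t * g x t.
Proof.
move=> t0; rewrite !gE// [X in _ = X * _](_ : t = expR (ln t)); last by rewrite lnK.
by rewrite -expRD; congr expR; ring.
Qed.

(** Jensen for ln under the Gamma(x) density, whose mean is x: the tangent bound ln t <= ln x + t/x
    - 1 is integrated. *)
Lemma digamma_le_ln (x : R) : 0 < x -> digamma x <= ln x.
Proof.
move=> x0; have [i1 _] := is_derive_Gamma x0.
have x10 : 0 < x + 1 by lra.
have [i2 E] := Gamma_comb (ln x - 1) x^-1 x0 x10.
rewrite digammaE// ler_pdivrMr ?Gamma_gt0//.
rewrite [leRHS](_ : _ = (ln x - 1) * Gamma x + x^-1 * Gamma (x + 1)); last first.
  by rewrite GammaD1// mulKf ?gt_eqF//; ring.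
rewrite -E; apply: le_Rintegral => // t; rewrite /= in_itv/= andbT => t0.
rewrite gD1// [leRHS](_ : _ = g x t * (ln x - 1 + x^-1 * t)); last by ring.
rewrite ler_wpM2l//.
have := ln_leB1 (divr_gt0 t0 x0); rewrite ln_div// mulrC; lra.
Qed.

(** By the functional equation this is digamma (x+1) >= ln x. It comes from integrating ln t >= ln x
    + 1 - x/t against the Gamma(x+1) density, under which 1/t has mean 1/x. *)
Lemma digamma_ge_ln (x : R) : 0 < x -> ln x - x^-1 <= digamma x.
Proof.
move=> x0; rewrite lerBlDr -digammaD1//.
have x10 : 0 < x + 1 by lra.
have [i1 _] := is_derive_Gamma x10.
have [i2 E] := Gamma_comb (ln x + 1) (- x) x10 x0.
rewrite digammaE// ler_pdivlMr ?Gamma_gt0//.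
rewrite [leLHS](_ : _ = (ln x + 1) * Gamma (x + 1) + (- x) * Gamma x); last first.
  by rewrite GammaD1//; ring.
rewrite -E; apply: le_Rintegral => // t; rewrite /= in_itv/= andbT => t0.
rewrite gD1// [leLHS](_ : _ = g x t * (t * (ln x + 1) - x)); last by ring.
rewrite [leRHS](_ : _ = g x t * (t * ln t)); last by ring.
rewrite ler_wpM2l//.
have h : t * (ln x - ln t) <= t * (x / t - 1).
  by rewrite ler_pM2l// -ln_div ?posrE//; apply: ln_leB1; exact: divr_gt0.
have e : t * (x / t - 1) = x - t by field; rewrite gt_eqF.
by move: h; rewrite e mulrBr; lra.
Qed.

End gamma.

Section inverse_bounds.
Context {R : realType}.

Lemma eq0_of_le_inv (x c : R) : (forall N, `|x| <= c * harmonic N) -> x = 0.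
Proof.
move=> h; apply/eqP; rewrite -normr_eq0 eq_le normr_ge0 andbT leNgt; apply/negP => x0.
have := h (Num.truncn (c / `|x|)); apply/negP; rewrite -ltNge.
by rewrite ltr_pdivrMr// mulrC -ltr_pdivrMr// truncnS_gt.
Qed.

(** Along each parity class the sequence decreases to 0, so it is nonnegative; one further step
    makes it positive. *)
Lemma gt0_of_step2 (x : nat -> R) (c : R) :
  (forall k, x k.+2 < x k) -> (forall k, `|x k| <= c * harmonic k) ->
  forall k, 0 < x k.
Proof.
move=> hs hc.
have c0 : 0 <= c by have := hc 0%N; rewrite /harmonic/= invr1 mulr1; apply: le_trans.
have ge0 k : 0 <= x k.
  have mono j : x (k + j.*2)%N <= x k.
    elim: j => [|j IH]; first by rewrite addn0.
    by rewrite doubleS !addnS (le_trans (ltW (hs _))).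
  rewrite leNgt; apply/negP => xk0.
  suff : x k = 0 by move=> e; move: xk0; rewrite e ltxx.
  apply: (@eq0_of_le_inv _ c) => N; rewrite ltr0_norm//.
  have h1 := mono N; have := hc (k + N.*2)%N.
  rewrite ltr0_norm; last exact: le_lt_trans h1 xk0.
  move=> h2; apply: (@le_trans _ _ (- x (k + N.*2)%N)); first by rewrite lerN2.
  apply: (le_trans h2); rewrite ler_wpM2l// lef_pV2 ?posrE// ler_nat ltnS.
  by rewrite -addnn addnA leq_addl.
by move=> k; exact: le_lt_trans (ge0 k.+2) (hs k).
Qed.

End inverse_bounds.

Definition log_kernel {R : realType} (m : nat) : R :=
  ln 2 + digamma ((1 + m%:R) / 2).

Definition log_kernel_diff {R : realType} (k : nat) : R :=
  log_kernel k.+1 - log_kernel k.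

(* [lra] compares its atoms up to conversion, which is slow on terms such as
   [ln k%:R] or [digamma x]; they are generalized beforehand. *)
Ltac abstract_lra :=
  repeat match goal with
  | H : is_true _ |- _ => revert H
  | H : @eq _ _ _ |- _ => revert H
  end;
  repeat match goal with
  | |- context [@log_kernel_diff ?T ?k] => generalize (@log_kernel_diff T k)
  | |- context [@log_kernel ?T ?k] => generalize (@log_kernel T k)
  | |- context [@harmonic ?T ?k] => generalize (@harmonic T k)
  | |- context [@digamma ?T ?x] => generalize (@digamma T x)
  | |- context [@ln ?T ?x] => generalize (@ln T x)
  end;
  intros; lra.

(** * Growth, monotonicity and concavity of the logarithmic kernel *)

Section log_kernel.
Context {R : realType}.

Local Notation A := (@log_kernel R).
Local Notation B := (@log_kernel_diff R).
Local Notation H := (@harmonic R).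

Lemma harmonic_double (N : nat) : H N = H N.*2.+1 * 2.
Proof.
rewrite /harmonic/= -doubleS -mul2n natrM invfM mulrAC mulVf ?mul1r//.
Qed.

Lemma harmonicS_le k : H k.+1 <= H k.
Proof. by rewrite /harmonic/= lef_pV2 ?posrE// ler_nat. Qed.

Lemma harmonicS_lt k : H k.+1 < H k.
Proof. by rewrite /harmonic/= ltf_pV2 ?posrE// ltr_nat. Qed.

Lemma half_harmonic m : ((1 + m%:R) / 2)^-1 = 2 * H m.
Proof. by rewrite invf_div /harmonic/= -[m.+1%:R]natr1 (addrC 1). Qed.

Lemma half_gt0 (m : nat) : (0 : R) < (1 + m%:R) / 2.
Proof. by rewrite divr_gt0// ltr_pwDl. Qed.

Lemma ln_half (m : nat) : ln m.+1%:R = ln 2 + ln ((1 + m%:R) / 2) :> R.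
Proof.
rewrite -lnM ?posrE ?half_gt0// mulrCA mulfV ?mulr1//.
by rewrite -[m.+1%:R]natr1 addrC.
Qed.

(** Because the argument is halved, a unit step of [digamma] is a step of two in [m]. *)
Lemma log_kernelSS m : A m.+2 = A m + 2 * H m.
Proof.
rewrite /A -half_harmonic -addrA -(digammaD1 (half_gt0 m)).
congr (_ + digamma _); rewrite -(addn2 m) natrD addrA mulrDl mulfV//.
Qed.

Lemma log_kernel_le m : A m <= ln m.+1%:R.
Proof. by rewrite ln_half lerD2l; apply: digamma_le_ln; exact: half_gt0. Qed.

Lemma log_kernel_ge m : ln m.+1%:R - 2 * H m <= A m.
Proof.
by rewrite ln_half -addrA lerD2l -half_harmonic; apply: digamma_ge_ln; exact: half_gt0.
Qed.

Lemma log_kernel_diffD k : B k + B k.+1 = 2 * H k.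
Proof. by rewrite /B log_kernelSS; move: (A k) (A k.+1) (H k) => x y z; ring. Qed.

Lemma lnS_le k : ln k.+2%:R <= ln k.+1%:R + H k.
Proof.
rewrite -lerBlDl -ln_div ?posrE//.
have -> : k.+2%:R / k.+1%:R = 1 + H k.
  by rewrite -[k.+2%:R]natr1 mulrDl divff// mul1r.
by apply: le_ln1Dx; rewrite (@lt_trans _ _ 0)// invr_gt0.
Qed.

Lemma log_kernel_diff_le k : `|B k| <= 3 * H k.
Proof.
have h1 := log_kernel_le k; have h2 := log_kernel_ge k.
have h3 := log_kernel_le k.+1; have h4 := log_kernel_ge k.+1.
have h5 := lnS_le k.
have h6 : ln k.+1%:R <= ln k.+2%:R :> R by rewrite ler_ln ?posrE// ler_nat.
have h7 := harmonicS_le k.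
have h8 : 0 <= H k by exact: harmonic_ge0.
by rewrite ler_norml /B; abstract_lra.
Qed.

(** The quantity b(2N) + 2 (psi(2N+1) - psi(N+1)) does not depend on N: it equals b(0) at N = 0 and
    tends to 2 log 2 by the logarithmic bounds. *)
Lemma log_kernel_diff0 : B 0 = 2 * ln 2.
Proof.
pose D N : R := 2 * (digamma N.*2.+1%:R - digamma N.+1%:R).
have psiS (N : nat) : digamma N.+2%:R = digamma N.+1%:R + H N :> R.
  by rewrite -[N.+2%:R]natr1 digammaD1.
have BD N : B N.*2 + D N = B 0.
  elim: N => [|N <-]; first by rewrite /D subrr mulr0 addr0.
  have e1 := log_kernel_diffD N.*2; have e2 := log_kernel_diffD N.*2.+1.
  have e3 := harmonic_double N.
  by rewrite /D doubleS !psiS; abstract_lra.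
apply/eqP; rewrite -subr_eq0; apply/eqP; apply: (@eq0_of_le_inv _ _ 20) => N.
rewrite -(BD N).
have h0 := log_kernel_diff_le N.*2.
have p1 : (0 : R) < N.*2.+1%:R by [].
have p2 : (0 : R) < N.+1%:R by [].
have h1 : digamma N.*2.+1%:R <= ln N.*2.+1%:R :> R := digamma_le_ln p1.
have h2 : ln N.*2.+1%:R - H N.*2 <= digamma N.*2.+1%:R := digamma_ge_ln p1.
have h3 : digamma N.+1%:R <= ln N.+1%:R :> R := digamma_le_ln p2.
have h4 : ln N.+1%:R - H N <= digamma N.+1%:R := digamma_ge_ln p2.
have h5 : ln N.*2.+1%:R <= ln N.*2.+2%:R :> R by rewrite ler_ln ?posrE// ler_nat.
have h6 := lnS_le N.*2.
have h7 : ln N.*2.+2%:R = ln 2 + ln N.+1%:R :> R.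
  by rewrite -lnM ?posrE// -natrM mul2n doubleS.
have h8 : H N.*2 <= H N.
  by rewrite /harmonic/= lef_pV2 ?posrE// ler_nat ltnS -addnn leq_addr.
have h9 : 0 <= H N by exact: harmonic_ge0.
move: h0; rewrite !ler_norml /D => h0; abstract_lra.
Qed.

Lemma log_kernel_diff_gt0 k : 0 < B k.
Proof.
apply: (@gt0_of_step2 _ _ 3); last exact: log_kernel_diff_le.
move=> {}k; have e1 := log_kernel_diffD k; have e2 := log_kernel_diffD k.+1.
have := harmonicS_lt k; abstract_lra.
Qed.

(** The recursion turns the two-step difference of b(k) - b(k+1) into a second difference of the
    convex sequence 1/(k+1). *)
Lemma log_kernel_diff_decr k : B k.+1 < B k.
Proof.
rewrite -subr_gt0; move: k; apply: (@gt0_of_step2 _ _ 6) => k; last first.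
  have h1 := log_kernel_diff_le k; have h2 := log_kernel_diff_le k.+1.
  have h7 := harmonicS_le k;
  apply: (le_trans (ler_normB _ _)); apply: (le_trans (lerD h1 h2)).
  by abstract_lra.
have e1 := log_kernel_diffD k; have e2 := log_kernel_diffD k.+1.
have e3 := log_kernel_diffD k.+2.
suff : 2 * H k.+1 < H k + H k.+2 by abstract_lra.
have -> : H k = (k.+2%:R - 1)^-1 by rewrite -[k.+2%:R]natr1 addrK.
have -> : H k.+2 = (k.+2%:R + 1)^-1 by rewrite natr1.
rewrite {1}/harmonic/=; have : (1 : R) < k.+2%:R by rewrite ltr1n.
move: (k.+2%:R : R) => x {e1 e2 e3} x1; rewrite -subr_gt0.
have -> : (x - 1)^-1 + (x + 1)^-1 - 2 * x^-1 = 2 / ((x - 1) * (x + 1) * x).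
  by field; rewrite !gt_eqF//; lra.
by rewrite divr_gt0// !mulr_gt0//; lra.
Qed.

End log_kernel.

(** * Integrals against the arcsine weight *)

Section asin_facts.
Context {R : realType}.
Local Notation w := (@arcsin_weight R).
Notation mu := (@lebesgue_measure R).

Lemma asinN (x : R) : -1 <= x <= 1 -> asin (- x) = - asin x.
Proof.
move=> x1; have h1 := asin_geNpi2 x1; have h2 := asin_lepi2 x1.
have e : sin (asin x) = x by apply: asinK; rewrite in_itv.
by rewrite -{1}e -sinN sinK// in_itv/=; apply/andP; split; rewrite ?lerN2// lerNl.
Qed.

Lemma asin_0 : asin (0 : R) = 0.
Proof. by rewrite -[X in asin X](@sin0 R) sinK// in_itv/= oppr_le0 divr_ge0 ?pi_ge0. Qed.

(** The constant is crude: for x > 1/2 it follows from pi/2 < 2, for 0 < x <= 1/2 from the mean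
    value theorem with sqrt(1 - c^2) >= 1/4. *)
Lemma asin_le4 (x : R) : -1 < x < 1 -> `|asin x| <= 4 * `|x|.
Proof.
wlog x0 : x / 0 < x => [hw|].
  move=> x1; case: (ltgtP 0 x) => [x0|x0|<-]; first exact: hw.
    rewrite -normrN -[leRHS]mulrC -[X in X * _]normrN -asinN; last by lra.
    by rewrite mulrC; apply: hw; lra.
  by rewrite asin_0 normr0 mulr0.
move=> /andP[_ x1].
have [xh|xh] := leP x (1 / 2); last first.
  have xx : -1 <= x <= 1 by lra.
  rewrite (ger0_norm (ltW x0)) (@le_trans _ _ 2)//; last by lra.
  have p2 := @pihalf_lt2 R.
  by rewrite ler_norml (le_trans _ (asin_geNpi2 xx)) ?(le_trans (asin_lepi2 xx))//; lra.
have dA z : z \in `]0, x[ -> is_derive z 1 asin (Num.sqrt (1 - z ^+ 2))^-1.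
  by rewrite in_itv/= => /andP[z0 zx]; apply: is_derive1_asin; lra.
have cA : {within `[0, x], continuous asin}.
  apply: continuous_in_subspaceT => z; rewrite inE/= in_itv/= => /andP[z0 zx].
  by apply: continuous_asin; lra.
have [c cx] := MVT x0 dA cA.
rewrite asin_0 !subr0 => ->; move: cx; rewrite in_itv/= => /andP[c0 cx].
rewrite normrM ler_wpM2r// ger0_norm ?invr_ge0 ?sqrtr_ge0//.
have c2 : c ^+ 2 <= (1 / 2) ^+ 2 by rewrite ler_sqr ?nnegrE; lra.
have c3 : (1 / 4) ^+ 2 <= 1 - c ^+ 2 by move: c2; rewrite !expr2; lra.
have h : 1 / 4 <= Num.sqrt (1 - c ^+ 2).
  by rewrite -[leLHS]ger0_norm; [rewrite -sqrtr_sqr ler_sqrt//; lra|lra].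
by rewrite -[leRHS]invrK lef_pV2 ?posrE; lra.
Qed.

Lemma arcsin_weight_bounded (x : R) : -1 < x < 1 -> `|w x| <= 4.
Proof.
move=> x1; have [->|x0] := eqVneq x 0; first by rewrite /arcsin_weight invr0 mulr0 normr0.
by rewrite /arcsin_weight normrM normfV ler_pdivrMr ?normr_gt0// asin_le4.
Qed.

Lemma continuous_arcsin_weight (x : R) : -1 < x < 1 -> x != 0 -> {for x, continuous w}.
Proof.
move=> x1 x0; apply: cvgM; first exact: continuous_asin.
exact: cvgV.
Qed.

Lemma measurable_arcsin_weight : measurable_fun (`]-1, 1[%classic : set R) w.
Proof.
(* The weight is discontinuous at 0, where it takes the value 0; the point is split off. *)
have E : (`]-1, 1[%classic : set R) = (`]-1, 0[ `|` `]0, 1[) `|` [set 0].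
  apply/seteqP; split => x /=; rewrite !in_itv/=.
    move=> /andP[x1 x2]; have [x0|x0|->] := ltgtP x 0; [left; left|left; right|by right].
      by rewrite x1.
    by rewrite x2.
  by move=> [[/andP[? ?]|/andP[? ?]]| ->]; apply/andP; split; lra.
rewrite E; apply/measurable_funU => //; first exact: measurableU.
split; last exact: measurable_fun_set1.
apply/measurable_funU => //; split; apply: open_continuous_measurable_fun.
- exact: interval_open.
- move=> x; rewrite inE/= in_itv/= => /andP[h1 h2].
  by apply: continuous_arcsin_weight; [lra|rewrite lt_eqF].
- exact: interval_open.
- move=> x; rewrite inE/= in_itv/= => /andP[h1 h2].
  by apply: continuous_arcsin_weight; [lra|rewrite gt_eqF].
Qed.

Lemma horner_bounded (q : {poly R}) : exists2 M, 0 <= M &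
  forall x, -1 <= x <= 1 -> `|q.[x]| <= M.
Proof.
exists (\sum_(i < size q) `|q`_i|); first exact: sumr_ge0.
move=> x x1; rewrite horner_coef; apply: (le_trans (ler_norm_sum _ _ _)).
apply: ler_sum => i _; rewrite normrM ler_piMr// normrX exprn_ile1//.
by rewrite ler_norml.
Qed.

Lemma continuous_horner (q : {poly R}) : continuous (fun x => q.[x]).
Proof.
elim/poly_ind: q => [|p c IH] x.
  by under eq_fun do rewrite horner0; exact: cvg_cst.
rewrite /continuous_at hornerMXaddC; under eq_fun do rewrite hornerMXaddC.
by apply: cvgD; [apply: cvgM => //; exact: IH|exact: cvg_cst].
Qed.

Definition arcsin_int (q : {poly R}) : R :=
  \int[mu]_(x in `]-1, 1[) (q.[x] * w x).

Lemma integrable_arcsin (q : {poly R}) :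
  mu.-integrable `]-1, 1[ (EFin \o (fun x => q.[x] * w x)).
Proof.
apply: measurable_bounded_integrable => //.
- by rewrite /= lebesgue_measure_itv/= lte_fin; case: ifP => _; rewrite ?ltry// -EFinD ltry.
- apply: measurable_funM; last exact: measurable_arcsin_weight.
  apply: measurable_funTS; exact: continuous_measurable_fun (@continuous_horner q).
- have [M M0 hM] := horner_bounded q.
  exists (M * 4); split; first exact: num_real.
  move=> c cM x; rewrite /= in_itv/= => x1; rewrite (le_trans _ (ltW cM))// normrM.
  apply: ler_pM => //; first by apply: hM; lra.
  exact: arcsin_weight_bounded.
Qed.

Lemma arcsin_intD (p q : {poly R}) : arcsin_int (p + q) = arcsin_int p + arcsin_int q.
Proof.
rewrite /arcsin_int -RintegralD//; try exact: integrable_arcsin.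
by apply: eq_Rintegral => x _; rewrite hornerD mulrDl.
Qed.

Lemma arcsin_intZ (c : R) (q : {poly R}) : arcsin_int (c *: q) = c * arcsin_int q.
Proof.
rewrite /arcsin_int -RintegralZl//; last exact: integrable_arcsin.
by apply: eq_Rintegral => x _; rewrite hornerZ -mulrA.
Qed.

Lemma arcsin_int_orthogonal (P : nat -> {poly R}) (hP : orthogonal_polynomials P) n (q : {poly R}) :
  (size q <= n)%N -> arcsin_int (P n * q) = 0.
Proof.
have [sP oP _] := hP.
have o m : m <> n -> arcsin_int (P n * P m) = 0.
  move=> mn; rewrite /arcsin_int /Rintegral.
  under eq_integral do rewrite hornerM (mulrC (P n).[_]).
  by rewrite oP.
(* Induction on the size of [q]: as [P s] has exact degree s, a multiple of it removes the leading
   term. *)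
elim: {q}(size q) {-2}q (leqnn (size q)) => [|s IH] q sq sn.
  move: sq; rewrite leqn0 size_poly_eq0 => /eqP ->.
  by rewrite mulr0 -(scale0r (0 : {poly R})) arcsin_intZ mul0r.
move: sq; rewrite leq_eqVlt => /orP[/eqP sq|]; last by rewrite ltnS => /IH; exact.
have {}sn : (s < n)%N by rewrite -sq.
have lP : lead_coef (P s) != 0 by rewrite lead_coef_eq0 -size_poly_eq0 sP.
pose c := q`_s / lead_coef (P s).
have -> : P n * q = P n * (q - c *: P s) + c *: (P n * P s).
  by rewrite mulrBr -scalerAr subrK.
rewrite arcsin_intD arcsin_intZ o ?mulr0 ?addr0.
  have sq' : (size (q - c *: P s)%R <= s)%N.
    apply/leq_sizeP => j; rewrite leq_eqVlt => /predU1P[<-|sj].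
      by rewrite coefB coefZ /c /lead_coef sP/= divfK ?subrr//; move: lP; rewrite /lead_coef sP.
    rewrite coefB coefZ !nth_default ?mulr0 ?subrr//; first by rewrite sP.
    by rewrite sq.
  by apply: IH => //; rewrite (leq_trans sq')// ltnW.
by apply/eqP; rewrite ltn_eqF.
Qed.

End asin_facts.

Section arcsine_exhaustion.
Context {R : realType}.
Notation mu := (@lebesgue_measure R).

(** Angles increasing to pi/2. Their sines exhaust (-1,1), and [asin] evaluates exactly at them, so
    boundary terms become values of a primitive in the angle. *)
Definition sine_angle (n : nat) : R := pi / 2 * (1 - harmonic n.+1).
Local Notation th := sine_angle.

Lemma sine_angle_itv n : 0 < th n < pi / 2.
Proof.
have n2 : (0 : R) < harmonic n.+1 by exact: harmonic_gt0.
have n3 : harmonic n.+1 < 1 :> R by rewrite /harmonic/= invf_lt1// ltr1n.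
have p0 := pi_gt0 R; rewrite /th; apply/andP; split.
  by rewrite mulr_gt0 ?divr_gt0//; lra.
by rewrite gtr_pMr ?divr_gt0//; lra.
Qed.

Lemma cvg_sine_angle : th n @[n --> \oo] --> (pi / 2 : R).
Proof.
rewrite -[X in _ --> X]mulr1; apply: cvgMl_tmp.
rewrite -[X in _ --> X]subr0; apply: cvgB; first exact: cvg_cst.
by rewrite (cvg_shiftS (harmonic : nat -> R)); exact: cvg_harmonic.
Qed.

Lemma ler_sin_pihalf (x y : R) : - (pi / 2) <= x -> y <= pi / 2 -> x <= y ->
  sin x <= sin y.
Proof.
move=> hx hy; rewrite le_eqVlt => /predU1P[->//|xy].
by rewrite ltW// ltr_sin// in_itv/=; lra.
Qed.

Lemma sine_angle_nd m n : (m <= n)%N -> sin (th m) <= sin (th n).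
Proof.
move=> mn; have hm := sine_angle_itv m; have hn := sine_angle_itv n.
have p0 := pi_gt0 R.
apply: ler_sin_pihalf; try lra.
rewrite ler_pM2l ?divr_gt0// lerB// /harmonic/= lef_pV2 ?posrE// ler_nat !ltnS//.
Qed.

Lemma sin_sine_angle n : 0 < sin (th n) < 1.
Proof.
have h := sine_angle_itv n; have p0 := pi_gt0 R.
have : sin (th n) < sin (pi / 2) by rewrite ltr_sin ?in_itv/=; lra.
by rewrite sin_pihalf => ->; rewrite sin_gt0_pihalf.
Qed.

Lemma asin_sine_angle n : asin (sin (th n)) = th n.
Proof.
by have h := sine_angle_itv n; have p0 := pi_gt0 R; rewrite sinK// in_itv/=; lra.
Qed.

Lemma asinN_sine_angle n : asin (- sin (th n)) = - th n.
Proof.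
rewrite asinN ?asin_sine_angle//; have := sin_sine_angle n; lra.
Qed.

Lemma sine_angle_exhausts :
  \bigcup_n `[- sin (th n), sin (th n)]%classic = `]-1, 1[%classic.
Proof.
apply/seteqP; split => x /=.
  move=> [n _]; rewrite /= !in_itv/=; have := sin_sine_angle n; lra.
rewrite in_itv/= => xI; have p0 := pi_gt0 R; have /andP[xN1 x1] := xI.
have aN : - (pi / 2) < asin x by rewrite asin_gtNpi2// xN1 ltW.
have aP : asin x < pi / 2 by rewrite asin_ltpi2// x1 ltW.
have h : `|asin x| < pi / 2 by rewrite ltr_norml aN.
have [n _ /(_ n (leqnn _))/=] := cvgr_gt _ cvg_sine_angle _ h.
rewrite ltr_norml => /andP[h1 h2]; have hth := sine_angle_itv n.
exists n => //=; rewrite in_itv/=.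
have : sin (asin x) <= sin (th n) by apply: ler_sin_pihalf; lra.
have : sin (- th n) <= sin (asin x) by apply: ler_sin_pihalf; lra.
by rewrite sinN asinK ?in_itv/= ?(ltW xN1) ?(ltW x1)// => -> ->.
Qed.

Lemma asin_gtlt (x : R) : -1 < x < 1 -> - (pi / 2) < asin x < pi / 2.
Proof.
move=> /andP[xN1 x1]; rewrite asin_gtNpi2 ?xN1 ?(ltW x1)//=.
by rewrite asin_ltpi2// x1 ltW.
Qed.

(* Substitution [x = sin u]. *)
Lemma Rintegral_sin_subst (f G : R -> R) :
  mu.-integrable `]-1, 1[ (EFin \o f) ->
  (forall x, -1 < x < 1 -> {for x, continuous f}) ->
  (forall u, - (pi / 2) < u < pi / 2 -> is_derive u 1 G (f (sin u) * cos u)) ->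
  {for pi / 2, continuous G} -> {for - (pi / 2), continuous G} ->
  \int[mu]_(x in `]-1, 1[) f x = G (pi / 2) - G (- (pi / 2)).
Proof.
move=> fi cf dG G1 G2.
apply: (@exhaustion_FTC _ f (G \o asin)
  (fun n => - sin (th n)) (fun n => sin (th n))) => //.
- by move=> n; have := sin_sine_angle n; lra.
- move=> m n /sine_angle_nd mn; rewrite subsetEset => x /=; rewrite !in_itv/=; lra.
- exact: sine_angle_exhausts.
- move=> x xI; have {}xI : -1 < x < 1 by move: xI; rewrite /= in_itv.
  have d := @is_derive1_comp R G asin x _ _ (dG _ (asin_gtlt xI)) (is_derive1_asin xI).
  apply: (is_derive_eq d).
  have xc : -1 <= x <= 1 by lra.
  rewrite asinK ?in_itv// cos_asin// mulfK// gt_eqF// sqrtr_gt0.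
  rewrite (_ : 1 - x ^+ 2 = (1 - x) * (1 + x)); last by ring.
  by rewrite mulr_gt0; lra.
- rewrite /= ; under eq_fun do rewrite asin_sine_angle asinN_sine_angle.
  apply: cvgB.
    by apply: (@cvg_comp _ _ _ th G _ _ _ cvg_sine_angle); exact: G1.
  apply: (@cvg_comp _ _ _ (fun n => - th n) G _ (nbhs (- (pi / 2)))) => //.
  by apply: cvgN; exact: cvg_sine_angle.
Qed.

End arcsine_exhaustion.

(** * Chebyshev polynomials of the second kind against the weight *)

Section chebyshev.
Context {R : realType}.

Fixpoint chebyshevU (n : nat) : {poly R} :=
  if n is n1.+1 then
    (if n1 is m.+1 then 2 *: ('X * chebyshevU n1) - chebyshevU m else 2 *: 'X)
  else 1.

Arguments chebyshevU : simpl never.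

Local Notation U := chebyshevU.

Lemma chebyshevUSS n : U n.+2 = 2 *: ('X * U n.+1) - U n.
Proof. by []. Qed.

Lemma nat_ind2 (T : nat -> Prop) :
  T 0%N -> T 1%N -> (forall n, T n -> T n.+1 -> T n.+2) -> forall n, T n.
Proof.
move=> h0 h1 h n; suff : T n /\ T n.+1 by case.
by elim: n => // n [a b]; split => //; exact: h.
Qed.

Lemma size_chebyshevU n : (size (U n) <= n.+1)%N.
Proof.
elim/nat_ind2: n => [||n h0 h1]; first by rewrite size_poly1.
  by rewrite (leq_trans (size_scale_leq _ _))// size_polyX.
rewrite chebyshevUSS (leq_trans (size_polyD _ _))// geq_max size_polyN.
rewrite (leq_trans h0) ?andbT; last by do 2 apply: leqW.
rewrite (leq_trans (size_scale_leq _ _))// mulrC.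
have [->|nz] := eqVneq (U n.+1) 0; first by rewrite mul0r size_poly0.
by rewrite size_mulX.
Qed.

Lemma chebyshevU_cos n (t : R) : (U n).[cos t] * sin t = sin (n.+1%:R * t).
Proof.
elim/nat_ind2: n => [||n h0 h1].
- by rewrite hornerC !mul1r.
- have -> : 2 * t = t *+ 2 by rewrite mulr_natl.
  by rewrite sin_mulr2n hornerZ hornerX; ring.
- rewrite chebyshevUSS !hornerE mulrBl h0 -!mulrA h1.
  have -> : n.+3%:R * t = n.+2%:R * t + t by rewrite -[n.+3%:R]natr1 mulrDl mul1r.
  have -> : n.+1%:R * t = n.+2%:R * t - t.
    by rewrite -[n.+2%:R]natr1 mulrDl mul1r addrK.
  by rewrite sinB sinD; ring.
Qed.

Lemma chebyshevU_sin n (u : R) : (U n).[sin u] * cos u = sin (n.+1%:R * (pi / 2 - u)).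
Proof.
rewrite -chebyshevU_cos cosB sinB cos_pihalf sin_pihalf.
by rewrite !mul0r !mul1r add0r subr0.
Qed.

(** The factor x cancels the denominator of the weight. With x = sin u the integrand becomes u
    sin(2(k+1)(pi/2 - u)), which is integrated by parts; as the frequency is even, the cosine is 1
    at both ends. *)
Lemma arcsin_int_XU k : arcsin_int ('X * U k.*2.+1) = pi / k.+1.*2%:R.
Proof.
pose m : R := k.+1.*2%:R.
have m0 : m != 0 by rewrite gt_eqF// ltr0n.
pose G u : R := u * cos (m * (pi / 2 - u)) / m + sin (m * (pi / 2 - u)) / m ^+ 2.
have dG (u : R) : is_derive u 1 G (u * sin (m * (pi / 2 - u))).
  have d0 : is_derive u 1 (fun u : R => m * (pi / 2 - u)) (- m).
    have d := is_deriveZ m (is_deriveB (is_derive_cst (pi / 2 : R) u 1) (is_derive_id u 1)).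
    by apply: (is_derive_eq d); rewrite sub0r /GRing.scale/= mulrN1.
  have d1 := @is_derive1_comp R cos _ u _ _ (is_derive_cos _) d0.
  have d2 := @is_derive1_comp R sin _ u _ _ (is_derive_sin _) d0.
  have d3 := is_deriveD (is_deriveZ (m^-1) (is_deriveM (is_derive_id u 1) d1))
     (is_deriveZ (m^-2) d2).
  rewrite (_ : G = (fun u => m^-1 * (u * cos (m * (pi / 2 - u))) + m ^- 2 * sin (m * (pi / 2 - u)))).
    apply: (is_derive_eq d3); rewrite /GRing.scale/= !mulr1.
    move: (cos _) (sin _) => c s; field.
    exact: m0.
  by apply/funext => z; rewrite /G mulrC [X in _ + X]mulrC.
have Gc (u : R) : {for u, continuous G}.
  apply: differentiable_continuous; apply/derivable1_diffP.
  exact: (@ex_derive _ _ _ _ _ _ _ (dG u)).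
(* At x = 0 the division takes its default value, but both sides vanish. *)
have E (x : R) : ('X * U k.*2.+1).[x] * arcsin_weight x = (U k.*2.+1).[x] * asin x.
  rewrite hornerM hornerX mulrAC /arcsin_weight mulrC; congr (_ * _).
  have [->|x0] := eqVneq x 0; first by rewrite mul0r asin_0.
  by rewrite mulrC divfK.
rewrite /arcsin_int; under eq_Rintegral do rewrite E.
transitivity (G (pi / 2) - G (- (pi / 2))); last first.
  rewrite /G subrr mulr0 cos0 sin0 mul0r addr0 mulr1 opprK -splitr.
  have -> : m * pi = k.+1%:R * (pi *+ 2).
    by rewrite /m -mul2n natrM -mulr_natl; ring.
  have per (j : nat) : cos (j%:R * (pi *+ 2)) = 1 :> R /\ sin (j%:R * (pi *+ 2)) = 0 :> R.
    elim: j => [|j [c s]]; first by rewrite mul0r cos0 sin0.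
    by rewrite -[j.+1%:R]natr1 mulrDl mul1r cosD2pi sinD2pi.
  have [-> ->] := per k.+1.
  by rewrite mul0r addr0 mulr1 mulNr opprK -mulrDl -splitr.
apply: Rintegral_sin_subst => //.
- have := @integrable_arcsin R ('X * U k.*2.+1).
  by apply: eq_integrable => // x _ /=; rewrite E.
- move=> x x1; apply: cvgM; [exact: continuous_horner|exact: continuous_asin].
- move=> u uI; apply: (is_derive_eq (dG u)) => /=.
  rewrite sinK ?in_itv/=; last by lra.
  by rewrite [RHS]mulrAC chebyshevU_sin mulrC.
Qed.

(** The Chebyshev recurrence reads U_{2k} + U_{2k+2} = 2 x U_{2k+1}, and the right-hand side has an
    explicit integral. *)
Lemma arcsin_int_chebyshevD k :
  arcsin_int (U k.*2) + arcsin_int (U k.+1.*2) = pi * harmonic k.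
Proof.
rewrite -arcsin_intD doubleS chebyshevUSS addrC subrK arcsin_intZ arcsin_int_XU.
have k0 : k.+1%:R != 0 :> R by rewrite pnatr_eq0.
by rewrite -mul2n natrM /harmonic/=; field.
Qed.

End chebyshev.

(** * The total mass of the weight *)

Section arcsin_mass.
Context {R : realType}.
Local Notation w := (@arcsin_weight R).
Notation mu := (@lebesgue_measure R).

Lemma eq_of_derive0 (F : R -> R) (a b : R) : a < b ->
  (forall x, a < x < b -> is_derive x 1 F 0) ->
  (forall x, a <= x <= b -> {for x, continuous F}) -> F a = F b.
Proof.
move=> ab dF cF.
have d x : x \in `]a, b[ -> is_derive x 1 F (cst 0 x).
  by rewrite in_itv; exact: dF.
have c : {within `[a, b], continuous F}.
  by apply: continuous_in_subspaceT => x; rewrite inE/= in_itv; exact: cF.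
have [x _] := MVT ab d c.
by rewrite mul0r => /eqP; rewrite subr_eq0 => /eqP.
Qed.

Let f : R -> R := w \_ `]-1, 1[.

(** Starting at -2, with the weight extended by 0, puts -1 and 1 in the interior of the domain, so
    continuity holds there as well. *)
Definition arcsin_primitive (y : R) : R := \int[mu]_(t in `[-2, y]) f t.
Local Notation Xi := arcsin_primitive.

Let iw : mu.-integrable `]-1, 1[ (EFin \o w).
Proof.
have := @integrable_arcsin R 1.
by apply: eq_integrable => // x _ /=; rewrite hornerC mul1r.
Qed.

Let fi (D : set R) : measurable D -> mu.-integrable D (EFin \o f).
Proof.
move=> mD; rewrite /f -restrict_EFin; apply/integrable_restrict => //.
by apply: integrableS iw => //; exact: measurableI.
Qed.

Let fE (x : R) : -1 < x < 1 -> f x = w x.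
Proof. by move=> x1; rewrite /f patchE mem_set//= in_itv. Qed.

Let f0 (x : R) : ~~ (-1 < x < 1) -> f x = 0.
Proof. by move=> x1; rewrite /f patchE memNset//= in_itv/=; exact/negP. Qed.

Lemma continuous_arcsin_primitive (y : R) : -1 <= y <= 1 -> {for y, continuous Xi}.
Proof.
move=> y1.
have h : {within `[(-2 : R), 2], continuous Xi}.
  by apply: parameterized_integral_continuous; [lra|exact: fi].
have l : (-2 : R) < 2 by lra.
have yI : y \in `](-2 : R), 2[ by rewrite in_itv/=; lra.
exact: (within_continuous_continuous l h yI).
Qed.

Lemma is_derive_arcsin_primitive (y : R) : -1 < y < 1 -> y != 0 ->
  is_derive y 1 Xi (w y).
Proof.
move=> y1 y0.
have cf : {for y, continuous f}.
  have : {near y, f =1 w}.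
    have yI : y \in `]-1, 1[ by rewrite in_itv.
    near=> x; apply: fE.
    have : x \in `]-1, 1[ by near: x; exact: near_in_itvoo.
    by rewrite in_itv.
  move=> e; rewrite /prop_for /continuous_at fE//.
  apply: cvg_trans (continuous_arcsin_weight y1 y0).
  by apply: near_eq_cvg; apply: filterS e => x /= ->.
have y2 : y < 2 by lra.
have y3 : -2 < y by lra.
have [d e] := continuous_FTC1_closed y2 (fi (measurable_itv _)) y3 cf.
apply: DeriveDef; first exact: d.
by rewrite -derive1E; rewrite e fE.
Unshelve. all: end_near. Qed.

Lemma arcsin_primitiveN1 : Xi (- 1) = 0.
Proof.
transitivity (\int[mu]_(t in `[-2, (-1 : R)]) (0 : R)); last first.
  by rewrite Rintegral_cst ?mul0r.
apply: eq_Rintegral => x; rewrite inE/= in_itv/= => h; apply: f0; rewrite negb_and -!leNgt; lra.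
Qed.

Lemma arcsin_primitive1 : Xi 1 = arcsin_int 1.
Proof.
rewrite /Xi /arcsin_int Rintegral_mkcond [RHS]Rintegral_mkcond.
apply: eq_Rintegral => x _; rewrite !patchE.
case: ifPn => xI; case: ifPn => xJ => //.
- by rewrite fE ?hornerC ?mul1r//; move: xJ; rewrite inE/= in_itv.
- by apply: f0; apply/negP => h; move/negP: xJ; apply; rewrite inE/= in_itv.
- exfalso; move: xI xJ; rewrite notin_setE inE/= !in_itv/= => /negP; lra.
Qed.

(** The weight is even, so Xi(y) + Xi(-y) is constant on [0,1]. *)
Lemma arcsin_primitive0 : Xi 1 = 2 * Xi 0.
Proof.
have d (y : R) : 0 < y < 1 -> is_derive y 1 (fun y => Xi y + Xi (- y)) 0.
  move=> y1.
  have y0 : y != 0 by rewrite gt_eqF//; lra.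
  have h1 : -1 < y < 1 by lra.
  have h2 : -1 < - y < 1 by lra.
  have d1 := is_derive_arcsin_primitive h1 y0.
  have d2 : is_derive (- y) 1 Xi (w (- y)).
    by apply: is_derive_arcsin_primitive => //; rewrite oppr_eq0.
  have d3 := is_deriveN (is_derive_id y (1 : R)).
  have d4 := @is_derive1_comp R Xi _ y _ _ d2 d3.
  apply: (is_derive_eq (is_deriveD d1 d4)).
  rewrite /arcsin_weight asinN; last by lra.
  by rewrite invrN mulrNN mulrN1 subrr.
have := @eq_of_derive0 (fun y => Xi y + Xi (- y)) 0 1 ltr01 d.
rewrite oppr0 arcsin_primitiveN1 addr0 => <-; first by rewrite mulr_natl mulr2n.
move=> x x1; apply: cvgD; first by apply: continuous_arcsin_primitive; lra.
apply: (@continuous_comp _ _ _ (fun y => - y) Xi); first exact: opp_continuous.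
by apply: continuous_arcsin_primitive; lra.
Qed.

(** A primitive of u cot u on (0, pi/2); it serves both the mass of the weight and the entropy of
    the arcsine law. *)
Definition sine_primitive (u : R) : R := Xi (sin u).
Local Notation Phi := sine_primitive.

Lemma continuous_sine_primitive (u : R) : {for u, continuous Phi}.
Proof.
apply: (@continuous_comp _ _ _ (@sin R) Xi); first exact: continuous_sin.
by apply: continuous_arcsin_primitive; rewrite sin_geN1 sin_le1.
Qed.

Lemma is_derive_sine_primitive (u : R) : 0 < u < pi / 2 ->
  is_derive u 1 Phi (u / sin u * cos u).
Proof.
move=> u1; have p0 := pi_gt0 R.
have s0 : 0 < sin u by exact: sin_gt0_pihalf.
have s1 : sin u < 1.
  have : sin u < sin (pi / 2) by rewrite ltr_sin ?in_itv/=; lra.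
  by rewrite sin_pihalf.
have h1 : -1 < sin u < 1 by lra.
have d1 := is_derive_arcsin_primitive h1 (lt0r_neq0 s0).
have d := @is_derive1_comp R Xi sin u _ _ d1 (is_derive_sin u).
by apply: (is_derive_eq d); rewrite /arcsin_weight sinK// in_itv/=; lra.
Qed.

(** The duplication formula 2 cot 2s = cot s - tan s makes the derivative vanish. At s = pi/4 the
    two occurrences of Phi(pi/4) cancel, so comparison with s = 0 isolates Phi(pi/2) - Phi(0). *)
Let D (s : R) := Phi (2 * s) - 2 * Phi s + 2 * Phi (pi / 2 - s) - pi * ln (cos s).

Let D_cst : D 0 = D (pi / 4).
Proof.
have p0 := pi_gt0 R.
apply: eq_of_derive0; first by lra.
  move=> s s1.
  have h1 : 0 < 2 * s < pi / 2 by lra.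
  have h2 : 0 < s < pi / 2 by lra.
  have h3 : 0 < pi / 2 - s < pi / 2 by lra.
  have c0 : 0 < cos s by apply: cos_gt0_pihalf; lra.
  have s0 : 0 < sin s by exact: sin_gt0_pihalf.
  have a1 := is_deriveZ (2 : R) (is_derive_id s (1 : R)).
  have a2 := is_deriveB (is_derive_cst (pi / 2 : R) s 1) (is_derive_id s (1 : R)).
  have d1 := @is_derive1_comp R Phi _ s _ _ (is_derive_sine_primitive h1) a1.
  have d2 := is_deriveZ (2 : R) (is_derive_sine_primitive h2).
  have d3 := is_deriveZ (2 : R) (@is_derive1_comp R Phi _ s _ _ (is_derive_sine_primitive h3) a2).
  have d4 := is_deriveZ (pi : R) (@is_derive1_comp R (@ln R) _ s _ _ (is_derive1_ln c0) (is_derive_cos s)).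
  have d := is_deriveB (is_deriveD (is_deriveB d1 d2) d3) d4.
  apply: (is_derive_eq d); rewrite /GRing.scale/=.
  have -> : sin (pi / 2 - s) = cos s by rewrite sinB cos_pihalf sin_pihalf mul1r mul0r subr0.
  have -> : cos (pi / 2 - s) = sin s by rewrite cosB cos_pihalf sin_pihalf mul1r mul0r add0r.
  have -> : 2 * s = s *+ 2 by rewrite mulr_natl.
  rewrite sin_mulr2n cos_mulr2n.
  have -> : cos s ^+ 2 *+ 2 - 1 = cos s ^+ 2 - sin s ^+ 2 by rewrite cos2sin2; ring.
  clear d d1 d2 d3 d4 a1 a2.
  move: (pi : R) (cos s) (sin s) c0 s0 => P C S c0 s0.
  by field; rewrite !gt_eqF//.
move=> s s1.
have c0 : 0 < cos s by apply: cos_gt0_pihalf; lra.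
have k1 : {for s, continuous (fun s : R => Phi (2 * s))}.
  apply: (@continuous_comp _ _ _ (fun s : R => 2 * s) Phi).
    by apply: cvgMl_tmp; exact: cvg_id.
  exact: continuous_sine_primitive.
have k2 : {for s, continuous (fun s : R => 2 * Phi s)}.
  by apply: cvgMl_tmp; exact: continuous_sine_primitive.
have k3 : {for s, continuous (fun s : R => 2 * Phi (pi / 2 - s))}.
  apply: cvgMl_tmp; apply: (@continuous_comp _ _ _ (fun s : R => pi / 2 - s) Phi).
    by apply: cvgB; [exact: cvg_cst|exact: cvg_id].
  exact: continuous_sine_primitive.
have k4 : {for s, continuous (fun s : R => pi * ln (cos s))}.
  apply: cvgMl_tmp; apply: (@continuous_comp _ _ _ (@cos R) (@ln R)).
    exact: continuous_cos.
  exact: continuous_ln.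
exact: (cvgB (cvgD (cvgB k1 k2) k3) k4).
Qed.

Lemma sine_primitive_pihalf : Phi (pi / 2) - Phi 0 = pi / 2 * ln 2.
Proof.
have p0 := pi_gt0 R; have := D_cst; rewrite /D.
have -> : 2 * (pi / 4) = pi / 2 :> R by field.
have -> : pi / 2 - pi / 4 = pi / 4 :> R by field.
rewrite subr0 mulr0 cos0 ln1.
have c0 : 0 < cos (pi / 4 : R) by apply: cos_gt0_pihalf; lra.
have : cos (pi / 4 : R) ^+ 2 * 2 = 1.
  have : cos ((pi / 4 : R) *+ 2) = 0.
    by rewrite -[RHS](@cos_pihalf R); congr cos; rewrite mulr2n; field.
  by rewrite cos_mulr2n => /eqP; rewrite subr_eq0 -mulr_natr => /eqP.
move=> /(congr1 (@ln R)); rewrite lnM ?posrE ?exprn_gt0// lnXn// ln1 mulr2n.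
move: (ln (cos _)) (ln 2) => a b ab.
have -> : a = - b / 2 by lra.
lra.
Qed.

Lemma arcsin_int1 : arcsin_int (1 : {poly R}) = pi * ln 2.
Proof.
have := sine_primitive_pihalf; rewrite /Phi sin_pihalf sin0 -arcsin_primitive1.
have := arcsin_primitive0; move: (Xi 1) (Xi 0) (ln 2) => a b c; lra.
Qed.

End arcsin_mass.

(** * The equilibrium equations of the coefficient vectors *)

Section equilibrium.
Context {R : realType}.
Local Notation U := (@chebyshevU R).
Local Notation B := (@log_kernel_diff R).

Lemma arcsin_int_chebyshevU k : arcsin_int (U k.*2) = pi / 2 * B k.
Proof.
elim: k => [|k IH].
  by rewrite double0 arcsin_int1 log_kernel_diff0 mulrA divfK.
have := arcsin_int_chebyshevD k (R := R).
have := @log_kernel_diffD R k; rewrite IH => e /(canRL (addKr _)) ->.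
have -> : B k.+1 = 2 * harmonic k - B k by rewrite -e addrC addKr.
by move: (harmonic k) (B k) => a b; field.
Qed.

Definition dist (i j : nat) : nat := (i - j + (j - i))%N.

(** U_{2(i-j)}, continued to negative indices by U_{-m-2} = -U_m. *)
Definition chebyshev_diff (i j : nat) : {poly R} :=
  if (j <= i)%N then U (i - j).*2 else - U (j - i.+1).*2.

Lemma chebyshev_diff_cos i j (t : R) :
  (chebyshev_diff i j).[cos t] * sin t = sin ((2 * i%:R + 1 - 2 * j%:R) * t).
Proof.
rewrite /chebyshev_diff; case: ifPn => [ji|]; last rewrite -ltnNge => ij.
  rewrite chebyshevU_cos; congr (sin (_ * _)).
  by rewrite -[(_ - _).*2.+1%:R]natr1 -mul2n natrM natrB//; ring.
rewrite hornerN mulNr chebyshevU_cos -sinN -mulNr; congr (sin (_ * _)).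
by rewrite -[(_ - _).*2.+1%:R]natr1 -mul2n natrM natrB// -[i.+1%:R]natr1; ring.
Qed.

Lemma arcsin_intN (p : {poly R}) : arcsin_int (- p) = - arcsin_int p.
Proof. by rewrite -scaleN1r arcsin_intZ mulN1r. Qed.

Lemma arcsin_int_sum (I : Type) (r : seq I) (F : I -> {poly R}) :
  arcsin_int (\sum_(i <- r) F i) = \sum_(i <- r) arcsin_int (F i).
Proof.
apply: (big_morph arcsin_int (@arcsin_intD R)).
by rewrite -(scale0r (0 : {poly R})) arcsin_intZ mul0r.
Qed.

(** The functional only sees (-1,1), where x = cos t with sin t nonzero; sine identities can thus
    replace polynomial ones. *)
Lemma arcsin_int_eq (p q : {poly R}) :
  (forall t, p.[cos t] * sin t = q.[cos t] * sin t) -> arcsin_int p = arcsin_int q.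
Proof.
move=> pq; apply: eq_Rintegral => x; rewrite inE/= in_itv/= => x1; congr (_ * _).
have xc : -1 <= x <= 1 by lra.
have := pq (acos x); rewrite acosK ?in_itv//; apply: mulIf.
rewrite sin_acos// gt_eqF// sqrtr_gt0 (_ : 1 - x ^+ 2 = (1 - x) * (1 + x)); last by ring.
by rewrite mulr_gt0; lra.
Qed.

Lemma arcsin_int_chebyshev_diff i j : arcsin_int (chebyshev_diff i j) =
  pi / 2 * (log_kernel (dist i.+1 j) - log_kernel (dist i j)).
Proof.
rewrite /chebyshev_diff; case: ifPn => [ji|]; last rewrite -ltnNge => ij.
  rewrite arcsin_int_chebyshevU /log_kernel_diff.
  have -> : dist i.+1 j = (i - j).+1 by rewrite /dist; lia.
  by have -> : dist i j = (i - j)%N by rewrite /dist; lia.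
rewrite arcsin_intN arcsin_int_chebyshevU /log_kernel_diff -mulrN opprB.
have -> : dist i.+1 j = (j - i.+1)%N by rewrite /dist; lia.
by have -> : dist i j = (j - i.+1).+1 by rewrite /dist; lia.
Qed.

Lemma digamma_mxE n (i j : 'I_n.+1) : digamma_mx n i j = log_kernel (dist i j) :> R.
Proof.
rewrite mxE /log_kernel; congr (_ + digamma ((1 + _) / 2)).
have [ij|ji] := leqP i j.
  rewrite distrC ger0_norm ?subr_ge0 ?ler_nat// -natrB//.
  by congr (_%:R); rewrite /dist; lia.
rewrite ger0_norm ?subr_ge0 ?ler_nat 1?ltnW// -natrB 1?ltnW//.
by congr (_%:R); rewrite /dist; lia.
Qed.

Lemma energyE (v : forall n, 'cV[R]_n.+1) n :
  energy v n = \sum_i \sum_j v n i 0 * v n j 0 * log_kernel (dist i j).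
Proof.
rewrite /energy mxE exchange_big/=; apply: eq_bigr => j _.
rewrite mxE mulr_suml; apply: eq_bigr => i _.
by rewrite digamma_mxE mxE mulrAC.
Qed.

Section fourier.
Variables (P : nat -> {poly R}) (v : forall n, 'cV[R]_n.+1).
Hypotheses (hP : orthogonal_polynomials P) (hv : fourier_coefficients P v).

Lemma fourier_real n (t : R) :
  cos (n%:R * t) * (P n).[cos t] = \sum_(k < n.+1) v n k 0 * cos (2 * k%:R * t) /\
  sin (n%:R * t) * (P n).[cos t] = \sum_(k < n.+1) v n k 0 * sin (2 * k%:R * t).
Proof.
have /eqP := hv n t; rewrite eq_complex => /andP[/eqP h1 /eqP h2]; split.
  move: h1; rewrite /= mulr0 subr0 => ->.
  rewrite raddf_sum; apply: eq_bigr => i _ /=; by rewrite mul0r subr0.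
move: h2; rewrite /= mulr0 add0r => ->.
by rewrite raddf_sum; apply: eq_bigr => i _ /=; rewrite mul0r addr0.
Qed.

Lemma fourier_sum1 n : \sum_(k < n.+1) v n k 0 = 1.
Proof.
have [+ _] := fourier_real n 0; rewrite mulr0 cos0 mul1r; have [_ _ ->] := hP.
by move=> ->; apply: eq_bigr => k _; rewrite mulr0 cos0 mulr1.
Qed.

(** Imaginary part of the conjugate Fourier identity multiplied by the phase of angle (2i+1)t. *)
Lemma fourier_sin n i (t : R) :
  (P n).[cos t] * sin ((2 * i%:R + 1 - n%:R) * t) =
  \sum_(j < n.+1) v n j 0 * sin ((2 * i%:R + 1 - 2 * j%:R) * t).
Proof.
have [hc hs] := fourier_real n t.
transitivity (sin ((2 * i%:R + 1) * t) * (cos (n%:R * t) * (P n).[cos t]) -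
              cos ((2 * i%:R + 1) * t) * (sin (n%:R * t) * (P n).[cos t])).
  by rewrite mulrBl sinB; ring.
rewrite hc hs !mulr_sumr -sumrB; apply: eq_bigr => j _.
by rewrite [in RHS]mulrBl sinB; ring.
Qed.

(** U_{2i-n} for an index of any sign: U_{-1} = 0 and U_{-m-2} = -U_m. *)
Definition shifted_chebyshevU n i : {poly R} :=
  if (n <= i.*2)%N then U (i.*2 - n) else if (i.*2.+1 == n) then 0 else - U (n - i.*2.+2).

Lemma shifted_chebyshevU_cos n i (t : R) :
  (shifted_chebyshevU n i).[cos t] * sin t = sin ((2 * i%:R + 1 - n%:R) * t).
Proof.
rewrite /shifted_chebyshevU; case: ifPn => [ni|]; last rewrite -ltnNge => ni.
  rewrite chebyshevU_cos; congr (sin (_ * _)).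
  by rewrite -[(_ - _).+1%:R]natr1 natrB// -mul2n natrM; ring.
case: eqP => [<-|/eqP ne].
  by rewrite horner0 mul0r -[i.*2.+1%:R]natr1 -mul2n natrM subrr mul0r sin0.
have {ni}ne : (i.*2.+2 <= n)%N by lia.
rewrite hornerN mulNr chebyshevU_cos -sinN -mulNr; congr (sin (_ * _)).
by rewrite -[(_ - _).+1%:R]natr1 natrB// -[i.*2.+2%:R]natr1 -[i.*2.+1%:R]natr1 -mul2n natrM; ring.
Qed.

(** For i < n the degree stays below n whatever the sign of 2i - n, so orthogonality applies to
    every pair of consecutive rows. *)
Lemma size_shifted_chebyshevU n i : (i < n)%N -> (size (shifted_chebyshevU n i) <= n)%N.
Proof.
move=> lin; rewrite /shifted_chebyshevU; case: ifPn => [ni|ni].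
  by rewrite (leq_trans (size_chebyshevU _))//; lia.
case: ifPn => [|ne]; first by rewrite size_poly0.
by rewrite size_polyN (leq_trans (size_chebyshevU _))//; lia.
Qed.

Lemma kernel_rowS n i : (i < n)%N ->
  \sum_(j < n.+1) v n j 0 * log_kernel (dist i.+1 j) =
  \sum_(j < n.+1) v n j 0 * log_kernel (dist i j).
Proof.
move=> lin; apply/eqP; rewrite -subr_eq0 -sumrB.
have p2 : pi / 2 != 0 :> R by rewrite gt_eqF// divr_gt0// pi_gt0.
rewrite -(mulrI_eq0 _ (mulfI p2)) mulr_sumr.
apply/eqP; transitivity (arcsin_int (P n * shifted_chebyshevU n i)); last first.
  exact: arcsin_int_orthogonal (size_shifted_chebyshevU lin).
transitivity (arcsin_int (\sum_(j < n.+1) v n j 0 *: chebyshev_diff i j)).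
  rewrite arcsin_int_sum; apply: eq_bigr => j _.
  by rewrite arcsin_intZ arcsin_int_chebyshev_diff -mulrBr mulrCA.
apply: arcsin_int_eq => t.
rewrite hornerM -mulrA shifted_chebyshevU_cos fourier_sin horner_sum mulr_suml.
by apply: eq_bigr => j _; rewrite hornerZ -mulrA chebyshev_diff_cos.
Qed.

Lemma kernel_row n i : (i <= n)%N ->
  \sum_(j < n.+1) v n j 0 * log_kernel (dist i j) = energy v n.
Proof.
have rowE k : (k <= n)%N -> \sum_(j < n.+1) v n j 0 * log_kernel (dist k j) =
    \sum_(j < n.+1) v n j 0 * log_kernel (dist 0 j).
  by elim: k => [//|k IH kn]; rewrite (kernel_rowS kn); apply: IH; exact: ltnW.
move=> lin; rewrite energyE (rowE _ lin).
transitivity (\sum_(k < n.+1) v n k 0 * \sum_(j < n.+1) v n j 0 * log_kernel (dist 0 j)).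
  by rewrite -mulr_suml (fourier_sum1 n) mul1r.
apply: eq_bigr => k _; rewrite -(rowE k); last by rewrite -ltnS.
by rewrite mulr_sumr; apply: eq_bigr => j _; rewrite mulrA.
Qed.

End fourier.

End equilibrium.

(** * Positive definiteness and monotonicity of the energy *)

Section triangles.
Context {R : realType}.
Local Notation A := (@log_kernel R).
Local Notation B := (@log_kernel_diff R).

Definition log_kernel_diff2 k : R := B k - B k.+1.
Local Notation C := log_kernel_diff2.

Lemma log_kernel_diff2_gt0 k : 0 < C k.
Proof. by rewrite subr_gt0; exact: log_kernel_diff_decr. Qed.

Lemma sum_window (a b M : nat) : (b < M)%N ->
  (\sum_(l < M) ((a < l) && (l <= b) : nat) = b - a)%N.
Proof.
have h m : (\sum_(l < m) ((a < l) && (l <= b) : nat) = minn b m.-1 - a)%N.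
  elim: m => [|m IH]; first by rewrite big_ord0; lia.
  by rewrite big_ord_recr/= IH; case: (ltnP a m); case: (leqP m b); lia.
by rewrite h; lia.
Qed.

Definition window (h i l : nat) : R := ((i < l) && (l <= i + h))%N%:R.

(** The triangle is the overlap of two intervals of length h starting at i and j, hence a Gram
    kernel; the range 2N contains both intervals. *)
Lemma triangle_windows (N h i j : nat) : (i < N)%N -> (j < N)%N -> (h <= N)%N ->
  (h - dist i j)%N%:R = \sum_(l < N.*2) window h i l * window h j l :> R.
Proof.
move=> iN jN hN.
transitivity ((\sum_(l < N.*2) ((maxn i j < l) && (l <= minn i j + h) : nat))%N%:R : R).
  by rewrite sum_window; [congr (_%:R); rewrite /dist|]; lia.
rewrite natr_sum; apply: eq_bigr => l _; rewrite /window -natrM; congr (_%:R).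
by rewrite mulnb; congr nat_of_bool; lia.
Qed.

Lemma triangle_form (N h m : nat) (x : nat -> R) : (m <= N)%N -> (h <= N)%N ->
  \sum_(i < m) \sum_(j < m) x i * x j * (h - dist i j)%N%:R =
  \sum_(l < N.*2) (\sum_(i < m) x i * window h i l) ^+ 2.
Proof.
move=> mN hN.
transitivity (\sum_(i < m) \sum_(j < m) \sum_(l < N.*2)
    (x i * window h i l) * (x j * window h j l)).
  apply: eq_bigr => i _; apply: eq_bigr => j _.
  rewrite (triangle_windows (leq_trans (ltn_ord i) mN) (leq_trans (ltn_ord j) mN) hN).
  by rewrite mulr_sumr; apply: eq_bigr => l _; ring.
under eq_bigr do rewrite exchange_big/=.
rewrite exchange_big/=; apply: eq_bigr => l _.
by rewrite expr2 mulr_suml; apply: eq_bigr => i _; rewrite mulr_sumr.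
Qed.

Lemma log_kernel_diff_sum (N m : nat) : (m <= N)%N ->
  \sum_(a < N) C a * (m <= a)%N%:R = B m - B N.
Proof.
elim: N => [|N IH]; first by rewrite leqn0 => /eqP ->; rewrite big_ord0 subrr.
rewrite leq_eqVlt => /predU1P[->|mN].
  by rewrite big1 ?subrr// => a _; rewrite leqNgt ltn_ord mulr0.
have {}mN : (m <= N)%N by [].
by rewrite big_ord_recr/= (IH mN) mN mulr1 /C; move: (B m) (B N) (B N.+1) => *; ring.
Qed.

(** Discrete Taylor formula at N: two summations by parts, with the second differences as
    weights. *)
Lemma log_kernel_triangles (N m : nat) : (m <= N)%N ->
  A N - A m = B N * (N - m)%N%:R + \sum_(a < N) C a * (a.+1 - m)%N%:R.
Proof.
move=> mN; rewrite -(subKn mN); move: (N - m)%N (leq_subr m N) => d {m mN}.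
elim: d => [_|d IH dN].
  rewrite subn0 subnn mulr0 add0r subrr big1// => a _.
  by rewrite (_ : (a.+1 - N)%N = 0%N) ?mulr0//; have := ltn_ord a; lia.
have -> : A N - A (N - d.+1)%N = (A N - A (N - d)%N) + B (N - d.+1)%N.
  by rewrite /B subnSK// addrA subrK.
rewrite IH; last exact: ltnW.
have -> : B (N - d.+1)%N = \sum_(a < N) C a * (N - d.+1 <= a)%N%:R + B N.
  by rewrite log_kernel_diff_sum ?subrK// leq_subr.
have -> : (N - (N - d))%N = d by lia.
have -> : (N - (N - d.+1))%N = d.+1 by lia.
rewrite -[d.+1%:R]natr1 mulrDr mulr1.
have -> : \sum_(a < N) C a * (a.+1 - (N - d.+1))%N%:R =
    \sum_(a < N) C a * (a.+1 - (N - d))%N%:R + \sum_(a < N) C a * (N - d.+1 <= a)%N%:R.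
  rewrite -big_split/=; apply: eq_bigr => a _; rewrite -mulrDr -natrD; congr (_ * _%:R).
  by case: (leqP (N - d.+1) a); lia.
move: (B N) (\sum_(a < N) _) (\sum_(a < N) _) => *; ring.
Qed.

(** Every triangle contributes a nonnegative form. The term a = 0 is the identity matrix and yields
    the quantitative lower bound. *)
Lemma log_kernel_form_ge (N m : nat) (x : nat -> R) : (0 < N)%N -> (m <= N)%N ->
  C 0%N * \sum_(i < m) x i ^+ 2 <=
  \sum_(i < m) \sum_(j < m) x i * x j * (A N - A (dist i j)).
Proof.
move=> N0 mN.
have -> : \sum_(i < m) \sum_(j < m) x i * x j * (A N - A (dist i j)) =
    B N * (\sum_(i < m) \sum_(j < m) x i * x j * (N - dist i j)%N%:R) +
    \sum_(a < N) C a * (\sum_(i < m) \sum_(j < m) x i * x j * (a.+1 - dist i j)%N%:R).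
  transitivity (\sum_(i < m) \sum_(j < m) (B N * (x i * x j * (N - dist i j)%N%:R)
     + \sum_(a < N) C a * (x i * x j * (a.+1 - dist i j)%N%:R))).
    apply: eq_bigr => i _; apply: eq_bigr => j _.
    rewrite log_kernel_triangles; last by rewrite /dist; have := ltn_ord i; have := ltn_ord j; lia.
    rewrite mulrDr mulr_sumr; congr (_ + _); first by rewrite mulrCA.
    by apply: eq_bigr => a _; rewrite mulrCA.
  under eq_bigr do rewrite big_split/=.
  rewrite big_split/=; congr (_ + _).
    by rewrite mulr_sumr; apply: eq_bigr => i _; rewrite mulr_sumr.
  under eq_bigr do rewrite exchange_big/=.
  rewrite exchange_big/=; apply: eq_bigr => a _.
  by rewrite mulr_sumr; apply: eq_bigr => i _; rewrite mulr_sumr.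
have tri_ge0 h : (h <= N)%N ->
    0 <= \sum_(i < m) \sum_(j < m) x i * x j * (h - dist i j)%N%:R.
  by move=> hN; rewrite (triangle_form _ mN hN); apply: sumr_ge0 => l _; exact: sqr_ge0.
case: N N0 mN tri_ge0 => // N _ mN tri_ge0.
rewrite [X in _ <= _ + X]big_ord_recl/=.
have -> : \sum_(i < m) \sum_(j < m) x i * x j * (1 - dist i j)%N%:R = \sum_(i < m) x i ^+ 2.
  apply: eq_bigr => i _; rewrite (bigD1 i)//= big1 => [|j ji].
    by rewrite /dist subnn mulr1 addr0 expr2.
  have -> : (1 - dist i j)%N = 0%N by move: ji; rewrite -val_eqE/= /dist; lia.
  by rewrite mulr0.
rewrite addrCA lerDl addr_ge0//.
  by rewrite mulr_ge0// ?tri_ge0// ltW// log_kernel_diff_gt0.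
apply: sumr_ge0 => a _; apply: mulr_ge0; first exact: ltW (log_kernel_diff2_gt0 _).
by apply: tri_ge0; rewrite /bump/=; have := ltn_ord a; lia.
Qed.

Lemma log_kernel_form_le0 (m : nat) (x : nat -> R) : \sum_(i < m) x i = 0 ->
  \sum_(i < m) \sum_(j < m) x i * x j * A (dist i j) <= - (C 0%N * \sum_(i < m) x i ^+ 2).
Proof.
move=> x0; have := @log_kernel_form_ge m.+1 m x isT (leqnSn m).
suff -> : \sum_(i < m) \sum_(j < m) x i * x j * (A m.+1 - A (dist i j)) =
   - \sum_(i < m) \sum_(j < m) x i * x j * A (dist i j) by rewrite lerNr.
rewrite -sumrN; transitivity (\sum_(i < m) (x i * A m.+1 * (\sum_(j < m) x j) -
    \sum_(j < m) x i * x j * A (dist i j))).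
  apply: eq_bigr => i _; rewrite mulr_sumr -sumrB; apply: eq_bigr => j _.
  by rewrite mulrBr mulrAC.
by apply: eq_bigr => i _; rewrite x0 mulr0 sub0r.
Qed.

End triangles.

(** * Nonnegative equilibria for an abstract kernel *)

Section equilibrium_positivity.
Context {R : realType} {T : finType}.
Variable K : T -> T -> R.
Hypothesis K_sym : forall i j, K i j = K j i.
Local Notation form x := (\sum_i \sum_j x i * x j * K i j).
Hypothesis K_ge0 : forall x : T -> R, 0 <= form x.
Hypothesis K_def : forall x : T -> R, form x = 0 -> forall i, x i = 0.
Hypothesis K_max : forall (S : {set T}) (x : T -> R), (forall i, 0 <= x i) ->
  (forall i, i \notin S -> x i = 0) -> (forall i, i \in S -> \sum_j x j * K i j = 1) ->
  forall i, \sum_j x j * K i j <= 1.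

Let dual (x y : T -> R) : \sum_i x i * (\sum_j y j * K i j) = \sum_j y j * (\sum_i x i * K j i).
Proof.
under eq_bigr do rewrite mulr_sumr.
rewrite exchange_big; apply: eq_bigr => j _; rewrite mulr_sumr; apply: eq_bigr => i _.
by rewrite mulrCA K_sym.
Qed.

Let formE (x : T -> R) : form x = \sum_i x i * (\sum_j x j * K i j).
Proof. by apply: eq_bigr => i _; rewrite mulr_sumr; apply: eq_bigr => j _; rewrite mulrA. Qed.

Lemma equilibrium_exists (S : {set T}) : exists x : T -> R,
  (forall i, i \notin S -> x i = 0) /\ (forall i, i \in S -> \sum_j x j * K i j = 1).
Proof.
(* The kernel on S, completed by the identity outside S: a matrix whose size does not depend on S,
   invertible by definiteness. *)
pose M : 'M[R]_#|T| := \matrix_(a, b)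
  (if (enum_val a \in S) && (enum_val b \in S) then K (enum_val a) (enum_val b)
   else (a == b)%:R).
have sumE (u : 'rV[R]_#|T|) b : (u *m M) 0 b =
    if enum_val b \in S then \sum_(i in S) u 0 (enum_rank i) * K i (enum_val b)
    else u 0 b.
  rewrite mxE; case: ifPn => bS.
    rewrite [RHS]big_mkcond/= (reindex enum_rank)/=; last first.
      by exists enum_val => x _; rewrite (enum_rankK, enum_valK).
    apply: eq_bigr => i _; rewrite mxE enum_rankK bS andbT; case: ifP => // iS.
    case: eqP => [e|_]; last by rewrite mulr0.
    by move: bS; rewrite -e enum_rankK iS.
  rewrite (bigD1 b)//= mxE (negbTE bS) andbF eqxx mulr1 big1 ?addr0// => a ab.
  by rewrite mxE (negbTE bS) andbF (negbTE ab) mulr0.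
have Mu : M \in unitmx.
  rewrite -row_free_unit; apply: inj_row_free => u uM.
  have u0 b : enum_val b \notin S -> u 0 b = 0.
    by move=> bS; move/rowP: uM => /(_ b); rewrite sumE (negbTE bS) mxE.
  pose x i := u 0 (enum_rank i).
  have x0 i : i \notin S -> x i = 0 by move=> iS; apply: u0; rewrite enum_rankK.
  have : form x = 0.
    rewrite formE big1// => i _; have [iS|/x0 ->] := boolP (i \in S); last by rewrite mul0r.
    move/rowP: uM => /(_ (enum_rank i)); rewrite sumE enum_rankK iS mxE => e.
    have -> : \sum_j x j * K i j = 0; last by rewrite mulr0.
    rewrite (bigID (mem S))/= [X in _ + X]big1 ?addr0 => [|j /x0 ->]; last by rewrite mul0r.
    by rewrite -[RHS]e; apply: eq_bigr => j _; rewrite K_sym.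
  move=> /K_def x00; apply/rowP => a; rewrite mxE -(enum_valK a); exact: x00.
have [u uM] : exists u : 'rV[R]_#|T|, u *m M = \row_b (enum_val b \in S)%:R.
  by exists ((\row_b (enum_val b \in S)%:R) *m invmx M); rewrite mulmxKV.
have x0 i : i \notin S -> u 0 (enum_rank i) = 0.
  move=> iS; move/rowP: uM => /(_ (enum_rank i)).
  by rewrite sumE mxE enum_rankK (negbTE iS).
exists (fun i => u 0 (enum_rank i)); split => // i iS.
move/rowP: uM => /(_ (enum_rank i)); rewrite sumE mxE enum_rankK iS => e.
rewrite -[RHS]/(true%:R) -[RHS]e.
rewrite (bigID (mem S))/= [X in _ + X]big1 ?addr0 => [|j /x0 ->]; last by rewrite mul0r.
by apply: eq_bigr => j _; rewrite K_sym.
Qed.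

(* The equilibrium [y] of the set where [x] is positive has potential at most 1,
   hence a mass at least that of [x]; but that mass is the projection of [x]. *)
Lemma equilibrium_ge0 (S : {set T}) (x : T -> R) :
  (forall i, i \notin S -> x i = 0) -> (forall i, i \in S -> \sum_j x j * K i j = 1) ->
  forall i, 0 <= x i.
Proof.
(* Induction on the cardinality of S: the hypothesis gives y >= 0 on a strictly smaller set. *)
elim: {S}_.+1 {-2}S (ltnSn #|S|) x => // m IH S Sm x x0 xS.
pose S' : {set T} := [set i in S | 0 < x i]%SET.
have S'S : S' \subset S by apply/fintype.subsetP => i; rewrite inE => /andP[].
have [SS'|nSS'] := boolP (S \subset S').
  move=> i; have [/(fintype.subsetP SS')|/x0 ->//] := boolP (i \in S).
  by rewrite inE => /andP[_ /ltW].
have S'm : (#|S'| < m)%N.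
  by rewrite -ltnS (leq_trans _ Sm)// ltnS proper_card// properE S'S.
have [y [y0 yS']] := equilibrium_exists S'.
have y_ge0 := IH _ S'm y y0 yS'.
have y_le1 := K_max y_ge0 y0 yS'.
have xle i : i \notin S' -> x i <= 0.
  have [iS|/x0 -> //] := boolP (i \in S); by rewrite inE iS/= -leNgt.
have yx : \sum_i y i * (\sum_j x j * K i j) = \sum_i y i.
  apply: eq_bigr => i _; have [/(fintype.subsetP S'S)/xS ->|/y0 ->] := boolP (i \in S').
    by rewrite mulr1.
  by rewrite mul0r.
have xy : \sum_i x i <= \sum_i x i * (\sum_j y j * K i j).
  apply: ler_sum => i _; have [/yS' ->|iS'] := boolP (i \in S'); first by rewrite mulr1.
  by rewrite -[leLHS]mulr1; apply: ler_wnM2l; [exact: xle|exact: y_le1].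
have yy : form y = \sum_i y i.
  rewrite formE; apply: eq_bigr => i _; have [/yS' ->|/y0 ->] := boolP (i \in S').
    by rewrite mulr1.
  by rewrite mul0r.
have xx : form x = \sum_i x i.
  rewrite formE; apply: eq_bigr => i _; have [/xS ->|/x0 ->] := boolP (i \in S).
    by rewrite mulr1.
  by rewrite mul0r.
(* By symmetry both mixed terms equal the mass of y. Together with [xy] this makes the form of x - y
   nonpositive, so x = y. *)
have e : form (fun i => x i - y i) = \sum_i x i - \sum_i y i.
  transitivity (form x + form y - 2 * \sum_i y i * (\sum_j x j * K i j)); last first.
    by rewrite yx yy xx; ring.
  transitivity (form x + form y - (\sum_i y i * (\sum_j x j * K i j) +
      \sum_i x i * (\sum_j y j * K i j))); last by rewrite (dual x y); ring.
  rewrite -!big_split/= -sumrB; apply: eq_bigr => i _.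
  rewrite !mulr_sumr -!big_split/= -sumrB; apply: eq_bigr => j _; ring.
have {e} : form (fun i => x i - y i) = 0.
  apply/eqP; rewrite eq_le K_ge0 andbT e subr_le0 -yx -dual; exact: xy.
by move=> /K_def h i; have /eqP := h i; rewrite subr_eq0 => /eqP ->.
Qed.

End equilibrium_positivity.

(** * Maximum principle for the logarithmic potential *)

Section log_kernel_positivity.
Context {R : realType}.
Local Notation A := (@log_kernel R).
Local Notation B := (@log_kernel_diff R).

Lemma log_kernel_lt m : A m < A m.+1.
Proof. by rewrite -subr_gt0; exact: log_kernel_diff_gt0. Qed.

Lemma log_kernel_ltn m p : (m < p)%N -> A m < A p.
Proof.
elim: p => // p IH; rewrite ltnS leq_eqVlt => /predU1P[->|/IH h]; first exact: log_kernel_lt.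
exact: lt_trans (log_kernel_lt p).
Qed.

Lemma log_kernel_concave (k y : nat) : (0 < k)%N -> y != k ->
  A (dist k.-1 y) + A (dist k.+1 y) < 2 * A (dist k y).
Proof.
move=> k0 yk.
have h d : A d + A d.+2 < 2 * A d.+1.
  have := @log_kernel_diff_decr R d; rewrite /B; move: (A d) (A d.+1) (A d.+2) => a b c; lra.
have [ky|ky] := ltnP k y.
  have -> : dist k.-1 y = (y - k.+1).+2 by rewrite /dist; lia.
  have -> : dist k.+1 y = (y - k.+1)%N by rewrite /dist; lia.
  have -> : dist k y = (y - k.+1).+1 by rewrite /dist; lia.
  by rewrite addrC.
have -> : dist k.-1 y = (k.-1 - y)%N by rewrite /dist; lia.
have -> : dist k.+1 y = (k.-1 - y).+2 by rewrite /dist; lia.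
by have -> : dist k y = (k.-1 - y).+1 by rewrite /dist; lia.
Qed.

(** A maximum above 1 would lie at a point k without mass. If k is interior, strict concavity of the
    kernel in the distance makes the potential strictly convex there; at an end point, the potential
    grows strictly when moving inwards. Both contradict maximality. *)
Lemma log_kernel_max_principle n (c : R) (S : {set 'I_n.+1}) (x : 'I_n.+1 -> R) :
  (forall i, 0 <= x i) -> (forall i, i \notin S -> x i = 0) ->
  (forall i, i \in S -> \sum_j x j * (c - A (dist i j)) = 1) ->
  forall i : 'I_n.+1, \sum_j x j * (c - A (dist i j)) <= 1.
Proof.
have aux (a b d : R) : a + b < 2 * d -> c - d + (c - d) < c - a + (c - b) by lra.
move=> x_ge0 x0 xS i0; pose V (i : 'I_n.+1) := \sum_j x j * (c - A (dist i j)).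
have [k _ kmax] := arg_maxP V (i0 := i0) (P := xpredT) isT.
apply: (le_trans (kmax i0 isT)); rewrite leNgt; apply/negP => Vk.
have kS : k \notin S by apply/negP => /xS e; move: Vk; rewrite /V e ltxx.
have xk := x0 _ kS.
(* Some mass exists, since otherwise the potential would vanish; it makes the comparisons below
   strict. *)
have [y xy] : exists y, 0 < x y.
  apply/not_existsP => h; move: Vk; rewrite /V big1 ?ltr10// => j _.
  have -> : x j = 0; last by rewrite mul0r.
  by apply/eqP; rewrite eq_le x_ge0 andbT leNgt; apply/negP/h.
have yk : (y : nat) != k by apply: contraTneq xy => /val_inj ->; rewrite xk ltxx.
have lt_sum (F G : 'I_n.+1 -> R) : (forall j, j != k -> F j < G j) ->
    \sum_j x j * F j < \sum_j x j * G j.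
  move=> FG; rewrite (bigD1 y)//= [ltRHS](bigD1 y)//=; apply: ltr_leD.
    by rewrite ltr_pM2l// FG.
  apply: ler_sum => j _; have [->|jk] := eqVneq j k; first by rewrite xk !mul0r.
  by rewrite ler_wpM2l// ltW// FG.
have [k0|k0] := posnP k.
  have n0 : (1 < n.+1)%N by move: yk (ltn_ord y); rewrite k0; lia.
  have h : V (Ordinal n0) <= V k := kmax _ isT.
  suff h' : V k < V (Ordinal n0) by have := lt_le_trans h' h; rewrite ltxx.
  apply: lt_sum => j jk.
  rewrite ltrD2l ltrN2; apply: log_kernel_ltn; rewrite /dist k0/=.
  by move: jk; rewrite -val_eqE/= k0; lia.
have [kn|kn] := ltnP k n.
  have k1 : (k.-1 < n.+1)%N by have := ltn_ord k; lia.
  have k2 : (k.+1 < n.+1)%N by [].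
  have h1 : V (Ordinal k1) <= V k := kmax _ isT.
  have h2 : V (Ordinal k2) <= V k := kmax _ isT.
  have h3 := lerD h1 h2.
  have : V k + V k < V (Ordinal k1) + V (Ordinal k2); last first.
    by move=> h; have := lt_le_trans h h3; rewrite ltxx.
  rewrite /V -!big_split/=.
  under eq_bigr do rewrite -mulrDr.
  under [ltRHS]eq_bigr do rewrite -mulrDr.
  apply: lt_sum => j jk.
  have := @log_kernel_concave k j k0; rewrite val_eqE => /(_ jk).
  exact: aux.
have kE : k = n :> nat by have := ltn_ord k; lia.
have n1 : (n.-1 < n.+1)%N by lia.
have h : V (Ordinal n1) <= V k := kmax _ isT.
suff h' : V k < V (Ordinal n1) by have := lt_le_trans h' h; rewrite ltxx.
apply: lt_sum => j jk.
rewrite ltrD2l ltrN2; apply: log_kernel_ltn; rewrite /dist kE/=.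
by move: jk (ltn_ord j); rewrite -val_eqE/= kE; lia.
Qed.

End log_kernel_positivity.

Section coefficients.
Context {R : realType}.
Local Notation A := (@log_kernel R).
Local Notation B := (@log_kernel_diff R).
Variables (P : nat -> {poly R}) (v : forall n, 'cV[R]_n.+1).
Hypotheses (hP : orthogonal_polynomials P) (hv : fourier_coefficients P v).

Let K n (i j : 'I_n.+1) : R := A n.+1 - A (dist i j).

Let form_ge n (x : 'I_n.+1 -> R) : log_kernel_diff2 0%N * \sum_i x i ^+ 2 <=
  \sum_i \sum_j x i * x j * K i j.
Proof.
have := @log_kernel_form_ge R n.+1 n.+1 (x \o inord) isT (leqnn _).
rewrite (eq_bigr (fun i => x i ^+ 2)) => [|i _]; last by rewrite /= inord_val.
rewrite [X in _ <= X](eq_bigr (fun i => \sum_j x i * x j * K i j))// => i _.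
by apply: eq_bigr => j _; rewrite /= !inord_val.
Qed.

Let dist_sym i j : dist i j = dist j i.
Proof. by rewrite /dist addnC. Qed.

(** Divided by the common row value [kappa], which is positive by definiteness, the vector has
    potential 1 on the whole index set, so [equilibrium_ge0] applies. *)
Lemma fourier_coefficient_ge0 n (i : 'I_n.+1) : 0 <= v n i 0.
Proof.
pose kappa : R := A n.+1 - energy v n.
have c0 := log_kernel_diff2_gt0 (R := R) 0.
have Kv (k : 'I_n.+1) : \sum_j v n j 0 * K k j = kappa.
  under eq_bigr do rewrite mulrBr.
  rewrite sumrB -mulr_suml (fourier_sum1 hP hv n) mul1r; congr (_ - _).
  by apply: (kernel_row hP hv); rewrite -ltnS.
have kappa_gt0 : 0 < kappa.
  have h := form_ge (fun i => v n i 0).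
  have e : \sum_i \sum_j v n i 0 * v n j 0 * K i j = kappa.
    transitivity (\sum_i v n i 0 * kappa).
      by apply: eq_bigr => k _; rewrite -(Kv k) mulr_sumr; apply: eq_bigr => j _; rewrite mulrA.
    by rewrite -mulr_suml (fourier_sum1 hP hv n) mul1r.
  rewrite e in h; apply: lt_le_trans h; apply: mulr_gt0 => //.
  rewrite lt_neqAle sumr_ge0 ?andbT => [|k _]; last exact: sqr_ge0.
  apply/eqP => /esym/eqP; rewrite psumr_eq0 => [/allP h|k _]; last exact: sqr_ge0.
  have := fourier_sum1 hP hv n; rewrite big1 => [/eqP|k _]; first by rewrite eq_sym oner_eq0.
  by apply/eqP; have := h k (mem_index_enum _); rewrite /= sqrf_eq0.
have form0 (x : 'I_n.+1 -> R) : \sum_i \sum_j x i * x j * K i j = 0 -> forall k, x k = 0.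
  move=> e k; have := form_ge x; rewrite e pmulr_rle0// => h.
  have : \sum_i x i ^+ 2 == 0.
    by rewrite eq_le h sumr_ge0// => j _; exact: sqr_ge0.
  rewrite psumr_eq0 => [/allP /(_ k (mem_index_enum _))|j _]; last exact: sqr_ge0.
  by rewrite /= sqrf_eq0 => /eqP.
have form_ge0 (x : 'I_n.+1 -> R) : 0 <= \sum_i \sum_j x i * x j * K i j.
  apply: le_trans (form_ge x); rewrite mulr_ge0 ?(ltW c0)// sumr_ge0// => j _.
  exact: sqr_ge0.
have Ksym (k j : 'I_n.+1) : K k j = K j k by rewrite /K dist_sym.
have : 0 <= v n i 0 / kappa.
  apply: (@equilibrium_ge0 R 'I_n.+1 (@K n) Ksym form_ge0 form0 _ [set: 'I_n.+1]%SET
    (fun k => v n k 0 / kappa)).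
  - move=> S x; exact: (@log_kernel_max_principle R n (A n.+1) S x).
  - by move=> k; rewrite inE.
  - move=> k _; rewrite -(@mulfV _ kappa) ?gt_eqF// -[X in _ = X / _](Kv k) mulr_suml.
    by apply: eq_bigr => j _; rewrite mulrAC.
by rewrite pmulr_lge0// invr_gt0.
Qed.

(** Let z be the zero extension of v_n and w = v_{n+1}. The rows of w are all equal, so the form of
    z - w is t_n - 2 t_{n+1} + t_{n+1}; as z - w has sum 0, this is negative unless z = w. *)
Lemma energy_ltS n : energy v n < energy v n.+1.
Proof.
pose w k : R := v n.+1 (inord k) 0.
pose z k : R := if (k < n.+1)%N then v n (inord k) 0 else 0.
have rowE k : (k <= n.+1)%N -> \sum_(j < n.+2) w j * A (dist k j) = energy v n.+1.
  move=> kn; rewrite -(kernel_row hP hv kn); apply: eq_bigr => j _.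
  by rewrite /w inord_val.
have w1 : \sum_(j < n.+2) w j = 1.
  by rewrite -(fourier_sum1 hP hv n.+1); apply: eq_bigr => j _; rewrite /w inord_val.
have zE (F : nat -> R) : \sum_(j < n.+2) z j * F j = \sum_(j < n.+1) v n j 0 * F j.
  rewrite big_ord_recr/= /z ltnn mul0r addr0; apply: eq_bigr => j _ /=.
  by rewrite ltn_ord inord_val.
have z1 : \sum_(j < n.+2) z j = 1.
  transitivity (\sum_(j < n.+2) z j * 1); first by apply: eq_bigr => j _; rewrite mulr1.
  by rewrite (zE (fun=> 1)) -[RHS](fourier_sum1 hP hv n); apply: eq_bigr => j _; rewrite mulr1.
pose d k := z k - w k.
have d0 : \sum_(j < n.+2) d j = 0 by rewrite sumrB z1 w1 subrr.
have := log_kernel_form_le0 d0.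
have c0 := log_kernel_diff2_gt0 (R := R) 0.
have -> : \sum_(i < n.+2) \sum_(j < n.+2) d i * d j * A (dist i j) =
    energy v n - energy v n.+1.
  transitivity (\sum_(i < n.+2) (z i * (\sum_(j < n.+2) z j * A (dist i j)) -
     (\sum_(j < n.+2) z j * (w i * A (dist i j))) -
      z i * (\sum_(j < n.+2) w j * A (dist i j)) + w i * (\sum_(j < n.+2) w j * A (dist i j)))).
    apply: eq_bigr => i _; rewrite !mulr_sumr -!sumrB -big_split/=; apply: eq_bigr => j _.
    by rewrite /d; ring.
  rewrite big_split/= !sumrB.
  have -> : \sum_(i < n.+2) z i * (\sum_(j < n.+2) z j * A (dist i j)) = energy v n.
    rewrite (zE (fun i => \sum_(j < n.+2) z j * A (dist i j))) energyE.
    apply: eq_bigr => i _; rewrite (zE (fun j => A (dist i j))) mulr_sumr.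
    by apply: eq_bigr => j _; rewrite mulrA.
  have -> : \sum_(i < n.+2) \sum_(j < n.+2) z j * (w i * A (dist i j)) = energy v n.+1.
    rewrite exchange_big/= -[RHS]mul1r -z1 mulr_suml; apply: eq_bigr => j _.
    rewrite -mulr_sumr; congr (_ * _); rewrite -(rowE j); last by rewrite -ltnS.
    by apply: eq_bigr => i _; rewrite dist_sym.
  have h (y : nat -> R) : \sum_(i < n.+2) y i = 1 ->
      \sum_(i < n.+2) y i * (\sum_(j < n.+2) w j * A (dist i j)) = energy v n.+1.
    move=> y1; rewrite -[RHS]mul1r -y1 mulr_suml; apply: eq_bigr => i _.
    by rewrite rowE// -ltnS.
  by rewrite (h z z1) (h w w1); move: (energy v n) (energy v n.+1) => a b; ring.
move=> h; rewrite -subr_lt0; apply: (le_lt_trans h); rewrite oppr_lt0.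
apply: mulr_gt0 => //.
rewrite lt_neqAle sumr_ge0 ?andbT => [|k _]; last exact: sqr_ge0.
apply/eqP => /esym/eqP; rewrite psumr_eq0 => [/allP hd|k _]; last exact: sqr_ge0.
have zw (k : 'I_n.+2) : z k = w k.
  by apply/eqP; rewrite -subr_eq0; have := hd k (mem_index_enum _); rewrite /= sqrf_eq0.
(* If z = w, rows n and n+1 would agree on v_n, but every point of {0,...,n} is farther from n+1
   than from n. *)
have r0 := rowE _ (leqnSn n); have r1 := rowE _ (leqnn n.+1).
have : \sum_(j < n.+1) v n j 0 * A (dist n j) = \sum_(j < n.+1) v n j 0 * A (dist n.+1 j).
  rewrite -(zE (fun j => A (dist n j))) -(zE (fun j => A (dist n.+1 j))).
  by under eq_bigr do rewrite zw; under [RHS]eq_bigr do rewrite zw; rewrite r0 r1.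
apply/eqP; rewrite -subr_eq0 -sumrB -oppr_eq0 -sumrN; apply/negP.
rewrite psumr_eq0 => [/allP h0|j _].
  have := fourier_sum1 hP hv n; rewrite big1 => [/eqP|k _]; first by rewrite eq_sym oner_eq0.
  have := h0 k (mem_index_enum _); rewrite /= -mulrBr -mulrN opprB mulf_eq0 => /orP[/eqP//|].
  rewrite subr_eq0 => /eqP e; suff : A (dist n k) < A (dist n.+1 k) by rewrite e ltxx.
  by apply: log_kernel_ltn; rewrite /dist; have := ltn_ord k; lia.
rewrite -mulrBr -mulrN opprB mulr_ge0 ?fourier_coefficient_ge0// subr_ge0 ltW//.
by apply: log_kernel_ltn; rewrite /dist; have := ltn_ord j; lia.
Qed.

End coefficients.

(** * Energy asymptotics and limits of the moments *)

Section kernel_sums.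
Context {R : realType}.
Local Notation A := (@log_kernel R).
Local Notation H := (@harmonic R).

(** The integral of ln over (0,N), including the value 0 at N = 0. *)
Definition stirling (N : nat) : R := N%:R * ln N%:R - N%:R.
Local Notation L := stirling.

Lemma lnS_ge k : ln k.+1%:R + H k.+1 <= ln k.+2%:R :> R.
Proof.
rewrite -lerBrDl.
have -> : ln k.+2%:R - ln k.+1%:R = - ln (k.+1%:R / k.+2%:R) :> R.
  by rewrite ln_div ?posrE// opprB.
rewrite lerNr.
have -> : k.+1%:R / k.+2%:R = 1 + - H k.+1 :> R.
  apply: (canLR (mulfK _)) => //.
  by rewrite mulrDl mul1r mulNr /harmonic/= mulVf// -[k.+2%:R]natr1 addrK.
apply: le_ln1Dx; rewrite ltrN2 /harmonic/= invf_lt1// ltr1n//.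
Qed.

Lemma stirlingS N : ln N.+1%:R - H N <= L N.+1 - L N <= ln N.+1%:R.
Proof.
have -> : L N.+1 - L N = ln N.+1%:R + N%:R * (ln N.+1%:R - ln N%:R) - 1.
  rewrite /L -{1 3}[N.+1%:R]natr1; ring.
case: N => [|N].
  by rewrite mul0r addr0 ln1 /harmonic/= invr1; lra.
have h1 := lnS_ge N; have h2 := @lnS_le R N.
have p : 0 < N.+1%:R :> R by [].
have e1 : N.+1%:R * H N = 1 by rewrite /harmonic/= divff.
have e2 : N.+1%:R * H N.+1 = 1 - H N.+1.
  have -> : N.+1%:R = N.+2%:R - 1 :> R by rewrite -[N.+2%:R]natr1 addrK.
  by rewrite mulrBl /harmonic/= divff// mul1r.
have : N.+1%:R * H N.+1 <= N.+1%:R * (ln N.+2%:R - ln N.+1%:R).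
  by rewrite ler_pM2l//; move: h1; abstract_lra.
have : N.+1%:R * (ln N.+2%:R - ln N.+1%:R) <= N.+1%:R * H N.
  by rewrite ler_pM2l//; move: h2; abstract_lra.
rewrite e1 e2; move: (N.+1%:R * _) => y.
by abstract_lra.
Qed.

(** Each term is ln(m+1) up to O(1/(m+1)), so the errors add up to a logarithm. The factor 3 pays
    one increment of ln for the bound on the kernel and two for the defect in [stirlingS]. *)
Lemma log_kernel_sum_bounds N :
  L N - ln N.+1%:R + A 0 <= \sum_(m < N.+1) A m <= L N + 3 * ln N.+1%:R.
Proof.
have L0 : L 0 = 0 by rewrite /L mul0r subr0.
elim: N => [|N IH].
  rewrite big_ord_recl big_ord0 addr0 L0 ln1 subr0 add0r lexx/= mulr0 addr0.
  by have := @log_kernel_le R 0; rewrite ln1.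
rewrite big_ord_recr/=; move: IH; move: (\sum_(_ < _) _) => s.
have := stirlingS N; have h1 := lnS_ge N; have h2 := @lnS_le R N.
have h3 := @log_kernel_le R N.+1; have h4 := @log_kernel_ge R N.+1.
have h5 : H N <= 2 * H N.+1.
  rewrite /harmonic/= ler_pdivlMr// mulrC ler_pdivrMr// -natrM ler_nat; lia.
have h6 : 0 <= H N.+1 by exact: harmonic_ge0.
move: (L N.+1) (L N) (A 0) => l1 l0 a0.
by abstract_lra.
Qed.

(** The distances to j run through 0,...,j and 0,...,n-j; the distance 0 is counted twice. *)
Lemma log_kernel_row_sum n j : (j <= n)%N ->
  \sum_(i < n.+1) A (dist i j) =
  \sum_(m < j.+1) A m + \sum_(m < (n - j).+1) A m - A 0.
Proof.
move=> jn.
have -> : \sum_(i < n.+1) A (dist i j) = \sum_(0 <= i < n.+1) A (dist i j) by rewrite big_mkord.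
rewrite (@big_cat_nat _ _ _ j.+1)//=.
have -> : \sum_(0 <= i < j.+1) A (dist i j) = \sum_(m < j.+1) A m.
  rewrite big_nat_rev/= big_mkord; apply: eq_bigr => m _.
  by rewrite (_ : dist _ j = m)// /dist; have := ltn_ord m; lia.
rewrite -addrA; congr (_ + _).
rewrite big_ord_recl/= addrAC subrr add0r -{1}(add0n j.+1) big_addn big_mkord.
rewrite subSS; apply: eq_bigr => m _.
by rewrite (_ : dist (m + j.+1) j = bump 0 m)// /dist /bump; lia.
Qed.

End kernel_sums.

Section energy_asymptotics.
Context {R : realType}.
Local Notation A := (@log_kernel R).
Local Notation L := (@stirling R).
Variables (P : nat -> {poly R}) (v : forall n, 'cV[R]_n.+1).
Hypotheses (hP : orthogonal_polynomials P) (hv : fourier_coefficients P v).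

(** As ln 0 = 0, the values at 0 and 1 are 0, which is the continuous extension. *)
Definition entropy (x : R) : R := x * ln x + (1 - x) * ln (1 - x).

Lemma xlnx_ge (x : R) : 0 <= x -> x - 1 <= x * ln x.
Proof.
rewrite le_eqVlt => /predU1P[<-|x0]; first by rewrite mul0r; lra.
have h : - ln x <= x^-1 - 1.
  rewrite -lnV ?posrE//; have := @le_ln1Dx R (x^-1 - 1); rewrite addrCA subrr addr0; apply.
  have : 0 < x^-1 by rewrite invr_gt0.
  by move: x^-1 => y; lra.
have : x * - ln x <= x * (x^-1 - 1) by rewrite ler_pM2l.
rewrite mulrBr divff ?gt_eqF// mulrN mulr1; move: (x * ln x) => y; lra.
Qed.

Lemma xlnx_le0 (x : R) : 0 <= x <= 1 -> x * ln x <= 0.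
Proof. by move=> /andP[x0 x1]; rewrite mulr_ge0_le0// ln_le0. Qed.

Lemma entropy_bounds (x : R) : 0 <= x <= 1 -> -1 <= entropy x <= 0.
Proof.
move=> x01; have x01' : 0 <= 1 - x <= 1 by lra.
have := xlnx_le0 x01; have := xlnx_le0 x01'.
have /andP[x0 _] := x01; have /andP[x0' _] := x01'.
have := xlnx_ge x0; have := xlnx_ge x0'; rewrite /entropy.
move: (x * ln x) ((1 - x) * ln (1 - x)) => a b; lra.
Qed.

(** An exact identity, and the place where the entropy enters the energy. *)
Lemma stirling_split n j : (0 < n)%N -> (j <= n)%N ->
  L j + L (n - j) = n%:R * (ln n%:R + entropy (j%:R / n%:R) - 1).
Proof.
move=> n0 jn; have np : 0 < n%:R :> R by rewrite ltr0n.
have h k : k%:R * ln k%:R = k%:R * (ln n%:R + ln (k%:R / n%:R)) :> R.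
  case: k => [|k]; first by rewrite !mul0r.
  by rewrite ln_div ?posrE// addrC subrK.
have e : 1 - j%:R / n%:R = (n - j)%N%:R / n%:R :> R.
  by rewrite natrB// mulrBl divff ?gt_eqF.
rewrite /L /entropy e (h j) (h (n - j)%N).
move: (ln (_ / _)) (ln (_ / _)) (ln _) => a b c; rewrite natrB//.
by field; rewrite gt_eqF.
Qed.

Definition coefficient_mean n (f : R -> R) : R := \sum_(j < n.+1) v n j 0 * f (j%:R / n%:R).
Local Notation xi := coefficient_mean.

Lemma energy_row_mean n : n.+1%:R * energy v n =
  \sum_(j < n.+1) v n j 0 * \sum_(i < n.+1) A (dist i j).
Proof.
transitivity (\sum_(i < n.+1) \sum_(j < n.+1) v n j 0 * A (dist i j)); last first.
  by rewrite exchange_big/=; apply: eq_bigr => j _; rewrite mulr_sumr.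
rewrite (eq_bigr (fun=> energy v n)) => [|i _].
  by rewrite sumr_const card_ord mulr_natl.
by apply: (kernel_row hP hv); rewrite -ltnS.
Qed.

Lemma energy_mean_dist n : (0 < n)%N ->
  `|n.+1%:R * energy v n - n%:R * (ln n%:R + xi n entropy - 1)| <= 6 * ln n.+1%:R - 2 * A 0.
Proof.
move=> n0; rewrite energy_row_mean.
have -> : n%:R * (ln n%:R + xi n entropy - 1) = \sum_(j < n.+1) v n j 0 * (L j + L (n - j)).
  transitivity (\sum_(j < n.+1) (v n j 0 * (n%:R * (ln n%:R - 1)) +
     n%:R * (v n j 0 * entropy (j%:R / n%:R)))).
    rewrite big_split/= -mulr_suml (fourier_sum1 hP hv n) mul1r -mulr_sumr /xi; ring.
  apply: eq_bigr => j _; rewrite stirling_split//; last by rewrite -ltnS.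
  ring.
rewrite -sumrB (le_trans (ler_norm_sum _ _ _))//.
have -> : 6 * ln n.+1%:R - 2 * A 0 = \sum_(j < n.+1) v n j 0 * (6 * ln n.+1%:R - 2 * A 0).
  by rewrite -mulr_suml (fourier_sum1 hP hv n) mul1r.
apply: ler_sum => j _; rewrite -mulrBr normrM.
rewrite (ger0_norm (fourier_coefficient_ge0 hP hv _)) ler_wpM2l ?(fourier_coefficient_ge0 hP hv)//.
have jn : (j <= n)%N by rewrite -ltnS.
rewrite log_kernel_row_sum//.
have h1 := @log_kernel_sum_bounds R j; have h2 := @log_kernel_sum_bounds R (n - j).
have A0 : A 0 <= 0 by have := @log_kernel_le R 0; rewrite ln1.
have l1 : ln j.+1%:R <= ln n.+1%:R :> R by rewrite ler_ln ?posrE// ler_nat ltnS.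
have l2 : ln (n - j).+1%:R <= ln n.+1%:R :> R by rewrite ler_ln ?posrE// ler_nat ltnS leq_subr.
move: h1 h2 A0 l1 l2; move: (\sum_(_ < _) _) (\sum_(_ < _) _) (L _) (L _) => s1 s2 x y.
rewrite ler_norml.
by abstract_lra.
Qed.

End energy_asymptotics.

(** * The moments of the arcsine law as numbers *)

Section wallis.
Context {R : realType}.

(** The number binom(2k,k) / 4^k, the k-th coefficient of (1-z)^(-1/2). *)
Fixpoint wallis (k : nat) : R :=
  if k is j.+1 then wallis j * (2 * j%:R + 1) / (2 * j%:R + 2) else 1.

Lemma wallisS k : 2 * k.+1%:R * wallis k.+1 = (2 * k%:R + 1) * wallis k.
Proof.
rewrite /= -[k.+1%:R]natr1; field.
by rewrite gt_eqF// ltr_wpDl// mulr_ge0.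
Qed.

(** The square of (1-z)^(-1/2) is 1/(1-z). Coefficientwise: symmetry replaces the factor k+1 by 2a,
    [wallisS] turns 2(a+1) w_{a+1} into (2a+1) w_a, and symmetry again returns k+1 times the
    previous sum. *)
Lemma wallis_convolution k : \sum_(a < k.+1) wallis (k - a) * wallis a = 1.
Proof.
elim: k => [|k IH]; first by rewrite big_ord1 /= mul1r.
apply: (@mulfI _ k.+1%:R); first by rewrite pnatr_eq0.
rewrite mulr1.
have sym : \sum_(a < k.+2) (k.+1 - a)%N%:R * (wallis (k.+1 - a) * wallis a) =
    \sum_(a < k.+2) a%:R * (wallis (k.+1 - a) * wallis a).
  rewrite (reindex_inj rev_ord_inj)/=; apply: eq_bigr => a _.
  have -> : (k.+1 - (k.+2 - a.+1))%N = a by have := ltn_ord a; lia.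
  by rewrite subSS mulrCA mulrC -mulrA mulrCA.
have -> : k.+1%:R * \sum_(a < k.+2) wallis (k.+1 - a) * wallis a =
    \sum_(a < k.+2) 2 * (a%:R * (wallis (k.+1 - a) * wallis a)).
  rewrite -[RHS]mulr_sumr.
  transitivity (\sum_(a < k.+2) (k.+1 - a)%N%:R * (wallis (k.+1 - a) * wallis a) +
    \sum_(a < k.+2) a%:R * (wallis (k.+1 - a) * wallis a)); last by rewrite sym; ring.
  rewrite -big_split/= mulr_sumr; apply: eq_bigr => a _.
  by rewrite -mulrDl -natrD subnK// -ltnS.
rewrite big_ord_recl/= mul0r mulr0 add0r.
have e (a : nat) : 2 * (a.+1%:R * (wallis (k.+1 - a.+1) * wallis a.+1)) =
    (2 * a%:R + 1) * (wallis (k - a) * wallis a).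
  rewrite subSS; move: (wallisS a); move: (wallis a.+1) (wallis a) (wallis (k - a)) => x y z h.
  by rewrite [RHS]mulrCA -h; ring.
rewrite (eq_bigr (fun a : 'I_k.+1 => (2 * a%:R + 1) * (wallis (k - a) * wallis a))) => [|a _].
  have sym' : \sum_(a < k.+1) (k - a)%N%:R * (wallis (k - a) * wallis a) =
      \sum_(a < k.+1) a%:R * (wallis (k - a) * wallis a).
    rewrite (reindex_inj rev_ord_inj)/=; apply: eq_bigr => a _.
    have -> : (k - (k.+1 - a.+1))%N = a by have := ltn_ord a; lia.
    by rewrite subSS mulrCA mulrC -mulrA mulrCA.
  transitivity (k.+1%:R * \sum_(a < k.+1) wallis (k - a) * wallis a); last by rewrite IH mulr1.
  transitivity (\sum_(a < k.+1) a%:R * (wallis (k - a) * wallis a) +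
     \sum_(a < k.+1) a%:R * (wallis (k - a) * wallis a) +
     \sum_(a < k.+1) wallis (k - a) * wallis a).
    rewrite -!big_split/=; apply: eq_bigr => a _; ring.
  rewrite -{1}sym' -!big_split/= mulr_sumr; apply: eq_bigr => a _.
  rewrite -mulrDl -natrD subnK; last by rewrite -ltnS.
  by rewrite -[k.+1%:R]natr1 mulrDl mul1r.
exact: e.
Qed.

End wallis.

Section vanishing_sequences.
Context {R : realType}.

Lemma cvg_inv_ln (c : R) : c / ln n.+1%:R @[n --> \oo] --> 0.
Proof.
rewrite -[X in _ --> X](mulr0 c); apply: cvgMl_tmp.
apply/cvgrPdist_le => /= e e0; near=> n.
have n1 : expR e^-1 <= n.+1%:R.
  by rewrite (le_trans (ltW (truncnS_gt _)))// ler_nat ltnS; near: n; exact: nbhs_infty_ge.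
have h : e^-1 <= ln n.+1%:R by rewrite -[leLHS]expRK ler_ln ?posrE ?expR_gt0.
have e1 : 0 < e^-1 by rewrite invr_gt0.
rewrite sub0r normrN ger0_norm ?invr_ge0 ?(le_trans (ltW e1))//.
by rewrite -[leRHS]invrK lef_pV2 ?posrE// (lt_le_trans e1).
Unshelve. all: end_near. Qed.

Lemma cvg_ln_harmonic : ln n.+1%:R * harmonic n @[n --> \oo] --> (0 : R).
Proof.
apply: (@squeeze_cvgr _ _ _ _ (cst 0) (fun n => 2 * Num.sqrt (harmonic n))).
- near=> n; rewrite mulr_ge0 ?harmonic_ge0 ?ln_ge0 ?ler1n//=.
  have n0 : 0 < n.+1%:R :> R by [].
  have s0 : 0 < Num.sqrt n.+1%:R :> R by rewrite sqrtr_gt0.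
  (* The square root turns ln x < x into a bound of order N^(1/2). *)
  have l : ln n.+1%:R = 2 * ln (Num.sqrt n.+1%:R) :> R.
    by rewrite -{1}[n.+1%:R]sqr_sqrtr// lnXn// mulr_natl.
  rewrite /harmonic/= sqrtrV// ler_pdivrMr// -mulrA.
  have -> : (Num.sqrt n.+1%:R)^-1 * n.+1%:R = Num.sqrt n.+1%:R :> R.
    by rewrite -{2}[n.+1%:R]sqr_sqrtr// expr2 mulKf// gt_eqF.
  by rewrite l ler_pM2l// ltW// ln_sublinear.
- exact: cvg_cst.
- rewrite -[X in _ --> X](mulr0 2); apply: cvgMl_tmp.
  rewrite -[X in _ --> X](@sqrtr0 R).
  apply: (@cvg_comp _ _ _ harmonic (@Num.sqrt R) _ (nbhs (0 : R))).
    exact: cvg_harmonic.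
  exact: sqrt_continuous.
Unshelve. all: end_near. Qed.

End vanishing_sequences.

Section coefficient_limits.
Context {R : realType}.
Local Notation A := (@log_kernel R).
Variables (P : nat -> {poly R}) (v : forall n, 'cV[R]_n.+1).
Hypotheses (hP : orthogonal_polynomials P) (hv : fourier_coefficients P v).
Local Notation xi := (coefficient_mean v).

Lemma coefficient_mean_bound n (f : R -> R) (a b : R) :
  (forall x, 0 <= x <= 1 -> a <= f x <= b) -> a <= xi n f <= b.
Proof.
move=> ab; have h (j : 'I_n.+1) : a <= f (j%:R / n%:R) <= b.
  apply: ab; rewrite divr_ge0//=; have jn : (j <= n)%N by rewrite -ltnS.
  case: (posnP n) => [n0|n0].
    by rewrite [X in _ / X%:R]n0 invr0 mulr0.
  by rewrite ler_pdivrMr ?ltr0n// mul1r ler_nat.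
have c (d : R) : d = \sum_(j < n.+1) v n j 0 * d.
  by rewrite -mulr_suml (fourier_sum1 hP hv n) mul1r.
rewrite /coefficient_mean; apply/andP; split.
  rewrite [leLHS](c a).
  by apply: ler_sum => j _; rewrite ler_wpM2l ?(fourier_coefficient_ge0 hP hv)//; case/andP: (h j).
rewrite [leRHS](c b).
by apply: ler_sum => j _; rewrite ler_wpM2l ?(fourier_coefficient_ge0 hP hv)//; case/andP: (h j).
Qed.

Lemma log_kernel0_le0 : A 0 <= 0.
Proof. by have := @log_kernel_le R 0; rewrite ln1. Qed.

(** In the constant 9, the logarithmic error accounts for 6, entropy - 1 >= -2 for 2, and the factor
    n in place of n+1 for 1. *)
Lemma energy_ge n : (0 < n)%N -> ln n%:R - (9 - 2 * A 0) <= energy v n.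
Proof.
move=> n0; have := energy_mean_dist hP hv n0.
rewrite ler_norml => /andP[h _].
have /andP[x1 x2] := coefficient_mean_bound n entropy_bounds.
have l0 : ln n.+1%:R <= n.+1%:R :> R by rewrite ltW// ln_sublinear.
have l1 : ln n%:R <= n.+1%:R :> R.
  by apply: (le_trans (ltW (ln_sublinear _))); rewrite ?ltr0n// ler_nat.
have A0 := log_kernel0_le0.
have np : 0 < n.+1%:R :> R by [].
rewrite -(ler_pM2l np); move: h l0 l1 A0 x1.
have e : n.+1%:R = n%:R + 1 :> R by rewrite natr1.
have m0 : 0 <= n%:R :> R by [].
rewrite e; move: (energy v n) (xi n entropy) (A 0) (ln n%:R) (ln (n%:R + 1)).
move: (n%:R : R) m0 => m m0 t x a l l' h l0 l1 A0 x1.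
have : m * -1 <= m * x by rewrite ler_wpM2l.
have : m * a <= 0 by rewrite mulr_ge0_le0.
have -> : (m + 1) * (l - (9 - 2 * a)) = m * l - 9 * m + 2 * (m * a) + l - 9 + 2 * a by ring.
have e1 : (m + 1) * t - m * (l + x - 1) = (m + 1) * t - (m * l + m * x - m) by ring.
move: h; rewrite e1; move: (m * x) ((m + 1) * t) (m * l) (m * a) => mx mt ml ma; lra.
Qed.

(** In row i the diagonal kernel value is nonpositive and the others are at most ln(n+1); comparison
    with [energy_ge] isolates the coefficient. The constant 10 is 9 plus the 1 of ln(n+1) <= ln n +
    1. *)
Lemma fourier_coefficient_le n (i : 'I_n.+1) : (0 < n)%N ->
  v n i 0 <= (10 - 2 * A 0) / ln n.+1%:R.
Proof.
move=> n0; have l0 : 0 < ln n.+1%:R :> R by rewrite ln_gt0// ltr1n.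
rewrite ler_pdivlMr//.
have h : energy v n <= (1 - v n i 0) * ln n.+1%:R.
  have il : (i <= n)%N by rewrite -ltnS.
  rewrite -(kernel_row hP hv il) -{1}(fourier_sum1 hP hv n).
  rewrite (bigD1 i)//= [X in (X - _) * _](bigD1 i)//= addrAC subrr add0r mulr_suml.
  rewrite -[leRHS]add0r; apply: lerD.
    by rewrite mulr_ge0_le0 ?(fourier_coefficient_ge0 hP hv)// /dist subnn log_kernel0_le0.
  apply: ler_sum => j _; rewrite ler_wpM2l ?(fourier_coefficient_ge0 hP hv)//.
  apply: (le_trans (log_kernel_le _)); rewrite ler_ln ?posrE// ler_nat ltnS.
  by rewrite /dist; have := ltn_ord i; have := ltn_ord j; lia.
have h2 := energy_ge n0.
have h3 : ln n.+1%:R <= ln n%:R + 1 :> R.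
  case: n {i h h2 l0} n0 => // n _; apply: (le_trans (lnS_le n)); rewrite lerD2l.
  by rewrite /harmonic/= invf_le1// ler1n.
move: h h2 h3; rewrite mulrBl mul1r; move: (v n i 0 * _) => y.
move: (energy v n) => t; by abstract_lra.
Qed.

End coefficient_limits.

Lemma cvg_sum_ord {R : realType} (m : nat) (f : nat -> nat -> R) (l : nat -> R) :
  (forall a, (a < m)%N -> f a n @[n --> \oo] --> l a) ->
  \sum_(a < m) f a n @[n --> \oo] --> \sum_(a < m) l a.
Proof.
elim: m => [|m IH] h.
  by rewrite big_ord0; under eq_fun do rewrite big_ord0; exact: cvg_cst.
rewrite big_ord_recr/=; under eq_fun do rewrite big_ord_recr/=.
by apply: cvgD; [apply: IH => a am; apply: h; exact: ltnW|exact: h].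
Qed.

(** * Discrete Hilbert equations and limits of the moments *)

Section moments.
Context {R : realType}.
Local Notation A := (@log_kernel R).
Variables (P : nat -> {poly R}) (v : forall n, 'cV[R]_n.+1).
Hypotheses (hP : orthogonal_polynomials P) (hv : fourier_coefficients P v).
Local Notation xi := (coefficient_mean v).

(* The term [j = i] vanishes since [0^-1 = 0]. *)
Lemma coefficient_hilbert n i : (0 < i < n)%N ->
  \sum_(j < n.+1) v n j 0 * (i%:R - j%:R)^-1 = 0.
Proof.
move=> /andP[i0 iln].
have i2 : (i.+1 <= n)%N by [].
have i1 : (i.-1 <= n)%N by lia.
(* The kernel grows by 2/(d+1) over a step of two, so this difference is odd in i - j. *)
have e (j : nat) : A (dist i.+1 j) - A (dist i.-1 j) = 2 * (i%:R - j%:R)^-1.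
  have h d : A d.+2 - A d = 2 * d.+1%:R^-1.
    by rewrite log_kernelSS addrAC subrr add0r.
  have [ij|ij|ij] := ltngtP i j.
  - have -> : dist i.+1 j = (j - i.+1)%N by rewrite /dist; lia.
    have -> : dist i.-1 j = (j - i.+1).+2 by rewrite /dist; lia.
    rewrite -opprB h -mulrN -invrN; congr (_ * _^-1).
    by rewrite subnSK// natrB 1?ltnW// opprB.
  - have -> : dist i.+1 j = (i - j.+1).+2 by rewrite /dist; lia.
    have -> : dist i.-1 j = (i - j.+1)%N by rewrite /dist; lia.
    by rewrite h subnSK// natrB 1?ltnW.
  - rewrite ij subrr invr0 mulr0; apply/eqP; rewrite subr_eq0; apply/eqP.
    by rewrite (_ : dist j.+1 j = dist j.-1 j)// /dist; lia.
apply: (@mulfI _ 2) => //.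
rewrite mulr0 mulr_sumr.
transitivity (\sum_(j < n.+1) v n j 0 * A (dist i.+1 j) -
   \sum_(j < n.+1) v n j 0 * A (dist i.-1 j)).
  by rewrite -sumrB; apply: eq_bigr => j _; rewrite -mulrBr e mulrCA.
by rewrite (kernel_row hP hv i2) (kernel_row hP hv i1) subrr.
Qed.

Definition moment n k : R := xi n (fun x => x ^+ k).

(** The divided difference of x^(k+1) in polynomial form, which keeps the value (k+1) x^k on the
    diagonal. *)
Definition power_kernel k (x y : R) : R := \sum_(a < k.+1) x ^+ (k - a) * y ^+ a.

Lemma power_kernelE k (x y : R) : x != y ->
  power_kernel k x y = (x ^+ k.+1 - y ^+ k.+1) / (x - y).
Proof. by move=> xy; rewrite subrXX mulrC mulKf// subr_eq0. Qed.

Lemma power_kernel_bound k (x y : R) : 0 <= x <= 1 -> 0 <= y <= 1 ->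
  0 <= power_kernel k x y <= k.+1%:R.
Proof.
move=> /andP[x0 x1] /andP[y0 y1]; apply/andP; split.
  by apply: sumr_ge0 => a _; rewrite mulr_ge0 ?exprn_ge0.
rewrite -[in leRHS](card_ord k.+1) -sumr_const; apply: ler_sum => a _.
by rewrite mulr_ile1 ?exprn_ge0 ?exprn_ile1.
Qed.

Lemma moment_convolution n k :
  \sum_(i < n.+1) \sum_(j < n.+1) v n i 0 * v n j 0 * power_kernel k (i%:R / n%:R) (j%:R / n%:R) =
  \sum_(a < k.+1) moment n (k - a) * moment n a.
Proof.
transitivity (\sum_(a < k.+1) \sum_(i < n.+1) \sum_(j < n.+1)
   (v n i 0 * (i%:R / n%:R) ^+ (k - a)) * (v n j 0 * (j%:R / n%:R) ^+ a)).
  rewrite [RHS]exchange_big/=; apply: eq_bigr => i _; rewrite exchange_big/=.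
  by apply: eq_bigr => j _; rewrite mulr_sumr; apply: eq_bigr => a _; ring.
by apply: eq_bigr => a _; rewrite mulr_suml; apply: eq_bigr => i _; rewrite mulr_sumr.
Qed.

(* The interior equations [coefficient_hilbert], tested against
   [x^k.+1 - x^k.+2], which vanishes at both endpoints, and symmetrized. *)
Lemma moment_loop n k : (0 < n)%N ->
  let D (x y : R) := power_kernel k x y - power_kernel k.+1 x y in
  \sum_(i < n.+1) \sum_(j < n.+1) v n i 0 * v n j 0 * D (i%:R / n%:R) (j%:R / n%:R) =
  \sum_(i < n.+1) v n i 0 ^+ 2 * D (i%:R / n%:R) (i%:R / n%:R).
Proof.
move=> n0 D; have np : n%:R != 0 :> R by rewrite pnatr_eq0 -lt0n.
pose f (x : R) := x ^+ k.+1 - x ^+ k.+2.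
pose x (i : nat) : R := i%:R / n%:R.
have xB i j : (x i - x j)^-1 = n%:R * (i%:R - j%:R)^-1.
  by rewrite /x -mulrBl invfM invrK mulrC.
have row i : (i <= n)%N -> f (x i) * \sum_(j < n.+1) v n j 0 * (x i - x j)^-1 = 0.
  move=> iln; have [->|i0] := posnP i.
    by rewrite /f /x mul0r !expr0n/= subrr mul0r.
  move: iln; rewrite leq_eqVlt => /predU1P[->|iln].
    by rewrite /f /x divff// !expr1n subrr mul0r.
  rewrite (_ : \sum_(j < n.+1) _ = 0) ?mulr0//.
  have i0n : (0 < i < n)%N by rewrite i0.
  transitivity (n%:R * \sum_(j < n.+1) v n j 0 * (i%:R - j%:R)^-1); last first.
    by rewrite (coefficient_hilbert i0n) mulr0.
  rewrite mulr_sumr; by apply: eq_bigr => j _; rewrite xB mulrCA.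
have S0 : \sum_(i < n.+1) \sum_(j < n.+1) v n i 0 * v n j 0 * (f (x i) * (x i - x j)^-1) = 0.
  apply: big1 => i _; have il : (i <= n)%N by rewrite -ltnS.
  transitivity (v n i 0 * (f (x i) * \sum_(j < n.+1) v n j 0 * (x i - x j)^-1)).
    by rewrite !mulr_sumr; apply: eq_bigr => j _; ring.
  by rewrite row// mulr0.
have S1 : \sum_(i < n.+1) \sum_(j < n.+1) v n i 0 * v n j 0 * (f (x j) * (x i - x j)^-1) = 0.
  rewrite exchange_big/= -[RHS]oppr0 -[X in _ = - X]S0 -sumrN; apply: eq_bigr => i _.
  rewrite -sumrN; apply: eq_bigr => j _; rewrite -(opprB (x i)) invrN; ring.
have S2 : \sum_(i < n.+1) \sum_(j < n.+1) v n i 0 * v n j 0 * ((f (x i) - f (x j)) * (x i - x j)^-1) = 0.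
  rewrite -[RHS]subr0 -[X in X - _]S0 -[X in _ - X]S1 -sumrB; apply: eq_bigr => i _.
  by rewrite -sumrB; apply: eq_bigr => j _; ring.
rewrite -[LHS]subr0 -[X in _ - X]S2 -sumrB; apply: eq_bigr => i _.
(* Off the diagonal D is the divided difference of f and cancels against [S2]. On the diagonal the
   summand of [S2] is 0, which leaves the squares. *)
rewrite -sumrB (bigD1 i)//= big1 => [|j ji].
  by rewrite subrr mul0r mulr0 subr0 addr0 -expr2.
have xij : x i != x j.
  rewrite /x -subr_eq0 -mulrBl mulf_neq0 ?invr_eq0// subr_eq0 eqr_nat eq_sym//.
apply/eqP; rewrite subr_eq0; apply/eqP; congr (_ * _).
by rewrite /D !power_kernelE// /f -mulrBl; congr (_ / _); ring.
Qed.

(** By [moment_loop], passing from k to k+1 changes the sum by a weighted sum of squares, at most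
    (k+2) max v_{n,i}, which tends to 0; for k = 0 the sum is 1. *)
Lemma moment_convolution_cvg k :
  \sum_(a < k.+1) moment n (k - a) * moment n a @[n --> \oo] --> (1 : R).
Proof.
have m0 n : moment n 0 = 1.
  rewrite /moment /coefficient_mean -[RHS](fourier_sum1 hP hv n).
  by apply: eq_bigr => j _; rewrite expr0 mulr1.
elim: k => [|k IH].
  by under eq_fun do rewrite big_ord1 /= !m0 mulr1; exact: cvg_cst.
pose S k n : R := \sum_(a < k.+1) moment n (k - a) * moment n a.
rewrite (_ : (fun n => _) = (fun n => S k n - (S k n - S k.+1 n))); last first.
  by apply/funext => n; rewrite subKr.
rewrite -[X in _ --> X]subr0; apply: cvgB => //.
apply: norm_cvg0.
pose c : R := (10 - 2 * A 0) * k.+2%:R.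
apply: (@squeeze_cvgr _ _ _ _ (cst 0) (fun n => c / ln n.+1%:R)); last 2 first.
- exact: cvg_cst.
- exact: cvg_inv_ln.
near=> n; rewrite normr_ge0/=.
have n0 : (0 < n)%N by near: n; exact: nbhs_infty_gt.
have := moment_loop k n0; rewrite /= => loop.
have -> : S k n - S k.+1 n = \sum_(i < n.+1) v n i 0 ^+ 2 *
  (power_kernel k (i%:R / n%:R) (i%:R / n%:R) - power_kernel k.+1 (i%:R / n%:R) (i%:R / n%:R)).
  rewrite -loop /S -!moment_convolution -sumrB; apply: eq_bigr => i _.
  by rewrite -sumrB; apply: eq_bigr => j _; rewrite mulrBr.
rewrite (le_trans (ler_norm_sum _ _ _))//.
have -> : c / ln n.+1%:R = \sum_(i < n.+1) v n i 0 * (c / ln n.+1%:R).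
  by rewrite -mulr_suml (fourier_sum1 hP hv n) mul1r.
apply: ler_sum => i _; have v0 := fourier_coefficient_ge0 hP hv i.
rewrite normrM expr2 normrM (ger0_norm v0) -mulrA ler_wpM2l//.
rewrite /c mulrAC; apply: ler_pM => //; first exact: (fourier_coefficient_le hP hv).
have x01 : 0 <= (i%:R / n%:R : R) <= 1.
  by rewrite divr_ge0//= ler_pdivrMr ?ltr0n// mul1r ler_nat -ltnS.
have h1 := power_kernel_bound k x01 x01; have h2 := power_kernel_bound k.+1 x01 x01.
have h3 : k.+1%:R <= k.+2%:R :> R by rewrite ler_nat.
move: h1 h2 h3; move: (power_kernel _ _ _) (power_kernel _ _ _) => p q.
rewrite ler_norml; move: (k.+1%:R : R) (k.+2%:R : R) => s t; lra.
Unshelve. all: end_near. Qed.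

(** As the moment of order 0 is 1, the convolution of order k+1 contains the moment of that order
    twice and otherwise only lower ones; [wallis] solves the limiting recursion. *)
Lemma moment_cvg k : moment n k @[n --> \oo] --> (wallis k : R).
Proof.
have m0 n : moment n 0 = 1.
  rewrite /moment /coefficient_mean -[RHS](fourier_sum1 hP hv n).
  by apply: eq_bigr => j _; rewrite expr0 mulr1.
elim/ltn_ind: k => -[_|k IH].
  by under eq_fun do rewrite m0; exact: cvg_cst.
have split_ (y : nat -> R) : y 0%N = 1 -> y k.+1 = (\sum_(a < k.+2) y (k.+1 - a)%N * y a -
    \sum_(a < k) y (k - a)%N * y a.+1) / 2.
  move=> y0; rewrite big_ord_recl big_ord_recr/= subn0 subnn y0.
  rewrite (eq_bigr (fun a : 'I_k => y (k - a)%N * y a.+1)) => [|a _]; last first.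
    by rewrite /bump/= add1n subSS.
  by rewrite /bump/= add1n; field.
rewrite (split_ _ (erefl : wallis 0 = 1 :> R)) wallis_convolution.
under eq_fun do rewrite (split_ _ (m0 _)).
apply: cvgMr_tmp; apply: cvgB; first exact: moment_convolution_cvg.
apply: (cvg_sum_ord (f := fun a n => moment n (k - a) * moment n a.+1)
  (l := fun a => wallis (k - a) * wallis a.+1)) => a ak.
by apply: cvgM; apply: IH; lia.
Qed.

End moments.

(** * Bernstein polynomials *)

Section weierstrass.
Context {R : realType}.

(** The expectation of phi at a binomial variable with N trials of success probability x, by
    conditioning on one trial; its properties become direct inductions. The nodes are k, not k/N. *)
Fixpoint bernstein (N : nat) (phi : nat -> R) : {poly R} :=
  if N is m.+1 then 'X * bernstein m (phi \o S) + (1 - 'X) * bernstein m phi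
  else (phi 0)%:P.

Lemma bernsteinS N phi (x : R) : (bernstein N.+1 phi).[x] =
  x * (bernstein N (phi \o S)).[x] + (1 - x) * (bernstein N phi).[x].
Proof. by rewrite /= hornerD !hornerM hornerX hornerD hornerN hornerX hornerC. Qed.

Lemma bernstein_lin N (c d : R) (phi psi : nat -> R) (x : R) :
  (bernstein N (fun k => c * phi k + d * psi k)).[x] =
  c * (bernstein N phi).[x] + d * (bernstein N psi).[x].
Proof.
elim: N phi psi => [|N IH] phi psi; first by rewrite !hornerC.
rewrite !bernsteinS -/(bernstein N) (IH phi psi) (_ : _ \o S = (fun k => c * (phi \o S) k + d * (psi \o S) k))//.
by rewrite IH; ring.
Qed.

Lemma le_bernstein N (phi psi : nat -> R) (x : R) : 0 <= x <= 1 ->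
  (forall k, (k <= N)%N -> phi k <= psi k) ->
  (bernstein N phi).[x] <= (bernstein N psi).[x].
Proof.
move=> x01; elim: N phi psi => [|N IH] phi psi h; first by rewrite !hornerC h.
have /andP[x0 x1] := x01.
rewrite !bernsteinS; apply: lerD; apply: ler_wpM2l; rewrite ?subr_ge0//; apply: IH => k kN.
  exact: h.
by apply: h; exact: leqW.
Qed.

Lemma bernstein_cst N (c x : R) : (bernstein N (fun=> c)).[x] = c.
Proof.
elim: N => [|N IH]; first by rewrite hornerC.
by rewrite bernsteinS (_ : _ \o S = (fun=> c))// IH; ring.
Qed.

(** The centre c is arbitrary because a success shifts it to c - 1 in the induction. *)
Lemma bernstein_variance N (c x : R) :
  (bernstein N (fun k => (k%:R - c) ^+ 2)).[x] = N%:R * (x * (1 - x)) + (N%:R * x - c) ^+ 2.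
Proof.
elim: N c => [|N IH] c; first by rewrite hornerC; ring.
rewrite bernsteinS IH.
rewrite (_ : _ \o S = (fun k => (k%:R - (c - 1)) ^+ 2)); last first.
  by apply/funext => k /=; rewrite -[k.+1%:R]natr1; congr (_ ^+ 2); ring.
by rewrite IH -[N.+1%:R]natr1; ring.
Qed.

Lemma segment_uniform_continuity (f : R -> R) : {within `[0, 1], continuous f} ->
  forall e, 0 < e -> exists2 d, 0 < d &
  forall x y, 0 <= x <= 1 -> 0 <= y <= 1 -> `|x - y| < d -> `|f x - f y| <= e.
Proof.
move=> /subspace_continuousP cf e e0.
have /compact_near_coveringP cpt := @segment_compact R 0 1.
have e2 : 0 < e / 2 by lra.
have [] := cpt R (0^'+) (fun d x => 0 <= x <= 1 -> forall y, 0 <= y <= 1 ->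
  `|x - y| < d -> `|f x - f y| <= e) _.
  move=> x x01.
  have := cf x x01; rewrite /cvg_to => /cvgrPdist_lt /(_ _ e2).
  rewrite near_withinE => /nbhs_ballP[r /= r0 hr].
  have hr' z : 0 <= z <= 1 -> `|x - z| < r -> `|f x - f z| < e / 2.
    by move=> z01 xz; apply: hr => //=; rewrite in_itv.
  have aux (x' d : R) : `|x - x'| < r / 2 -> d < r / 2 -> 0 <= x' <= 1 ->
      forall y, 0 <= y <= 1 -> `|x' - y| < d -> `|f x' - f y| <= e.
    move=> h1 h2 x'01 y y01 xy.
    have h3 : `|f x - f x'| < e / 2 by apply: hr' => //; lra.
    have h4 : `|f x - f y| < e / 2.
      by apply: hr' => //; apply: (le_lt_trans (ler_distD x' _ _)); lra.
    by apply: (le_trans (ler_distD (f x) _ _)); rewrite distrC; lra.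
  have r2 : 0 < r / 2 by lra.
  exists (ball x (r / 2), [set d : R | d < r / 2]) => /=.
    by split; [exact: nbhsx_ballx|exact: nbhs_right_lt].
  by move=> [x' d] /= [h1 h2]; exact: aux.
move=> r /= r0 hr; exists (r / 2); first by lra.
have r2 : 0 < r / 2 by lra.
have h : ball_ [eta Num.norm] 0 r (r / 2) by rewrite /= sub0r normrN gtr0_norm//; lra.
move=> x y x01 y01 xy; exact: (hr (r / 2) h r2 x).
Qed.

Lemma segment_bounded (f : R -> R) : {within `[0, 1], continuous f} ->
  exists2 M, 0 < M & forall x, 0 <= x <= 1 -> `|f x| <= M.
Proof.
move=> cf; have [a _ ha] := EVT_max ler01 cf; have [b _ hb] := EVT_min ler01 cf.
exists (`|f a| + `|f b| + 1); first by rewrite ltr_wpDl// addr_ge0.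
move=> x x01; have xI : x \in `[0, 1] by rewrite in_itv.
have := ha x xI; have := hb x xI; have := ler_norm (f a); have := ler_norm (- f b).
rewrite normrN ler_norml; have := normr_ge0 (f a); have := normr_ge0 (f b); lra.
Qed.

Theorem weierstrass (f : R -> R) : {within `[0, 1], continuous f} ->
  forall e, 0 < e -> exists q : {poly R}, forall x, 0 <= x <= 1 -> `|f x - q.[x]| <= e.
Proof.
move=> cf e e0.
have e2 : 0 < e / 2 by lra.
have [d d0 hd] := segment_uniform_continuity cf e2.
have [M M0 hM] := segment_bounded cf.
(* Where |x - y| >= d, the oscillation 2M is at most c (x - y)^2, as in Chebyshev's inequality; the
   variance then controls the error. *)
pose c := 2 * M / d ^+ 2.
have d2 : 0 < d ^+ 2 by rewrite exprn_gt0.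
have c0 : 0 < c by rewrite divr_gt0//; lra.
have quad x y : 0 <= x <= 1 -> 0 <= y <= 1 -> `|f x - f y| <= e / 2 + c * (x - y) ^+ 2.
  move=> x01 y01; have [xy|xy] := ltP `|x - y| d.
    by rewrite (le_trans (hd _ _ x01 y01 xy))// lerDl mulr_ge0 ?sqr_ge0// ltW.
  have h1 : d ^+ 2 <= (x - y) ^+ 2.
    by rewrite -[leRHS]real_normK ?num_real// ler_sqr ?nnegrE// ltW.
  have h2 : 2 * M <= c * (x - y) ^+ 2.
    by rewrite /c mulrAC ler_pdivlMr// ler_wpM2l//; lra.
  rewrite (le_trans (ler_normB _ _))//; have := hM _ x01; have := hM _ y01; lra.
(* Chosen so that c/N <= e/2; the other half of e is the modulus of continuity. *)
pose N := (Num.truncn (c / (e / 2))).+1.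
have N0 : 0 < N%:R :> R by rewrite ltr0n.
have cN : c / N%:R <= e / 2.
  rewrite ler_pdivrMr// mulrC -ler_pdivrMr//; exact/ltW/truncnS_gt.
exists (bernstein N (fun k => f (k%:R / N%:R))) => x x01.
have E : f x = (bernstein N (fun=> f x)).[x] by rewrite bernstein_cst.
have V : (bernstein N (fun k => (e / 2) * 1 + (c / N%:R ^+ 2) * (k%:R - N%:R * x) ^+ 2)).[x] <= e.
  rewrite (bernstein_lin _ _ _ (fun=> 1)) bernstein_cst bernstein_variance subrr expr0n/= addr0 mulr1.
  have -> : c / N%:R ^+ 2 * (N%:R * (x * (1 - x))) = c / N%:R * (x * (1 - x)).
    by field; rewrite gt_eqF.
  have : c / N%:R * (x * (1 - x)) <= c / N%:R.
    have xx : x * (1 - x) <= 1 by apply: mulr_ile1; lra.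
    have cN0 : 0 <= c / N%:R by rewrite divr_ge0 ?(ltW c0).
    exact: ler_piMr.
  lra.
have kN k : (k <= N)%N -> 0 <= (k%:R / N%:R : R) <= 1.
  by move=> kN; rewrite divr_ge0//= ler_pdivrMr// mul1r ler_nat.
have Q k : (k <= N)%N -> `|f x - f (k%:R / N%:R)| <=
    (e / 2) * 1 + (c / N%:R ^+ 2) * (k%:R - N%:R * x) ^+ 2.
  move=> /kN h; apply: (le_trans (quad _ _ x01 h)); rewrite mulr1 lerD2l.
  rewrite le_eqVlt; apply/orP; left; apply/eqP; field; by rewrite gt_eqF.
pose err k : R := (e / 2) * 1 + (c / N%:R ^+ 2) * (k%:R - N%:R * x) ^+ 2.
have hi : (bernstein N (fun k => f (k%:R / N%:R))).[x] <=
    (bernstein N (fun k => 1 * f x + 1 * err k)).[x].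
  apply: le_bernstein => // k kN'; have := Q k kN'; rewrite ler_norml !mul1r -/(err k); lra.
have lo : (bernstein N (fun k => 1 * f x + -1 * err k)).[x] <=
    (bernstein N (fun k => f (k%:R / N%:R))).[x].
  apply: le_bernstein => // k kN'; have := Q k kN'; rewrite ler_norml mulN1r mul1r -/(err k); lra.
move: hi lo V; rewrite !(bernstein_lin _ _ _ (fun=> f x)) bernstein_cst -/err.
rewrite ler_norml; move: (bernstein N _).[x] (bernstein N _).[x] => y z; lra.
Qed.

End weierstrass.

(** * Integrals against the arcsine law *)

Section arcsine_density.
Context {R : realType}.
Notation mu := (@lebesgue_measure R).
Local Notation ap := (@arcsine_prob R).
Local Notation pdf := (@arcsine_pdf R).

Let mpdf : measurable_fun setT (EFin \o pdf).
Proof. by apply/measurable_EFinP; exact: measurable_arcsine_pdf. Qed.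

Let pdf0 x : (0 <= (pdf x)%:E)%E.
Proof. by rewrite lee_fin arcsine_pdf_ge0. Qed.

Let arcsine_indic E : measurable E ->
  (\int[ap]_x (\1_E x)%:E = \int[mu]_x ((\1_E x)%:E * (pdf x)%:E))%E.
Proof.
move=> mE; transitivity (\int[mu]_(x in E) (pdf x)%:E)%E.
  by rewrite integral_indic// setIT.
rewrite [LHS]integral_mkcond.
apply: eq_integral => x _; rewrite patchE indicE.
by case: ifPn => xE; rewrite ?mul1e ?mul0e.
Qed.

Import HBNNSimple.

Let arcsine_nnsfun (f : {nnsfun _ >-> R}) :
  (\int[ap]_x (f x)%:E = \int[mu]_x ((f x)%:E * (pdf x)%:E))%E.
Proof.
have mI r : measurable_fun [set: R] (\1_(f @^-1` [set r]) : R -> R).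
  exact: measurable_indic.
under [LHS]eq_integral do rewrite fimfunE -fsumEFin//.
rewrite [LHS]ge0_integral_fsum//; last 2 first.
  - by move=> r; exact/measurable_EFinP/measurableT_comp.
  - by move=> n x _; rewrite EFinM nnfun_muleindic_ge0.
under [RHS]eq_integral.
  move=> x xD; rewrite fimfunE -fsumEFin// ge0_mule_fsuml; last first.
    by move=> r; rewrite EFinM nnfun_muleindic_ge0.
  over.
rewrite [RHS]ge0_integral_fsum//; last 2 first.
  - move=> r; apply: emeasurable_funM => //.
    by apply/measurable_EFinP; apply: measurable_funM; [exact: measurable_cst|exact: mI].
  - by move=> n x _; rewrite mule_ge0// EFinM nnfun_muleindic_ge0.
apply: eq_fsbigr => r _.
rewrite integralZl_indic_nnsfun// arcsine_indic//.
have [r0|r0] := leP 0 r.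
  rewrite -ge0_integralZl//; last 2 first.
  - by apply: emeasurable_funM => //; apply/measurable_EFinP; exact: mI.
  - by move=> x _; rewrite mule_ge0// lee_fin.
  by apply: eq_integral => x _; rewrite EFinM muleA.
(* A nonnegative simple function takes no negative value. *)
have -> : f @^-1` [set r] = set0.
  by apply/seteqP; split => // x /= fx; move: r0; rewrite -fx ltNge fun_ge0.
transitivity (0%E : \bar R).
  by rewrite integral0_eq ?mule0// => x _; rewrite indicE in_set0 mul0e.
by apply/esym/integral0_eq => x _; rewrite indicE in_set0 mulr0 mul0e.
Qed.

(** The measure is defined by its density on sets only; the formula passes to simple functions and,
    by monotone convergence, to nonnegative ones. *)
Lemma ge0_integral_arcsine (f : R -> \bar R) : measurable_fun setT f ->
  (forall x, (0 <= f x)%E) ->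
  (\int[ap]_x f x = \int[mu]_x (f x * (pdf x)%:E))%E.
Proof.
move=> mf f0.
pose f_ := nnsfun_approx measurableT mf.
have mf_ n : measurable_fun [set: R] (fun x => (f_ n x)%:E).
  exact/measurable_EFinP/measurable_funTS.
have nd (x : R) m n : (m <= n)%N -> f_ m x <= f_ n x.
  by move=> mn; exact/lefP/nd_nnsfun_approx.
transitivity (lim (\int[ap]_x (f_ n x)%:E @[n --> \oo])%E).
  rewrite -monotone_convergence//=.
  - apply: eq_integral => ? /[!inE] xD; apply/esym/cvg_lim => //=.
    exact: cvg_nnsfun_approx.
  - by move=> n ? _; rewrite lee_fin.
  - by move=> ? _ ? ? mn; rewrite lee_fin; exact/lefP/nd_nnsfun_approx.
transitivity (lim (\int[mu]_x ((f_ n x)%:E * (pdf x)%:E) @[n --> \oo])%E).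
  by apply: congr_lim; apply/funext => n /=; exact: arcsine_nnsfun.
rewrite -monotone_convergence//=.
- apply: eq_integral => x _; apply/cvg_lim => //.
  apply: cvgeZr => //; exact: cvg_nnsfun_approx.
- by move=> n; apply: emeasurable_funM => //; exact: mf_.
- by move=> n x _; rewrite mule_ge0// lee_fin.
- move=> x _ m n mn; apply: lee_wpmul2r => //.
  by rewrite lee_fin; exact: nd.
Qed.

Lemma integral_arcsine01 (f : R -> R) : measurable_fun (`[0, 1]%classic : set R) f ->
  (\int[ap]_(x in `[0%R, 1%R]) (f x)%:E =
   \int[mu]_(x in `]0%R, 1%R[) (f x * (pi * Num.sqrt (x * (1 - x)))^-1)%:E)%E.
Proof.
move=> mf; pose F := (EFin \o f) \_ (`[0, 1]%classic : set R).
have mF : measurable_fun setT F.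
  have mf' : measurable_fun (`[0, 1]%classic : set R) (EFin \o f).
    exact/measurable_EFinP.
  exact: (iffLR (measurable_restrictT _ _) mf').
transitivity (\int[ap]_x F x)%E; first by rewrite [LHS]integral_mkcond.
rewrite [LHS]integralE !ge0_integral_arcsine//; last 2 first.
- exact: measurable_funeneg.
- exact: measurable_funepos.
transitivity (\int[mu]_x (F x * (pdf x)%:E))%E.
  rewrite [RHS]integralE; congr (_ - _)%E; apply: eq_integral => x _.
    by rewrite !funeposE [LHS]muleC maxe_pMr ?arcsine_pdf_ge0// mule0 muleC.
  by rewrite !funenegE [LHS]muleC maxe_pMr ?arcsine_pdf_ge0// mule0 muleN muleC.
rewrite [RHS]integral_mkcond; apply: eq_integral => x _.
rewrite !patchE /arcsine_pdf patchE.
have [xI|xI] := boolP (x \in (`]0, 1[%classic : set R)); last by rewrite mule0.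
rewrite /F patchE; have -> : x \in (`[0, 1]%classic : set R).
  by move: xI; rewrite !inE/= !in_itv/=; lra.
by rewrite -EFinM.
Qed.

Lemma integrable_arcsine_pdf :
  mu.-integrable `]0, 1[ (fun x => ((pi * Num.sqrt (x * (1 - x)))^-1)%:E).
Proof.
have h : mu.-integrable setT (EFin \o pdf).
  apply/integrableP; split => //.
  rewrite (_ : (\int[mu]_x _)%E = ap setT).
    by rewrite [ap setT]probability_setT ltry.
  by apply: eq_integral => x _ /=; rewrite ger0_norm ?arcsine_pdf_ge0.
have h' : mu.-integrable (`]0, 1[%classic : set R) (EFin \o pdf).
  by apply: integrableS h.
move: h'; apply: eq_integrable => // x; rewrite inE /= => x01.
by rewrite /arcsine_pdf patchE mem_set.
Qed.

Definition arcsine_mean (f : R -> R) : R := fine (\int[ap]_(x in `[0%R, 1%R]) (f x)%:E).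

Let in01 (x : R) : 0 < x < 1 -> 0 <= x <= 1. Proof. by lra. Qed.

Lemma measurable_within (f : R -> R) : {within `[0, 1], continuous f} ->
  measurable_fun (`[0, 1]%classic : set R) f.
Proof. by apply: subspace_continuous_measurable_fun. Qed.

Lemma integrable_arcsine_prob (f : R -> R) : {within `[0, 1], continuous f} ->
  ap.-integrable `[0, 1] (EFin \o f).
Proof.
move=> cf; have [M M0 hM] := segment_bounded cf.
apply: measurable_bounded_integrable => //.
- by rewrite (le_lt_trans (probability_le1 _ _)) ?ltry.
- exact: measurable_within.
- exists M; split; first exact: num_real.
  by move=> c cM x; rewrite /= in_itv/= => x01; rewrite (le_trans (hM _ x01))// ltW.
Qed.

Lemma integrable_arcsine_weighted (f : R -> R) : {within `[0, 1], continuous f} ->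
  mu.-integrable `]0, 1[ (EFin \o (fun x => f x * (pi * Num.sqrt (x * (1 - x)))^-1)).
Proof.
move=> cf; have [M M0 hM] := segment_bounded cf.
have mf : measurable_fun (`]0, 1[%classic : set R) f.
  apply: measurable_funS (measurable_within cf) => //; exact: subset_itv_oo_cc.
have h := integrable_arcsine_pdf.
have bf : [bounded f x | x in (`]0, 1[%classic : set R)].
  exists M; split; first exact: num_real.
  by move=> c cM x; rewrite /= in_itv/= => /in01 x01; rewrite (le_trans (hM _ x01))// ltW.
have := integrableMl _ h mf bf; move=> /(_ (measurable_itv _)).
by apply: eq_integrable => // x _ /=; rewrite -EFinM mulrC.
Qed.

(* Substitution [x = (1 + sin u) / 2]. *)
Lemma arcsine_meanE (f G : R -> R) : {within `[0, 1], continuous f} ->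
  (forall u, - (pi / 2) < u < pi / 2 -> is_derive u 1 G (f ((1 + sin u) / 2) / pi)) ->
  {for pi / 2, continuous G} -> {for - (pi / 2), continuous G} ->
  arcsine_mean f = G (pi / 2) - G (- (pi / 2)).
Proof.
move=> cf dG G1 G2; rewrite /arcsine_mean integral_arcsine01; last exact: measurable_within.
have p0 := pi_gt0 R.
pose th := @sine_angle R.
apply: (@exhaustion_FTC _ (fun x => f x * (pi * Num.sqrt (x * (1 - x)))^-1)
  (fun x => G (asin (2 * x - 1)))
  (fun n => (1 - sin (th n)) / 2) (fun n => (1 + sin (th n)) / 2)) => //.
- by move=> n; have := sin_sine_angle (R := R) n; rewrite -/th; lra.
- move=> m n /(@sine_angle_nd R) mn; rewrite subsetEset => x /=; rewrite !in_itv/= /th; lra.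
- have h := @sine_angle_exhausts R.
  apply/seteqP; split => x /=.
    move=> [n _]; rewrite /= !in_itv/=; have := sin_sine_angle (R := R) n; rewrite /th; lra.
  rewrite in_itv/= => x01.
  have : (`]-1, 1[%classic : set R) (2 * x - 1) by rewrite /= in_itv/=; lra.
  rewrite -h => -[n _]; rewrite /= in_itv/= => hn.
  by exists n => //=; rewrite in_itv/= /th; lra.
- exact: integrable_arcsine_weighted.
- move=> x xI; have {}xI : 0 < x < 1 by move: xI; rewrite /= in_itv.
  apply: cvgM.
    apply: (within_continuous_continuous (ltr01 : (0 : R) < 1) cf).
    by rewrite in_itv.
  apply: cvgV.
    rewrite mulf_neq0 ?gt_eqF// sqrtr_gt0 mulr_gt0//; lra.
  apply: cvgMl_tmp.
  apply: (@continuous_comp _ _ _ (fun x : R => x * (1 - x)) (@Num.sqrt R)).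
    by apply: cvgM; [exact: cvg_id|apply: cvgB; [exact: cvg_cst|exact: cvg_id]].
  exact: sqrt_continuous.
- move=> x xI; have {}xI : 0 < x < 1 by move: xI; rewrite /= in_itv.
  have yI : -1 < 2 * x - 1 < 1 by lra.
  have yc : -1 <= 2 * x - 1 <= 1 by lra.
  have d0 : is_derive x 1 (fun x : R => 2 * x - 1) 2.
    have d := is_deriveB (is_deriveZ (2 : R) (is_derive_id x (1 : R))) (is_derive_cst (1 : R) x 1).
    by apply: (is_derive_eq d); rewrite subr0 /GRing.scale/= mulr1.
  have d1 := @is_derive1_comp R (@asin R) _ x _ _ (is_derive1_asin yI) d0.
  have d2 := @is_derive1_comp R G _ x _ _ (dG _ (asin_gtlt yI)) d1.
  apply: (is_derive_eq d2); rewrite asinK ?in_itv//.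
  have -> : (1 + (2 * x - 1)) / 2 = x by field.
  have -> : 1 - (2 * x - 1) ^+ 2 = 2 ^+ 2 * (x * (1 - x)) by ring.
  rewrite sqrtrM// sqrtr_sqr ger0_norm//.
  have : Num.sqrt (x * (1 - x)) != 0.
    by rewrite gt_eqF// sqrtr_gt0 mulr_gt0//; lra.
  move: (Num.sqrt _) (pi : R) p0 (f x) => s p p0 y s0; field; rewrite s0 gt_eqF//.
- have e1 n : 2 * ((1 + sin (th n)) / 2) - 1 = sin (th n) by field.
  have e2 n : 2 * ((1 - sin (th n)) / 2) - 1 = - sin (th n) by field.
  under eq_fun do rewrite e1 e2 asin_sine_angle asinN_sine_angle.
  apply: cvgB.
    by apply: (@cvg_comp _ _ _ th G _ _ _ (@cvg_sine_angle R)); exact: G1.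
  apply: (@cvg_comp _ _ _ (fun n => - th n) G _ (nbhs (- (pi / 2)))) => //.
  by apply: cvgN; exact: cvg_sine_angle.
Qed.

End arcsine_density.

(** * Moments and mean entropy of the arcsine law *)

Section arcsine_integrals.
Context {R : realType}.
Local Notation ap := (@arcsine_prob R).

Lemma arcsine_meanD (f g : R -> R) : {within `[0, 1], continuous f} ->
  {within `[0, 1], continuous g} ->
  arcsine_mean (fun x => f x + g x) = arcsine_mean f + arcsine_mean g.
Proof.
move=> cf cg; rewrite /arcsine_mean.
have jf := integrable_arcsine_prob cf; have jg := integrable_arcsine_prob cg.
rewrite -fineD; [|exact: integrable_fin_num|exact: integrable_fin_num].
congr fine; rewrite -integralD//.
Qed.

Lemma arcsine_meanZ (c : R) (f : R -> R) : {within `[0, 1], continuous f} ->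
  arcsine_mean (fun x => c * f x) = c * arcsine_mean f.
Proof.
move=> cf; rewrite /arcsine_mean.
have jf := integrable_arcsine_prob cf.
rewrite -[c in RHS]/(fine c%:E) -fineM//; last exact: integrable_fin_num.
congr fine; rewrite -integralZl//.
Qed.

Let cX k : {within `[0, 1], continuous (fun x : R => x ^+ k)}.
Proof. by apply: continuous_subspaceT; exact: exprn_continuous. Qed.

Let cZX (c : R) k : {within `[0, 1], continuous (fun x : R => c * x ^+ k)}.
Proof.
by apply: continuous_subspaceT => x; apply: cvgMl_tmp; exact: exprn_continuous.
Qed.

Let cH (x : R) : {for x, continuous (fun u : R => (1 + sin u) / 2)}.
Proof. by apply: cvgMr_tmp; apply: cvgD; [exact: cvg_cst|exact: continuous_sin]. Qed.

Lemma arcsine_mean_cst1 : arcsine_mean (fun x : R => x ^+ 0) = 1.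
Proof.
have p0 : (pi : R) != 0 by rewrite gt_eqF ?pi_gt0.
have c (u : R) : {for u, continuous (fun u : R => u / pi)} by apply: cvgMr_tmp; exact: cvg_id.
have dG u : - (pi / 2) < u < pi / 2 ->
    is_derive u 1 (fun u : R => u / pi) (((1 + sin u) / 2) ^+ 0 / pi).
  move=> _; rewrite expr0.
  have d := is_deriveZ (pi^-1 : R) (is_derive_id u (1 : R)).
  have -> : (fun u : R => u / pi) = (pi^-1 *: id) by apply/funext => y; rewrite mulrC.
  by apply: (is_derive_eq d); rewrite /GRing.scale/= mulrC.
rewrite (arcsine_meanE (@cX 0%N) dG (c _) (c _)).
by move: (pi : R) p0 => p p0; field.
Qed.

(** With x = (1 + sin u)/2, the derivative of x^k cos u is (2k+1) x^k - (2k+2) x^(k+1), and x^k cos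
    u vanishes at both ends; the moments therefore satisfy [wallisS]. *)
Lemma arcsine_moment k : arcsine_mean (fun x : R => x ^+ k) = wallis k.
Proof.
have p0 : (pi : R) != 0 by rewrite gt_eqF ?pi_gt0.
elim: k => [|k IH]; first exact: arcsine_mean_cst1.
have E : arcsine_mean (fun x : R => (2 * k%:R + 1) * x ^+ k + (- (2 * k.+1%:R)) * x ^+ k.+1) = 0.
  have c : forall u : R, {for u, continuous (fun u : R => ((1 + sin u) / 2) ^+ k * (cos u / pi))}.
    move=> u; apply: cvgM.
      apply: (@continuous_comp _ _ _ (fun u : R => (1 + sin u) / 2) (fun x => x ^+ k)); first exact: cH.
      exact: exprn_continuous.
    by apply: cvgMr_tmp; exact: continuous_cos.
  have cf : {within `[0, 1], continuous (fun x : R => (2 * k%:R + 1) * x ^+ k + (- (2 * k.+1%:R)) * x ^+ k.+1)}.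
    apply: continuous_subspaceT => x; apply: cvgD; apply: cvgMl_tmp; exact: exprn_continuous.
  have dG u : - (pi / 2) < u < pi / 2 ->
      is_derive u 1 (fun u : R => ((1 + sin u) / 2) ^+ k * (cos u / pi))
       (((2 * k%:R + 1) * ((1 + sin u) / 2) ^+ k + (- (2 * k.+1%:R)) * ((1 + sin u) / 2) ^+ k.+1) / pi).
    move=> _.
    have d1 : is_derive u 1 (fun u : R => (1 + sin u) / 2) (cos u / 2).
      have d := is_deriveZ (2^-1 : R) (is_deriveD (is_derive_cst (1 : R) u 1) (is_derive_sin u)).
      have -> : (fun u : R => (1 + sin u) / 2) = (2^-1 *: (cst 1 + sin)) by apply/funext => y; rewrite mulrC.
      by apply: (is_derive_eq d); rewrite /GRing.scale/= add0r mulrC.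
    have dX (y : R) : is_derive y 1 (fun x : R => x ^+ k) (k%:R * y ^+ k.-1).
      have -> : (fun x : R => x ^+ k) = (@idfun R) ^+ k by apply/funext => z; rewrite exprfctE.
      have d := is_deriveX k (is_derive_id y (1 : R)).
      by apply: (is_derive_eq d); rewrite /GRing.scale/= mulr1.
    have d2 := @is_derive1_comp R _ _ u _ _ (dX ((1 + sin u) / 2)) d1.
    have d3 : is_derive u 1 (fun u : R => cos u / pi) (- sin u / pi).
      have d := is_deriveZ (pi^-1 : R) (is_derive_cos u).
      have -> : (fun u : R => cos u / pi) = (pi^-1 *: cos) by apply/funext => y; rewrite mulrC.
      by apply: (is_derive_eq d); rewrite /GRing.scale/= mulrC.
    apply: (is_derive_eq (is_deriveM d2 d3)); rewrite /GRing.scale/=.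
    (* Covers k = 0 as well, where [k.-1] is again 0. *)
    have kE : k%:R * ((1 + sin u) / 2) ^+ k = (1 + sin u) / 2 * (k%:R * ((1 + sin u) / 2) ^+ k.-1).
      by case: (k) => [|j]; [rewrite !mul0r mulr0|rewrite exprS; ring].
    have := cos2sin2 u; rewrite (exprS ((1 + sin u) / 2)) -[k.+1%:R]natr1.
    have -> : (2 * k%:R + 1) * ((1 + sin u) / 2) ^+ k = 2 * (k%:R * ((1 + sin u) / 2) ^+ k) + ((1 + sin u) / 2) ^+ k.
      by ring.
    have -> : - (2 * (k%:R + 1)) * ((1 + sin u) / 2 * ((1 + sin u) / 2) ^+ k) =
       - (1 + sin u) * (k%:R * ((1 + sin u) / 2) ^+ k + ((1 + sin u) / 2) ^+ k) by field.
    rewrite kE.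
    move: (pi : R) p0 (sin u) (cos u) => p p0 s q e.
    move: (k%:R * ((1 + s) / 2) ^+ k.-1) (((1 + s) / 2) ^+ k) => B C.
    have -> : C * (- s / p) + q / p * (B * (q / 2)) = (- C * s + B * q ^+ 2 / 2) / p by field.
    by rewrite e; field.
  rewrite (arcsine_meanE cf dG (c _) (c _)).
  by rewrite cosN !cos_pihalf !mul0r !mulr0 subrr.
move: E; rewrite arcsine_meanD// !arcsine_meanZ// IH.
move=> E; apply: (@mulfI _ (2 * k.+1%:R)); first by rewrite mulf_neq0// pnatr_eq0.
by rewrite wallisS; move: E; rewrite mulNr => /eqP; rewrite subr_eq0 => /eqP ->.
Qed.

(** For x < 0 the function is 0, as ln is there. To the right of 0, with s = sqrt x, x ln x = 2 s (s
    ln s) >= 2 s (s - 1) >= -2 s. *)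
Lemma continuous_xlnx : continuous (fun x : R => x * ln x).
Proof.
move=> x; have [x0|x0|x0] := ltgtP x 0.
- have e : {near x, (fun=> 0) =1 (fun x : R => x * ln x)}.
    near=> y; rewrite ln0 ?mulr0//; apply: ltW; near: y; exact: lt_nbhsl.
  rewrite /prop_for /continuous_at (ln0 (ltW x0)) mulr0.
  by apply: cvg_trans (near_eq_cvg e) _; exact: cvg_cst.
- by apply: cvgM; [exact: cvg_id|exact: continuous_ln].
- rewrite x0 /prop_for /continuous_at mul0r.
  apply: (@squeeze_cvgr _ _ _ _ (fun x => - (2 * Num.sqrt x)) (fun=> 0)).
  + near=> y.
    have y1 : y <= 1 by apply: ltW; near: y; apply: lt_nbhsl; lra.
    have [y0|y0] := leP y 0.
      by rewrite ln0// mulr0 lexx andbT oppr_le0 mulr_ge0 ?sqrtr_ge0.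
    rewrite xlnx_le0 ?(ltW y0)// andbT.
    have s0 : 0 < Num.sqrt y by rewrite sqrtr_gt0.
    have h := xlnx_ge (ltW s0).
    rewrite -{2 3}(sqr_sqrtr (ltW y0)) lnXn//.
    move: (Num.sqrt y) (ln (Num.sqrt y)) s0 h => s l s0 h.
    have -> : s ^+ 2 * (l *+ 2) = 2 * s * (s * l) by ring.
    have : 2 * s * (s - 1) <= 2 * s * (s * l) by rewrite ler_pM2l ?mulr_gt0.
    have : 0 <= s * s by rewrite mulr_ge0 ?ltW.
    move: (s * l) => q; rewrite mulrBr; move: (2 * s * q) => z; nra.
  + have : - (2 * Num.sqrt x) @[x --> (0 : R)] --> - (2 * Num.sqrt (0 : R)).
      by apply: cvgN; apply: cvgMl_tmp; exact: sqrt_continuous.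
    by rewrite sqrtr0 mulr0 oppr0.
  + exact: cvg_cst.
Unshelve. all: end_near. Qed.

Lemma continuous_entropy : continuous (@entropy R).
Proof.
move=> x; apply: cvgD; first exact: continuous_xlnx.
apply: (@continuous_comp _ _ _ (fun x : R => 1 - x) (fun x => x * ln x)).
  by apply: cvgB; [exact: cvg_cst|exact: cvg_id].
exact: continuous_xlnx.
Qed.

(* A primitive of [2 * sin p ^+ 2 * ln (sin p)]. *)
Let g (p : R) := (p - sin p * cos p) * ln (sin p) - sine_primitive p + (p + sin p * cos p) / 2.

(** Integration by parts: p - sin p cos p is a primitive of 2 sin^2 p, and its product with cot p is
    p cot p - cos^2 p, the first term being the derivative of [sine_primitive]. *)
Let is_derive_g (p : R) : 0 < p < pi / 2 -> is_derive p 1 g (2 * sin p ^+ 2 * ln (sin p)).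
Proof.
move=> p1; have s0 : 0 < sin p by exact: sin_gt0_pihalf.
have dsc := is_deriveM (is_derive_sin p) (is_derive_cos p).
have d1 := is_deriveB (is_derive_id p (1 : R)) dsc.
have d2 := @is_derive1_comp R (@ln R) _ p _ _ (is_derive1_ln s0) (is_derive_sin p).
have d3 := is_derive_sine_primitive p1.
have d4 := is_deriveZ (2^-1 : R) (is_deriveD (is_derive_id p (1 : R)) dsc).
have d := is_deriveD (is_deriveB (is_deriveM d1 d2) d3) d4.
have -> : g = ((id - (sin \* cos)) \* (@ln R \o sin) - sine_primitive + 2^-1 *: (id + (sin \* cos)))%R.
  by apply/funext => y; rewrite /g [_ / 2]mulrC.
apply: (is_derive_eq d); rewrite /GRing.scale/= !fctE.
have := cos2sin2 p.
move: (sin p) (cos p) (ln (sin p)) s0 => s c l s0 e.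
have s0' : s != 0 by rewrite gt_eqF.
have -> : (p - s * c) * (s^-1 * c) + l * (1 - (s * - s + c * c)) - p / s * c + 2^-1 * (1 + (s * - s + c * c)) =
   - c ^+ 2 + l * (1 + s ^+ 2 - c ^+ 2) + 2^-1 * (1 - s ^+ 2 + c ^+ 2) by field.
by rewrite e; field.
Qed.

Let xlnx_sin : continuous (fun p : R => sin p * ln (sin p)).
Proof.
move=> p; apply: (@continuous_comp _ _ _ (@sin R) (fun x => x * ln x)).
  exact: continuous_sin.
exact: continuous_xlnx.
Qed.

Let csc : continuous (fun p : R => sin p * cos p).
Proof. by move=> p; apply: cvgM; [exact: continuous_sin|exact: continuous_cos]. Qed.

Let cg_rest (p : R) : {for p, continuous (fun p : R => (p + sin p * cos p) / 2)}.
Proof. by apply: cvgMr_tmp; apply: cvgD; [exact: cvg_id|exact: csc]. Qed.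

Let continuous_g0 : {for 0, continuous g}.
Proof.
have p0 := pi_gt0 R.
have c1 : {for 0, continuous (fun p : R => (p - sin p * cos p) * ln (sin p))}.
  rewrite /prop_for /continuous_at sin0 mul0r subr0 mul0r.
  apply/norm_cvg0P.
  (* The constant 5 combines |p| <= 4 |sin p|, from [asin_le4], with |sin p cos p| <= |sin p|. *)
  apply: (@squeeze_cvgr _ _ _ _ (fun=> 0) (fun p => 5 * `|sin p * ln (sin p)|)).
  - near=> p; rewrite normr_ge0/=.
    have pb : - (pi / 2) < p < pi / 2.
      by apply/andP; split; near: p; [apply: lt_nbhsr|apply: lt_nbhsl]; lra.
    have [s0|s0] := leP (sin p) 0; first by rewrite ln0// !mulr0 normr0 mulr0.
    rewrite !normrM mulrA ler_wpM2r//.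
    have s1 : sin p < 1.
      have : sin p < sin (pi / 2) by rewrite ltr_sin ?in_itv/=; lra.
      by rewrite sin_pihalf.
    have h : -1 < sin p < 1 by lra.
    have := asin_le4 h; rewrite sinK ?in_itv/=; last by lra.
    have : `|sin p * cos p| <= `|sin p|.
      by rewrite normrM ler_piMr// ler_norml cos_geN1 cos_le1.
    have := ler_normB p (sin p * cos p).
    by move: `|p| `|_ * _| `|_ - _| `|sin p| => x y z t; lra.
  - exact: cvg_cst.
  - have : 5 * `|sin p * ln (sin p)| @[p --> (0 : R)] --> 5 * `|sin (0 : R) * ln (sin 0)|.
      by apply: cvgMl_tmp; apply: cvg_norm; exact: xlnx_sin.
    by rewrite sin0 mul0r normr0 mulr0.
apply: cvgD; last exact: cg_rest.
by apply: cvgB; [exact: c1|exact: continuous_sine_primitive].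
Unshelve. all: end_near. Qed.

Let continuous_g_pihalf : {for pi / 2, continuous g}.
Proof.
have c1 : {for pi / 2, continuous (fun p : R => (p - sin p * cos p) * ln (sin p))}.
  apply: cvgM; first by apply: cvgB; [exact: cvg_id|exact: csc].
  apply: (@continuous_comp _ _ _ (@sin R) (@ln R)); first exact: continuous_sin.
  by apply: continuous_ln; rewrite sin_pihalf.
apply: cvgD; last exact: cg_rest.
by apply: cvgB; [exact: c1|exact: continuous_sine_primitive].
Qed.

Let g_total : g (pi / 2) - g 0 = pi / 4 - pi / 2 * ln 2.
Proof.
have := @sine_primitive_pihalf R.
rewrite /g cos_pihalf sin_pihalf sin0 !mul0r !mulr0 subr0 ln1 mulr0 !addr0 mul0r !sub0r.
move: (sine_primitive _) (sine_primitive 0) (ln 2) => a b c; lra.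
Qed.

(** The angle that writes the arcsine variable (1 + sin u)/2 as a square sin^2 p, with logarithm 2
    ln (sin p). *)
Let half (u : R) : R := (u + pi / 2) / 2.

Let chalf (u : R) : {for u, continuous half}.
Proof. by apply: cvgMr_tmp; apply: cvgD; [exact: cvg_id|exact: cvg_cst]. Qed.

Let sin_half (u : R) : sin (half u) ^+ 2 = (1 + sin u) / 2.
Proof.
have : cos (half u *+ 2) = - sin u.
  have -> : half u *+ 2 = u + pi / 2 by rewrite /half mulr2n; field.
  by rewrite cosD cos_pihalf sin_pihalf mulr0 mulr1 sub0r.
by rewrite cos_mulr2n cos2sin2 mulr2n; move: (sin (half u) ^+ 2) (sin u) => a b; lra.
Qed.

Let Gx (u : R) : R := 2 / pi * g (half u).

Let is_derive_Gx (u : R) : - (pi / 2) < u < pi / 2 ->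
  is_derive u 1 Gx ((1 + sin u) / 2 * ln ((1 + sin u) / 2) / pi).
Proof.
move=> u1; have p0 := pi_gt0 R.
have h1 : 0 < half u < pi / 2 by rewrite /half; lra.
have d0 : is_derive u 1 half 2^-1.
  have d := is_deriveZ (2^-1 : R) (is_deriveD (is_derive_id u (1 : R)) (is_derive_cst (pi / 2 : R) u 1)).
  have -> : half = 2^-1 *: (id + cst (pi / 2)) by apply/funext => y; rewrite /half mulrC.
  by apply: (is_derive_eq d); rewrite /GRing.scale/= addr0 mulr1.
have d := is_deriveZ (2 / pi : R) (@is_derive1_comp R g half u _ _ (is_derive_g h1) d0).
apply: (is_derive_eq d); rewrite /GRing.scale/= -sin_half lnXn ?sin_gt0_pihalf//.
have p0' : (pi : R) != 0 by rewrite gt_eqF.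
by move: (sin _) (ln _) (pi : R) p0' => s l p p0'; field.
Qed.

Let cGx (u : R) : {for half u, continuous g} -> {for u, continuous Gx}.
Proof.
move=> c; apply: cvgMl_tmp; apply: (@continuous_comp _ _ _ half g); first exact: chalf.
exact: c.
Qed.

(** The reflection of u to -u exchanges the two halves of the entropy, hence the primitive Gx(u) -
    Gx(-u). The value is twice (2/pi) (pi/4 - (pi/2) log 2). *)
Lemma arcsine_mean_entropy : arcsine_mean (@entropy R) = 1 - 2 * ln 2.
Proof.
have p0 := pi_gt0 R.
have hp : half (pi / 2) = pi / 2 by rewrite /half; field.
have hN : half (- (pi / 2)) = 0 by rewrite /half addNr mul0r.
have cp : {for pi / 2, continuous Gx} by apply: cGx; rewrite hp.
have cN : {for - (pi / 2), continuous Gx} by apply: cGx; rewrite hN.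
have ce : {within `[0, 1], continuous (@entropy R)}.
  by apply: continuous_subspaceT; exact: continuous_entropy.
have dG u : - (pi / 2) < u < pi / 2 ->
    is_derive u 1 (fun u => Gx u - Gx (- u)) (entropy ((1 + sin u) / 2) / pi).
  move=> u1; have u2 : - (pi / 2) < - u < pi / 2 by lra.
  have d1 := is_deriveN (is_derive_id u (1 : R)).
  have d2 := @is_derive1_comp R Gx _ u _ _ (is_derive_Gx u2) d1.
  apply: (is_derive_eq (is_deriveB (is_derive_Gx u1) d2)).
  rewrite sinN /entropy.
  have -> : 1 - (1 + sin u) / 2 = (1 + - sin u) / 2 by field.
  by move: (_ * ln _) (_ * ln _) (pi : R) => a b p; ring.
have N u : {for u, continuous (fun u : R => - u)} by exact: opp_continuous.
have c1 : {for pi / 2, continuous (fun u => Gx u - Gx (- u))}.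
  apply: cvgB; first exact: cp.
  by apply: (@continuous_comp _ _ _ (fun u => - u) Gx); [exact: N|exact: cN].
have c2 : {for - (pi / 2), continuous (fun u => Gx u - Gx (- u))}.
  apply: cvgB; first exact: cN.
  apply: (@continuous_comp _ _ _ (fun u => - u) Gx); first exact: N.
  by rewrite opprK; exact: cp.
rewrite (arcsine_meanE ce dG c1 c2) opprK /Gx hp hN.
have -> : g (pi / 2) = g 0 + (pi / 4 - pi / 2 * ln 2) by rewrite -g_total addrC subrK.
have p0' : (pi : R) != 0 by rewrite gt_eqF.
by move: (g 0) (ln 2) (pi : R) p0' => x l p p0'; field.
Qed.

End arcsine_integrals.

(** * Weak convergence and the limit of the energy *)

Section coefficient_measure.
Context {R : realType} (P : nat -> {poly R}) (v : forall n, 'cV[R]_n.+1).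
Hypothesis hP : orthogonal_polynomials P.
Hypothesis hv : fourier_coefficients P v.

Let weight n k : {nonneg R} := NngNum (fourier_coefficient_ge0 hP hv (inord k : 'I_n.+1)).

Definition coefficient_measure n : set R -> \bar R :=
  msum (fun k => mscale (weight n k) (@dirac _ R (k%:R / n%:R) R)) n.+1.

HB.instance Definition _ n := Measure.on (coefficient_measure n).

Lemma coefficient_measureE n A : coefficient_measure n A =
  (\sum_(k < n.+1) (v n k 0)%:E * \d_((k%:R / n%:R)%R : R) A)%E.
Proof.
by rewrite /coefficient_measure /msum; apply: eq_bigr => k _; rewrite /mscale /weight/= inord_val.
Qed.

Let coefficient_measure_setT n : coefficient_measure n setT = 1%E.
Proof.
rewrite coefficient_measureE.
under eq_bigr do rewrite diracT mule1.
by rewrite sumEFin (fourier_sum1 hP hv).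
Qed.

HB.instance Definition _ n :=
  @Measure_isProbability.Build _ _ R (coefficient_measure n) (coefficient_measure_setT n).

Let D : set R := `[0, 1].

Let node_in n (k : 'I_n.+1) : D (k%:R / n%:R).
Proof.
rewrite /D/= in_itv/= divr_ge0//=; have kn : (k <= n)%N by rewrite -ltnS.
case: (posnP n) => [n0|n0]; first by rewrite [X in _ / X%:R]n0 invr0 mulr0.
by rewrite ler_pdivrMr ?mul1r ?ler_nat ?ltr0n.
Qed.

Let ge0_integral_coefficient n (f : R -> \bar R) : measurable_fun D f ->
  (forall x, D x -> (0 <= f x)%E) ->
  (\int[coefficient_measure n]_(x in D) f x =
   \sum_(k < n.+1) (v n k 0)%:E * f (k%:R / n%:R)%R)%E.
Proof.
move=> mf f0; have mD : measurable D by exact: measurable_itv.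
rewrite ge0_integral_measure_sum//; apply: eq_bigr => k _.
rewrite ge0_integral_mscale// integral_dirac// /weight/= inord_val diracE mem_set ?mul1e//.
Qed.

Lemma integral_coefficient n (f : R -> R) : measurable_fun D f ->
  (\int[coefficient_measure n]_(x in D) (f x)%:E = (coefficient_mean v n f)%:E)%E.
Proof.
move=> mf; have mf' : measurable_fun D (EFin \o f) by exact/measurable_EFinP.
rewrite integralE !ge0_integral_coefficient//; last 2 first.
- exact: measurable_funeneg.
- exact: measurable_funepos.
under eq_bigr do rewrite funeposE -EFin_max.
under [X in (_ - X)%E]eq_bigr do rewrite funenegE -EFinN -EFin_max -EFinM.
rewrite !sumEFin -EFinB -sumrB; congr EFin; apply: eq_bigr => k _.
rewrite -mulrBr; congr *%R; move: (f _) => y.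
rewrite /Order.max/=; case: ifPn => h1; case: ifPn => h2; lra.
Qed.

Lemma coefficient_meanB n (f g : R -> R) :
  coefficient_mean v n (fun x => f x - g x) = coefficient_mean v n f - coefficient_mean v n g.
Proof. by rewrite /coefficient_mean -sumrB; apply: eq_bigr => j _; rewrite mulrBr. Qed.

Lemma coefficient_mean_poly n (q : {poly R}) :
  coefficient_mean v n (horner q) = \sum_(i < size q) q`_i * moment v n i.
Proof.
rewrite /moment /coefficient_mean.
transitivity (\sum_(j < n.+1) \sum_(i < size q) q`_i * (v n j 0 * (j%:R / n%:R) ^+ i)).
  apply: eq_bigr => j _; rewrite horner_coef mulr_sumr; apply: eq_bigr => i _.
  by rewrite mulrCA.
by rewrite exchange_big/=; apply: eq_bigr => i _; rewrite mulr_sumr.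
Qed.

Lemma continuous_within_horner (q : {poly R}) : {within `[0, 1], continuous (horner q)}.
Proof. by apply: continuous_subspaceT; exact: continuous_horner. Qed.

Lemma arcsine_mean_poly (q : {poly R}) :
  arcsine_mean (horner q) = \sum_(i < size q) q`_i * wallis i.
Proof.
have h m (c : nat -> R) :
    {within `[0, 1], continuous (fun x : R => \sum_(i < m) c i * x ^+ i)} /\
    arcsine_mean (fun x : R => \sum_(i < m) c i * x ^+ i) = \sum_(i < m) c i * wallis i.
  have cX k : {within `[0, 1], continuous (fun x : R => x ^+ k)}.
    by apply: continuous_subspaceT; exact: exprn_continuous.
  have cZ (a : R) k : {within `[0, 1], continuous (fun x : R => a * x ^+ k)}.
    by apply: continuous_subspaceT => x; apply: cvgMl_tmp; exact: exprn_continuous.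
  elim: m => [|m [IHc IH]].
    have -> : (fun x : R => \sum_(i < 0) c i * x ^+ i) = (fun x => 0 * x ^+ 0).
      by apply/funext => x; rewrite big_ord0 mul0r.
    by split; [exact: cZ|rewrite arcsine_meanZ ?mul0r ?big_ord0//; exact: cX].
  have -> : (fun x : R => \sum_(i < m.+1) c i * x ^+ i) =
      (fun x => \sum_(i < m) c i * x ^+ i + c m * x ^+ m).
    by apply/funext => x; rewrite big_ord_recr.
  split; first by move=> x; apply: cvgD; [exact: IHc|exact: cZ].
  rewrite (arcsine_meanD IHc (@cZ (c m) m)).
  rewrite (arcsine_meanZ _ (@cX m)) IH arcsine_moment.
  by rewrite [RHS]big_ord_recr.
have -> : horner q = (fun x : R => \sum_(i < size q) q`_i * x ^+ i).
  by apply/funext => x; rewrite horner_coef.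
exact: (h _ (fun i => q`_i)).2.
Qed.

Lemma arcsine_mean_le (f g : R -> R) : {within `[0, 1], continuous f} ->
  {within `[0, 1], continuous g} -> (forall x, 0 <= x <= 1 -> f x <= g x) ->
  arcsine_mean f <= arcsine_mean g.
Proof.
move=> cf cg fg.
by apply: (le_Rintegral _ (integrable_arcsine_prob cf) (integrable_arcsine_prob cg)).
Qed.

Lemma arcsine_mean_dist (f : R -> R) (q : {poly R}) e : {within `[0, 1], continuous f} ->
  (forall x, 0 <= x <= 1 -> `|f x - q.[x]| <= e) ->
  `|arcsine_mean f - arcsine_mean (horner q)| <= e.
Proof.
move=> cf h; have cq : {within `[0, 1], continuous (horner q)} by exact: continuous_within_horner.
have c1 : {within `[0, 1], continuous (horner e%:P)} by exact: continuous_within_horner.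
have E1 : arcsine_mean (horner e%:P) = e.
  have -> : horner e%:P = (fun x => e * x ^+ 0).
    by apply/funext => x; rewrite hornerC expr0 mulr1.
  rewrite arcsine_meanZ ?arcsine_moment ?mulr1//.
  by apply: continuous_subspaceT; exact: exprn_continuous.
have le1 : arcsine_mean f <= arcsine_mean (fun x => q.[x] + (e%:P).[x]).
  apply: arcsine_mean_le => //; first by move=> x; apply: cvgD; [exact: cq|exact: c1].
  by move=> x /h; rewrite hornerC ler_norml; lra.
have le2 : arcsine_mean (horner q) <= arcsine_mean (fun x => f x + (e%:P).[x]).
  apply: arcsine_mean_le => //; first by move=> x; apply: cvgD; [exact: cf|exact: c1].
  by move=> x /h; rewrite hornerC ler_norml; lra.
move: le1 le2; rewrite !arcsine_meanD// E1 ler_norml.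
move: (arcsine_mean f) (arcsine_mean _) => a b; lra.
Qed.

Lemma coefficient_mean_cvg (f : R -> R) : {within `[0, 1], continuous f} ->
  coefficient_mean v n f @[n --> \oo] --> arcsine_mean f.
Proof.
move=> cf; apply/cvgrPdist_le => /= e e0.
have e4 : 0 < e / 4 by lra.
have [q hq] := weierstrass cf e4.
have ap := arcsine_mean_dist cf hq.
have : coefficient_mean v n (horner q) @[n --> \oo] --> arcsine_mean (horner q).
  rewrite arcsine_mean_poly; under eq_fun do rewrite coefficient_mean_poly.
  apply: (@cvg_sum_ord _ (size q) (fun i n => q`_i * moment v n i) (fun i => q`_i * wallis i)).
  by move=> i _; apply: cvgMl_tmp; exact: (moment_cvg hP hv).
move=> /cvgrPdist_le /(_ _ e4) /=; apply: filterS => n hn.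
have := @coefficient_mean_bound _ P v hP hv n (fun x => f x - q.[x]) (- (e / 4)) (e / 4).
have hb x : 0 <= x <= 1 -> - (e / 4) <= f x - q.[x] <= e / 4.
  by move=> /hq; rewrite ler_norml.
move=> /(_ hb); rewrite coefficient_meanB.
move: ap hn; rewrite !ler_norml.
move: (arcsine_mean f) (arcsine_mean _) (coefficient_mean v n f) (coefficient_mean v n _) => a b c d; lra.
Qed.

End coefficient_measure.

Section energy_limit.
Context {R : realType} (P : nat -> {poly R}) (v : forall n, 'cV[R]_n.+1).
Hypothesis hP : orthogonal_polynomials P.
Hypothesis hv : fourier_coefficients P v.

Let ln4 : ln 4 = 2 * ln 2 :> R.
Proof. by rewrite (_ : 4 = 2 ^+ 2) ?lnXn// ?mulr_natl//; ring. Qed.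

Lemma energy_error n : (0 < n)%N ->
  `|energy v n - ln n%:R - (coefficient_mean v n entropy - 1)| <=
  7 * (ln n.+1%:R * harmonic n) + (2 - 2 * log_kernel 0) * harmonic n.
Proof.
move=> n0; have := energy_mean_dist hP hv n0.
have := coefficient_mean_bound hP hv n entropy_bounds.
have l0 : 0 <= ln n%:R :> R by rewrite ln_ge0// ler1n.
have l1 : ln n%:R <= ln n.+1%:R :> R by rewrite ler_ln ?posrE ?ltr0n// ler_nat.
have e : n%:R = n.+1%:R - 1 :> R by rewrite -[n.+1%:R]natr1 addrK.
have N0 : 0 < n.+1%:R :> R by [].
rewrite [X in `|_ - X * _|]e.
have -> : 7 * (ln n.+1%:R * harmonic n) + (2 - 2 * log_kernel 0) * harmonic n =
   (7 * ln n.+1%:R + (2 - 2 * log_kernel 0)) / n.+1%:R :> R by rewrite /harmonic/=; ring.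
move: (n.+1%:R) N0 (ln n%:R) (ln n.+1%:R) l0 l1 (energy v n) (coefficient_mean v n entropy) (log_kernel 0).
move=> N N0 l L l0 l1 E x A x01 h.
rewrite ler_pdivlMr// -{1}(gtr0_norm N0) -normrM.
(* Exchanging n for N = n+1 costs one further term ln n + entropy - 1, at most ln N + 2 in absolute
   value: hence 7 = 6 + 1 and the 2. *)
have -> : (E - l - (x - 1)) * N = (N * E - (N - 1) * (l + x - 1)) - (l + x - 1) by ring.
move: h; rewrite !ler_norml; move: (N * E - _) => z; lra.
Qed.

Lemma energy_cvg : energy v n - ln n%:R @[n --> \oo] --> - ln 4.
Proof.
have err : energy v n - ln n%:R - (coefficient_mean v n entropy - 1) @[n --> \oo] --> (0 : R).
  apply/norm_cvg0P.
  apply: (@squeeze_cvgr _ _ _ _ (fun=> 0)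
    (fun n => 7 * (ln n.+1%:R * harmonic n) + (2 - 2 * log_kernel 0) * harmonic n)).
  - by near=> n; rewrite normr_ge0/= energy_error//; near: n; exact: nbhs_infty_gt.
  - exact: cvg_cst.
  - rewrite -[X in _ --> X](addr0 0) -[X in _ --> X + _](mulr0 7).
    rewrite -[X in _ --> _ + X](mulr0 (2 - 2 * log_kernel 0)).
    apply: cvgD; apply: cvgMl_tmp; [exact: cvg_ln_harmonic|exact: cvg_harmonic].
have ent : coefficient_mean v n entropy - 1 @[n --> \oo] --> arcsine_mean (@entropy R) - 1.
  apply: cvgB; last exact: cvg_cst.
  apply: (coefficient_mean_cvg hP hv).
  by apply: continuous_subspaceT; exact: continuous_entropy.
have -> : - ln 4 = 0 + (arcsine_mean (@entropy R) - 1) :> R.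
  by rewrite arcsine_mean_entropy ln4; ring.
have -> : (fun n => energy v n - ln n%:R) =
    (fun n => energy v n - ln n%:R - (coefficient_mean v n entropy - 1) +
      (coefficient_mean v n entropy - 1)).
  by apply/funext => n; rewrite subrK.
exact: cvgD.
Unshelve. all: end_near. Qed.

End energy_limit.

Theorem theorem1p2 (R : realType) (P : nat -> {poly R})
    (v : forall n, 'cV[R]_n.+1)
    (hP : orthogonal_polynomials P) (hv : fourier_coefficients P v) :
  [/\ increasing_seq (energy v),
      energy v n - (ln n%:R - ln 4) @[n --> \oo] --> 0,
      n%:R * energy_radius v n @[n --> \oo] --> 8 * pi
    & exists xi : nat -> probability R R,
        coefficient_measures v xi /\ weakly_converges01 xi arcsine_prob].
Proof.
have E := energy_cvg hP hv.
split.
- by apply/increasing_seqP => n; exact: energy_ltS hP hv n.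
- rewrite -[X in _ --> X](addNr (ln 4)).
  have -> : (fun n => energy v n - (ln n%:R - ln 4)) = (fun n => energy v n - ln n%:R + ln 4).
    by apply/funext => n; rewrite opprB addrA addrAC.
  by apply: cvgD => //; exact: cvg_cst.
- have c : 2 * pi * expR (- (energy v n - ln n%:R)) @[n --> \oo] --> 2 * pi * expR (- - ln 4 : R).
    apply: cvgMl_tmp; apply: (@cvg_comp _ _ _ (fun n => - (energy v n - ln n%:R)) (@expR R) _ (nbhs (- - ln 4 : R))).
      exact: cvgN.
    exact: continuous_expR.
  have -> : 8 * pi = 2 * pi * expR (- - ln 4) :> R by rewrite opprK lnK ?posrE//; ring.
  (* Writing n as exp(ln n) needs n > 0, so the two sequences agree only eventually. *)
  apply: cvg_trans c; apply: near_eq_cvg; near=> n.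
  have n0 : (0 < n)%N by near: n; exact: nbhs_infty_gt.
  rewrite /energy_radius opprB expRD lnK ?posrE ?ltr0n//.
  by rewrite [RHS]mulrCA.
- exists (fun n => coefficient_measure hP hv n); split.
    by move=> n _ A mA; exact: coefficient_measureE.
  move=> f cf; have mf := measurable_within cf.
  have -> : (\int[arcsine_prob]_(x in `[0%R, 1%R]) (f x)%:E)%E = (arcsine_mean f)%:E.
    by rewrite /arcsine_mean fineK//; apply: integrable_fin_num => //; exact: integrable_arcsine_prob.
  under eq_fun do rewrite integral_coefficient//.
  by apply: cvg_EFin; [exact: nearW|exact: coefficient_mean_cvg hP hv f cf].
Unshelve. all: end_near. Qed.
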